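(* Let $(A,\Delta)$ be a $C^{*}$-bialgebra, where $A$ has the slice map property, and let $\delta_C$ be an injective, regular partial coaction of $(A,\Delta)$ on a $C^{*}$-algebra $C$. Denote by $\mathfrak{G}(C)\subseteq M(C\otimes A)$ the $C^{*}$-subalgebra generated by $$\{(\mathrm{id}_C\otimes\mathrm{id}_A\otimes\omega)(\mathrm{id}_C\otimes\Delta)\delta_C(c):\omega\in A^{*},\,c\in C\}\quad\text{and}\quad \delta_C(C).$$ Then $\mathrm{id}_C\otimes\Delta$ restricts to a coaction of $(A,\Delta)$ on $\mathfrak{G}(C)$, and $\mathfrak{G}(\delta_C):=(\mathfrak{G}(C),\mathrm{id}_C\otimes\Delta,\delta_C)$ is a minimal dilation of $\delta_C$.
   Context: Conventions: tensor products of $C^{*}$-algebras are minimal; $M(A)$ is the multiplier algebra with unit $1_A$; $A^{*}$ is the space of bounded linear functionals. Maps on tensor products are extended to multipliers in the usual way. A $C^{*}$-bialgebra is a $C^{*}$-algebra $A$ with a nondegenerate $*$-homomorphism $\Delta\colon A\to M(A\otimes A)$ such that $(\Delta\otimes \mathrm{id}_A)\Delta=(\mathrm{id}_A\otimes\Delta)\Delta$. $A$ has the slice map property if for every $C^{*}$-algebra $B$ and every $C^{*}$-subalgebra $C\subseteq B$, every $x\in B\otimes A$ with $(\mathrm{id}\otimes\omega)(x)\in C$ for all $\omega\in A^{*}$ lies in $C\otimes A$. A $*$-homomorphism $\pi\colon B\to M(C)$ is strict if it is strictly continuous on the unit ball; it then extends to a $*$-homomorphism $M(B)\to M(C)$,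 strictly continuous on the unit ball, also denoted $\pi$. A partial coaction of $(A,\Delta)$ on a $C^{*}$-algebra $C$ is a strict $*$-homomorphism $\delta\colon C\to M(C\otimes A)$ with $\delta(C)(1_C\otimes A)\subseteq C\otimes A$ and $(\delta\otimes\mathrm{id}_A)\delta(c)=(\delta(1_C)\otimes 1_A)(\mathrm{id}_C\otimes\Delta)\delta(c)$ for all $c\in C$. It is regular if $(\mathrm{id}_C\otimes\Delta)(\delta(C))\cdot(1_C\otimes 1_A\otimes A)\subseteq M(C\otimes A)\otimes A$. A coaction of $(A,\Delta)$ on a $C^{*}$-algebra $B$ is an injective $*$-homomorphism $\delta_B\colon B\to M(B\otimes A)$ with $\delta_B(B)(1_B\otimes A)\subseteq B\otimes A$ and $(\delta_B\otimes\mathrm{id}_A)\delta_B=(\mathrm{id}_B\otimes\Delta)\delta_B$, i.e. $(\delta_B\otimes\mathrm{id}_A)(\delta_B(b)(1_B\otimes a))=(\mathrm{id}_B\otimes\Delta)(\delta_B(b))(1_B\otimes 1_A\otimes a)$ for all $b\in B,a\in A$. Write $\omega\triangleright b:=(\mathrm{id}_B\otimes\omega)\delta_B(b)$ for $\omega\in A^{*}$. A dilation of a partial coaction $\delta_C$ on $C$ is a triple $(B,\delta_B,\iota)$ of a $C^{*}$-algebra $B$, a coaction $\delta_B$ of $(A,\Delta)$ on $B$ and an injective $*$-homomorphism $\iota\colon C\to B$ with $\delta_B(\iota(c))(\iota(c')\otimes a)=(\iota\otimes\mathrm{id}_A)(\delta_C(c)(c'\otimes a))$ for all $c,c'\in C$,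 $a\in A$. It is minimal if $\iota(C)$ and $A^{*}\triangleright\iota(C)$ generate $B$ as a $C^{*}$-algebra. *)

(* Defs.v *)
From HB Require Import structures.
From mathcomp Require Import all_boot all_order all_algebra.
From mathcomp Require Import complex.
From mathcomp Require Import all_classical all_reals all_analysis.

Set Implicit Arguments.
Unset Strict Implicit.
Unset Printing Implicit Defensive.

Import Order.TTheory GRing.Theory Num.Theory.
Import numFieldNormedType.Exports.

Local Open Scope classical_set_scope.
Local Open Scope ring_scope.

HB.mixin Record CompleteNormedModule_isHilbert (R : realType) H
    & CompleteNormedModule R[i] H := {
  hip : H -> H -> R[i];
  hip_linear : forall (k : R[i]) (x y z : H),
    hip (k *: x + y) z = k * hip x z + hip y z;
  hip_herm : forall x y : H, hip y x = (hip x y)^*;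
  hip_norm : forall x : H, hip x x = `|x| ^+ 2
}.

#[short(type="hilbertType")]
HB.structure Definition Hilbert (R : realType) :=
  {H of CompleteNormedModule R[i] H & CompleteNormedModule_isHilbert R H}.

(* C*-algebras are not assumed unital, so the product cannot come from the
   (unital) ring structures of MathComp. *)
HB.mixin Record CompleteNormedModule_isCStar (R : realType) A
    & CompleteNormedModule R[i] A := {
  amul : A -> A -> A;
  star : A -> A;
  amulA : associative amul;
  amulDl : left_distributive amul +%R;
  amulDr : right_distributive amul +%R;
  amulZl : forall (k : R[i]) (a b : A), amul (k *: a) b = k *: amul a b;
  amulZr : forall (k : R[i]) (a b : A), amul a (k *: b) = k *: amul a b;
  starK : involutive star;
  starD : {morph star : a b / a + b};
  starZ : forall (k : R[i]) (a : A), star (k *: a) = k^* *: star a;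
  starM : forall a b : A, star (amul a b) = amul (star b) (star a);
  norm_amul : forall a b : A, `|amul a b| <= `|a| * `|b|;
  cstar_norm : forall a : A, `|amul (star a) a| = `|a| ^+ 2
}.

#[short(type="cstarType")]
HB.structure Definition CStar (R : realType) :=
  {A of CompleteNormedModule R[i] A & CompleteNormedModule_isCStar R A}.

Declare Scope cstar_scope.
Delimit Scope cstar_scope with C_star.
Notation "a ** b" := (amul a b) (at level 40, left associativity) : cstar_scope.
Local Open Scope cstar_scope.

HB.factory Record Lmodule_isCStar (R : realType) A & GRing.Lmodule R[i] A := {
  cnorm : A -> R[i];
  ler_cnormD : forall x y, cnorm (x + y) <= cnorm x + cnorm y;
  cnormZ : forall (k : R[i]) (x : A), cnorm (k *: x) = `|k| * cnorm x;
  cnorm0_eq0 : forall x : A, cnorm x = 0 -> x = 0;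
  cnorm_complete : forall F : set_system A, ProperFilter F ->
    (forall e, 0 < e -> exists x, F [set y | cnorm (x - y) < e]) ->
    exists l, forall e, 0 < e -> F [set y | cnorm (l - y) < e];
  cmul : A -> A -> A;
  cstar : A -> A;
  cmulA : associative cmul;
  cmulDl : left_distributive cmul +%R;
  cmulDr : right_distributive cmul +%R;
  cmulZl : forall (k : R[i]) (a b : A), cmul (k *: a) b = k *: cmul a b;
  cmulZr : forall (k : R[i]) (a b : A), cmul a (k *: b) = k *: cmul a b;
  cstarK : involutive cstar;
  cstarD : {morph cstar : a b / a + b};
  cstarZ : forall (k : R[i]) (a : A), cstar (k *: a) = k^* *: cstar a;
  cstarM : forall a b : A, cstar (cmul a b) = cmul (cstar b) (cstar a);
  cnorm_cmul : forall a b : A, cnorm (cmul a b) <= cnorm a * cnorm b;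
  cnorm_cstar : forall a : A, cnorm (cmul (cstar a) a) = cnorm a ^+ 2
}.

HB.builders Context R A & Lmodule_isCStar R A.

HB.instance Definition _ :=
  Lmodule_isNormed.Build R[i] A ler_cnormD cnormZ cnorm0_eq0.

Let complete_A (F : set_system A) : ProperFilter F -> cauchy F -> cvg F.
Proof.
move=> FF /cauchy_ballP Fc.
have /(cnorm_complete FF)[l Fl] : forall e, 0 < e ->
    exists x, F [set y | cnorm (x - y) < e].
  move=> e e0; have /cauchyP /(_ e e0) [x Fx] : cauchy F by apply/cauchy_ballP.
  by exists x; move: Fx; rewrite -ball_normE.
by apply/cvg_ex; exists l; apply/cvgrPdist_lt => e e0; exact: Fl.
Qed.

HB.instance Definition _ := Uniform_isComplete.Build A complete_A.

HB.instance Definition _ := @CompleteNormedModule_isCStar.Build R A cmul cstar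
  cmulA cmulDl cmulDr cmulZl cmulZr cstarK cstarD cstarZ cstarM
  cnorm_cmul cnorm_cstar.

HB.end.

Section CStarTheory.
Variables (R : realType) (A : cstarType R).
Implicit Types a b c : A.

Lemma amul0l a : 0 ** a = 0.
Proof. by have := amulZl 0 (0 : A) a; rewrite !scale0r. Qed.

Lemma amul0r a : a ** 0 = 0.
Proof. by have := amulZr 0 a (0 : A); rewrite !scale0r. Qed.

Lemma amulNl a b : (- a) ** b = - (a ** b).
Proof. by rewrite -scaleN1r amulZl scaleN1r. Qed.

Lemma amulNr a b : a ** (- b) = - (a ** b).
Proof. by rewrite -scaleN1r amulZr scaleN1r. Qed.

Lemma amulBl a b c : (a - b) ** c = a ** c - b ** c.
Proof. by rewrite amulDl amulNl. Qed.

Lemma amulBr a b c : c ** (a - b) = c ** a - c ** b.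
Proof. by rewrite amulDr amulNr. Qed.

Lemma star0 : star (0 : A) = 0.
Proof. by have := starZ 0 (0 : A); rewrite conjC0 !scale0r. Qed.

Lemma starN a : star (- a) = - star a.
Proof. by rewrite -scaleN1r starZ rmorphN1 scaleN1r. Qed.

Lemma starB a b : star (a - b) = star a - star b.
Proof. by rewrite starD starN. Qed.

Lemma norm_star_le a : `|a| <= `|star a|.
Proof.
have [->|a0] := eqVneq a 0; first by rewrite star0.
have a1 : 0 < `|a| by rewrite normr_gt0.
by rewrite -(ler_pM2r a1) -expr2 -cstar_norm norm_amul.
Qed.

Lemma norm_star a : `|star a| = `|a|.
Proof.
by apply/eqP; rewrite eq_le norm_star_le andbT -{2}(starK a) norm_star_le.
Qed.

Lemma cstar_norm_r a : `|a ** star a| = `|a| ^+ 2.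
Proof. by have := cstar_norm (star a); rewrite starK norm_star. Qed.

Lemma amul_eq0l a : (forall c, c ** a = 0) -> a = 0.
Proof.
move=> /(_ (star a)) h; have := cstar_norm a; rewrite h normr0 => /esym/eqP.
by rewrite sqrf_eq0 normr_eq0 => /eqP.
Qed.

Lemma amul_eq0r a : (forall c, a ** c = 0) -> a = 0.
Proof.
move=> /(_ (star a)) h; have := cstar_norm_r a; rewrite h normr0 => /esym/eqP.
by rewrite sqrf_eq0 normr_eq0 => /eqP.
Qed.

End CStarTheory.

Definition bounded_op (K : numFieldType) (V W : normedModType K) (f : V -> W) :=
  exists M : K, forall x, `|f x| <= M * `|x|.

(* M(A) is realised as the algebra of double centralizers (x . _, _ . x). *)
Definition is_multiplier (R : realType) (A : cstarType R) (l r : A -> A) :=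
  [/\ linear l /\ linear r,
      bounded_op l /\ bounded_op r,
      forall a b, l (a ** b) = l a ** b,
      forall a b, r (a ** b) = a ** r b
    & forall a b, a ** l b = r a ** b].

Record multiplier (R : realType) (A : cstarType R) := Multiplier {
  lmul : A -> A;
  rmul : A -> A;
  multiplierP : is_multiplier lmul rmul
}.

Section Multiplier.
Variables (R : realType) (A : cstarType R).
Notation M := (multiplier A).
Implicit Types (x y z : M) (a b c : A).

Lemma multiplier_eq x y :
  (forall a, lmul x a = lmul y a) -> (forall a, rmul x a = rmul y a) -> x = y.
Proof.
case: x y => [l r h] [l' r' h'] /= /funext e1 /funext e2.
by subst l' r'; congr Multiplier; exact: Prop_irrelevance.
Qed.

Lemma lmul_linear x : linear (lmul x).
Proof. by case: (multiplierP x) => -[]. Qed.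

Lemma rmul_linear x : linear (rmul x).
Proof. by case: (multiplierP x) => -[]. Qed.

HB.instance Definition _ x := GRing.isLinear.Build R[i] A A *:%R (lmul x)
  (lmul_linear x).
HB.instance Definition _ x := GRing.isLinear.Build R[i] A A *:%R (rmul x)
  (rmul_linear x).

Lemma lmulM x a b : lmul x (a ** b) = lmul x a ** b.
Proof. by case: (multiplierP x). Qed.

Lemma rmulM x a b : rmul x (a ** b) = a ** rmul x b.
Proof. by case: (multiplierP x). Qed.

Lemma lrmul x a b : a ** lmul x b = rmul x a ** b.
Proof. by case: (multiplierP x). Qed.

Lemma lmul_bounded x : bounded_op (lmul x).
Proof. by case: (multiplierP x) => _ []. Qed.

Lemma rmul_bounded x : bounded_op (rmul x).
Proof. by case: (multiplierP x) => _ []. Qed.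

Lemma bounded_opD (f g : A -> A) :
  bounded_op f -> bounded_op g -> bounded_op (f \+ g).
Proof.
move=> [m fm] [n gn]; exists (m + n) => a /=.
by rewrite mulrDl (le_trans (ler_normD _ _)) // lerD.
Qed.

Lemma bounded_opZ k (f : A -> A) : bounded_op f -> bounded_op (k \*: f).
Proof.
move=> [m fm]; exists (`|k| * m) => a /=.
by rewrite normrZ -mulrA ler_wpM2l.
Qed.

Lemma bounded_op_comp (f g : A -> A) :
  bounded_op f -> bounded_op g -> bounded_op (f \o g).
Proof.
move=> [m fm] [n gn]; exists (`|m| * n) => a /=.
have h b : `|f b| <= `|m| * `|b|.
  have mb : m * `|b| \is Num.real by apply: ger0_real (le_trans _ (fm b)).
  rewrite (le_trans (fm b)) // (le_trans (real_ler_norm mb)) //.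
  by rewrite normrM normr_id.
by rewrite (le_trans (h _)) // -mulrA ler_wpM2l.
Qed.

Lemma bounded_op_star (f : A -> A) :
  bounded_op f -> bounded_op (fun a => star (f (star a))).
Proof. by move=> [m fm]; exists m => a; rewrite norm_star -(norm_star a). Qed.

Fact madd_subproof x y : is_multiplier (lmul x \+ lmul y) (rmul x \+ rmul y).
Proof.
split.
- by split=> k a b /=; rewrite !linearP scalerDr addrACA.
- by split; apply: bounded_opD;
    solve [exact: lmul_bounded | exact: rmul_bounded].
- by move=> a b /=; rewrite !lmulM amulDl.
- by move=> a b /=; rewrite !rmulM amulDr.
- by move=> a b /=; rewrite amulDr amulDl !lrmul.
Qed.
Definition madd x y := Multiplier (madd_subproof x y).

Fact mscale_subproof k x : is_multiplier (k \*: lmul x) (k \*: rmul x).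
Proof.
split.
- by split=> l a b /=; rewrite !linearP.
- by split; apply: bounded_opZ;
    solve [exact: lmul_bounded | exact: rmul_bounded].
- by move=> a b /=; rewrite !lmulM amulZl.
- by move=> a b /=; rewrite !rmulM amulZr.
- by move=> a b /=; rewrite amulZr amulZl lrmul.
Qed.
Definition mscale k x := Multiplier (mscale_subproof k x).

Fact memb_subproof a : is_multiplier (fun b => a ** b) (fun b => b ** a).
Proof.
split.
- by split=> k b c; rewrite ?amulDr ?amulDl ?amulZr ?amulZl.
- by split; exists `|a| => b; rewrite ?norm_amul // mulrC norm_amul.
- by move=> b c; rewrite amulA.
- by move=> b c; rewrite amulA.
- by move=> b c; rewrite amulA.
Qed.

(* the inclusion of A into M(A) *)
Definition memb a : M := Multiplier (memb_subproof a).

Fact mone_subproof : @is_multiplier R A idfun idfun.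
Proof. by split=> //; split=> //; exists 1 => a; rewrite mul1r. Qed.
Definition mone : M := Multiplier mone_subproof.

Fact mmul_subproof x y : is_multiplier (lmul x \o lmul y) (rmul y \o rmul x).
Proof.
split.
- by split=> k a b /=; rewrite !linearP.
- by split; apply: bounded_op_comp;
    solve [exact: lmul_bounded | exact: rmul_bounded].
- by move=> a b /=; rewrite !lmulM.
- by move=> a b /=; rewrite !rmulM.
- by move=> a b /=; rewrite !lrmul.
Qed.
Definition mmul x y := Multiplier (mmul_subproof x y).

Fact mstar_subproof x :
  is_multiplier (fun a => star (rmul x (star a)))
                (fun a => star (lmul x (star a))).
Proof.
split.
- by split=> k a b; rewrite starD starZ linearP starD starZ conjCK.
- by split; apply: bounded_op_star;
    solve [exact: lmul_bounded | exact: rmul_bounded].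
- by move=> a b; rewrite starM rmulM starM starK.
- by move=> a b; rewrite starM lmulM starM starK.
- by move=> a b; apply: (can_inj (@starK _ A)); rewrite !starM !starK lrmul.
Qed.
Definition mstar x := Multiplier (mstar_subproof x).

HB.instance Definition _ := gen_eqMixin M.
HB.instance Definition _ := gen_choiceMixin M.

Fact maddA : associative madd.
Proof. by move=> x y z; apply: multiplier_eq => a /=; rewrite addrA. Qed.
Fact maddC : commutative madd.
Proof. by move=> x y; apply: multiplier_eq => a /=; rewrite addrC. Qed.
Fact madd0 : left_id (memb 0) madd.
Proof.
by move=> x; apply: multiplier_eq => a /=; rewrite ?amul0l ?amul0r add0r.
Qed.
Fact maddN : left_inverse (memb 0) (mscale (-1)) madd.
Proof.
by move=> x; apply: multiplier_eq => a /=;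
  rewrite scaleN1r addNr ?amul0l ?amul0r.
Qed.
HB.instance Definition _ := GRing.isZmodule.Build M maddA maddC madd0 maddN.

Fact mscaleA (k l : R[i]) x : mscale k (mscale l x) = mscale (k * l) x.
Proof. by apply: multiplier_eq => a /=; rewrite scalerA. Qed.
Fact mscale1 : left_id 1 mscale.
Proof. by move=> x; apply: multiplier_eq => a /=; rewrite scale1r. Qed.
Fact mscaleDr : right_distributive mscale +%R.
Proof. by move=> k x y; apply: multiplier_eq => a /=; rewrite scalerDr. Qed.
Fact mscaleDl x : {morph mscale^~ x : k l / k + l}.
Proof. by move=> k l; apply: multiplier_eq => a /=; rewrite scalerDl. Qed.
HB.instance Definition _ :=
  GRing.Zmodule_isLmodule.Build R[i] M mscaleA mscale1 mscaleDr mscaleDl.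

Definition mnorm x : R[i] :=
  (sup [set complex.Re `|lmul x a| | a in [set a : A | `|a| <= 1]])%:C%C.

Lemma ReK (k : R[i]) : 0 <= k -> (complex.Re k)%:C%C = k.
Proof.
by move=> k0; rewrite RRe_real // ger0_real.
Qed.

Lemma mnormP x (k : R[i]) : 0 <= k ->
  (mnorm x <= k <-> forall a, `|lmul x a| <= k * `|a|).
Proof.
move=> k0; rewrite /mnorm; set S := (X in sup X).
have S0 : S !=set0 by exists (complex.Re `|lmul x 0|), 0; rewrite //= normr0.
have [m hm] := lmul_bounded x.
have Sub : has_ubound S.
  exists (complex.Re `|m|) => _ [a /= a1 <-].
  rewrite -lecR !ReK // (le_trans (hm a)) //.
  have ma : m * `|a| \is Num.real by apply: ger0_real (le_trans _ (hm a)).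
  rewrite (le_trans (real_ler_norm ma)) // normrM normr_id.
  by rewrite -[leRHS]mulr1 ler_wpM2l.
split=> [h a|h].
  have [->|a0] := eqVneq a 0; first by rewrite linear0 !normr0 mulr0.
  have na : 0 < `|a| by rewrite normr_gt0.
  have : S (complex.Re `|lmul x (`|a|^-1 *: a)|).
    by exists (`|a|^-1 *: a); rewrite //= normfZV.
  move=> /(ub_le_sup Sub); rewrite -lecR => /le_trans/(_ h).
  rewrite ReK // linearZ /= normrZ normfV normr_id.
  by rewrite ler_pdivrMl // mulrC.
rewrite -(ReK k0) lecR; apply: ge_sup => // _ [a /= a1 <-].
rewrite -lecR !ReK // (le_trans (h a)) //.
by rewrite -[leRHS]mulr1 ler_wpM2l.
Qed.

Lemma mnorm_ge0 x : 0 <= mnorm x.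
Proof.
have [m hm] := lmul_bounded x.
rewrite /mnorm (_ : 0 = (0 : R)%:C%C) // lecR.
set S := (X in sup X).
have Sub : has_ubound S.
  exists (complex.Re `|m|) => _ [a /= a1 <-].
  rewrite -lecR !ReK // (le_trans (hm a)) //.
  have ma : m * `|a| \is Num.real by apply: ger0_real (le_trans _ (hm a)).
  rewrite (le_trans (real_ler_norm ma)) // normrM normr_id.
  by rewrite -[leRHS]mulr1 ler_wpM2l.
by apply: (ub_le_sup Sub); exists 0; rewrite /= ?linear0 normr0.
Qed.

Lemma le_mnorm x a : `|lmul x a| <= mnorm x * `|a|.
Proof. by apply: (mnormP x (mnorm_ge0 x)).1. Qed.

Lemma le_mnorm_r x a : `|rmul x a| <= mnorm x * `|a|.
Proof.
have [->|r0] := eqVneq (rmul x a) 0.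
  by rewrite normr0 mulr_ge0 // mnorm_ge0.
have nr : 0 < `|rmul x a| by rewrite normr_gt0.
rewrite -(ler_pM2r nr) -expr2 -cstar_norm_r -lrmul.
rewrite (le_trans (norm_amul _ _)) // [mnorm x * _]mulrC -mulrA ler_wpM2l //.
by rewrite (le_trans (le_mnorm _ _)) // norm_star.
Qed.

Fact mnormD x y : mnorm (x + y) <= mnorm x + mnorm y.
Proof.
apply/mnormP => [|a]; first by rewrite addr_ge0 // mnorm_ge0.
by rewrite (le_trans (ler_normD _ _)) // mulrDl lerD // le_mnorm.
Qed.

Lemma mnormZ_le k x : mnorm (k *: x) <= `|k| * mnorm x.
Proof.
apply/mnormP => [|a]; first by rewrite mulr_ge0 // mnorm_ge0.
by rewrite /= normrZ -mulrA ler_wpM2l // le_mnorm.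
Qed.

Fact mnormZ k x : mnorm (k *: x) = `|k| * mnorm x.
Proof.
apply/eqP; rewrite eq_le mnormZ_le /=.
have [->|k0] := eqVneq k 0; first by rewrite normr0 mul0r mnorm_ge0.
rewrite -ler_pdivlMl ?normr_gt0 // -normfV.
by rewrite (le_trans _ (mnormZ_le _ _)) // scalerA mulVf // scale1r.
Qed.

Fact mnorm0_eq0 x : mnorm x = 0 -> x = 0.
Proof.
move=> x0; apply: multiplier_eq => a /=; rewrite ?amul0l ?amul0r.
  by apply/eqP; rewrite -normr_le0 (le_trans (le_mnorm x a)) // x0 mul0r.
by apply/eqP; rewrite -normr_le0 (le_trans (le_mnorm_r x a)) // x0 mul0r.
Qed.

Fact mmulA : associative mmul.
Proof. by move=> x y z; apply: multiplier_eq. Qed.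
Fact mmulDl : left_distributive mmul +%R.
Proof. by move=> x y z; apply: multiplier_eq => a //=; rewrite linearD. Qed.
Fact mmulDr : right_distributive mmul +%R.
Proof. by move=> x y z; apply: multiplier_eq => a //=; rewrite linearD. Qed.
Fact mmulZl k x y : mmul (k *: x) y = k *: mmul x y.
Proof. by apply: multiplier_eq => a //=; rewrite linearZ. Qed.
Fact mmulZr k x y : mmul x (k *: y) = k *: mmul x y.
Proof. by apply: multiplier_eq => a //=; rewrite linearZ. Qed.
Fact mstarK : involutive mstar.
Proof. by move=> x; apply: multiplier_eq => a /=; rewrite !starK. Qed.
Fact mstarD : {morph mstar : x y / x + y}.
Proof. by move=> x y; apply: multiplier_eq => a /=; rewrite starD. Qed.
Fact mstarZ (k : R[i]) x : mstar (k *: x) = k^* *: mstar x.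
Proof. by apply: multiplier_eq => a /=; rewrite starZ. Qed.
Fact mstarM x y : mstar (mmul x y) = mmul (mstar y) (mstar x).
Proof. by apply: multiplier_eq => a /=; rewrite starK. Qed.

Fact mnormM x y : mnorm (mmul x y) <= mnorm x * mnorm y.
Proof.
apply/mnormP => [|a]; first by rewrite mulr_ge0 // mnorm_ge0.
by rewrite /= (le_trans (le_mnorm _ _)) // -mulrA ler_wpM2l ?mnorm_ge0 ?le_mnorm.
Qed.

Lemma mnorm_star_le x : mnorm (mstar x) <= mnorm x.
Proof.
apply/mnormP => [|a]; first exact: mnorm_ge0.
by rewrite /= norm_star (le_trans (le_mnorm_r _ _)) // norm_star.
Qed.

Fact mnorm_cstar x : mnorm (mmul (mstar x) x) = mnorm x ^+ 2.
Proof.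
apply/eqP; rewrite eq_le; apply/andP; split.
  by rewrite (le_trans (mnormM _ _)) // expr2 ler_wpM2r ?mnorm_ge0 ?mnorm_star_le.
set n := mnorm (mmul _ _).
have n0 : 0 <= n by apply: mnorm_ge0.
rewrite -(sqrtCK n) lerXn2r ?nnegrE ?sqrtC_ge0 ?mnorm_ge0 //.
apply/mnormP => [|a]; first by rewrite sqrtC_ge0.
rewrite -(@ler_pXn2r _ 2) ?nnegrE ?mulr_ge0 ?sqrtC_ge0 //.
rewrite exprMn sqrtCK -cstar_norm.
have -> : star (lmul x a) ** lmul x a = star a ** lmul (mmul (mstar x) x) a.
  by rewrite [RHS]lrmul /= !lrmul /= starK -lrmul.
rewrite (le_trans (norm_amul _ _)) // norm_star expr2 [n * _]mulrC -mulrA.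
by rewrite ler_wpM2l // mulrC le_mnorm.
Qed.

Lemma lmulB x y a : lmul (x - y) a = lmul x a - lmul y a.
Proof. by rewrite /= scaleN1r. Qed.

Lemma rmulB x y a : rmul (x - y) a = rmul x a - rmul y a.
Proof. by rewrite /= scaleN1r. Qed.

Section complete.
Variables (F : set_system M) (FF : ProperFilter F).
Hypothesis Fc : forall e, 0 < e -> exists x, F [set y | mnorm (x - y) < e].

(* evaluations at a point, left and right *)
Let controlled (f : M -> A) (a : A) :=
  forall x y, `|f x - f y| <= mnorm (x - y) * `|a|.

Let cvg_controlled f a : controlled f a -> cvg (f @ F).
Proof.
move=> hf; apply: cauchy_cvg; apply: cauchy_exP => e e0.
have a1 : 0 < `|a| + 1 by rewrite ltr_wpDl.
have [x Fx] := Fc (divr_gt0 e0 a1).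
exists (f x); rewrite /fmapE -ball_normE /ball_ /=.
apply: filterS Fx => y /=; rewrite ltr_pdivlMr // => xy.
rewrite (le_lt_trans (hf _ _)) // (le_lt_trans _ xy) //.
by rewrite ler_wpM2l ?mnorm_ge0 // lerDl.
Qed.

Let l a : A := lim ((fun x => lmul x a) @ F).
Let r a : A := lim ((fun x => rmul x a) @ F).

Let lE a : (fun x => lmul x a) @ F --> l a.
Proof.
by apply: (@cvg_controlled _ a) => x y; rewrite -lmulB le_mnorm.
Qed.

Let rE a : (fun x => rmul x a) @ F --> r a.
Proof.
by apply: (@cvg_controlled _ a) => x y; rewrite -rmulB le_mnorm_r.
Qed.

Let limE (f g : M -> A) (u v : A) :
  (forall x, f x = g x) -> f @ F --> u -> g @ F --> v -> u = v.
Proof.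
move=> /funext <- fu fv; exact: (@cvg_unique _ (@norm_hausdorff _ A) (f @ F)).
Qed.

Let cvg_amull c (f : M -> A) (u : A) : f @ F --> u -> (fun x => c ** f x) @ F --> c ** u.
Proof.
move=> /cvgrPdist_lt fu; apply/cvgrPdist_lt => e e0.
have c1 : 0 < `|c| + 1 by rewrite ltr_wpDl.
apply: filterS (fu _ (divr_gt0 e0 c1)) => x /=.
rewrite ltr_pdivlMr // => h; rewrite -amulBr (le_lt_trans (norm_amul _ _)) //.
by rewrite (le_lt_trans _ h) // mulrC ler_wpM2l // lerDl.
Qed.

Let cvg_amulr c (f : M -> A) (u : A) : f @ F --> u -> (fun x => f x ** c) @ F --> u ** c.
Proof.
move=> /cvgrPdist_lt fu; apply/cvgrPdist_lt => e e0.
have c1 : 0 < `|c| + 1 by rewrite ltr_wpDl.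
apply: filterS (fu _ (divr_gt0 e0 c1)) => x /=.
rewrite ltr_pdivlMr // => h; rewrite -amulBl (le_lt_trans (norm_amul _ _)) //.
by rewrite (le_lt_trans _ h) // ler_wpM2l // lerDl.
Qed.

Let dist_l e x : 0 < e -> F [set y | mnorm (x - y) < e] ->
  forall a, `|lmul x a - l a| <= e * `|a|.
Proof.
move=> e0 Fx a; apply/ler_addgt0Pr => d d0.
have /cvgrPdist_lt/(_ d d0) h := @lE a.
have [y [/= xy yl]] := filter_ex (filterI Fx h).
rewrite -(subrKA (lmul y a)) (le_trans (ler_normD _ _)) //.
rewrite lerD //; last by rewrite distrC ltW.
by rewrite -lmulB (le_trans (le_mnorm _ _)) // ler_wpM2r // ltW.
Qed.

Let dist_r e x : 0 < e -> F [set y | mnorm (x - y) < e] ->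
  forall a, `|rmul x a - r a| <= e * `|a|.
Proof.
move=> e0 Fx a; apply/ler_addgt0Pr => d d0.
have /cvgrPdist_lt/(_ d d0) h := @rE a.
have [y [/= xy yr]] := filter_ex (filterI Fx h).
rewrite -(subrKA (rmul y a)) (le_trans (ler_normD _ _)) //.
rewrite lerD //; last by rewrite distrC ltW.
by rewrite -rmulB (le_trans (le_mnorm_r _ _)) // ler_wpM2r // ltW.
Qed.

Let is_multiplier_lim : is_multiplier l r.
Proof.
have [x Fx] := Fc (@ltr01 R[i]).
split.
- split=> k a b.
    apply: (limE _ (@lE _) (cvgD (cvgZl_tmp (k := k) (@lE a)) (@lE b))) => y /=.
    by rewrite linearP.
  apply: (limE _ (@rE _) (cvgD (cvgZl_tmp (k := k) (@rE a)) (@rE b))) => y /=.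
  by rewrite linearP.
- split; exists (1 + mnorm x) => a.
    rewrite -[l a](subrK (lmul x a)) (le_trans (ler_normD _ _)) // mulrDl.
    by rewrite lerD // ?le_mnorm // distrC dist_l.
  rewrite -[r a](subrK (rmul x a)) (le_trans (ler_normD _ _)) // mulrDl.
  by rewrite lerD // ?le_mnorm_r // distrC dist_r.
- move=> a b; apply: (limE _ (@lE _) (@cvg_amulr b _ _ (@lE a))) => y; exact: lmulM.
- move=> a b; apply: (limE _ (@rE _) (@cvg_amull a _ _ (@rE b))) => y; exact: rmulM.
- move=> a b; apply: (limE _ (@cvg_amull a _ _ (@lE b)) (@cvg_amulr b _ _ (@rE a))) => y.
  exact: lrmul.
Qed.

Fact mnorm_complete : exists l, forall e, 0 < e -> F [set y | mnorm (l - y) < e].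
Proof.
pose m := Multiplier is_multiplier_lim; exists m => e e0.
have e4 : 0 < e / 4 by rewrite divr_gt0.
have [x Fx] := Fc e4.
have mx : mnorm (m - x) <= e / 4.
  apply/mnormP => [|a]; first exact: ltW.
  by rewrite lmulB distrC; exact: dist_l.
apply: filterS Fx => y /= xy.
rewrite (_ : m - y = (m - x) + (x - y)); last by rewrite subrKA.
rewrite (le_lt_trans (mnormD _ _)) //.
rewrite (le_lt_trans (lerD mx (ltW xy))) //.
rewrite -mulrDl ltr_pdivrMr // -mulr2n -(mulr_natr e) ltr_pM2l //.
by rewrite ltr_nat.
Qed.

End complete.

HB.instance Definition _ := @Lmodule_isCStar.Build R M mnorm mnormD mnormZ
  mnorm0_eq0 mnorm_complete mmul mstar mmulA mmulDl mmulDr mmulZl mmulZr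
  mstarK mstarD mstarZ mstarM mnormM mnorm_cstar.

End Multiplier.

Notation "''M' ( A )" := (multiplier A)
  (at level 8, format "''M' ( A )") : type_scope.

(* C*-subalgebras: norm-closed *-subalgebras. *)
Definition is_cstar_sub (R : realType) (A : cstarType R) (S : set A) :=
  [/\ closed S,
      S 0 /\ (forall (k : R[i]) a b, S a -> S b -> S (k *: a + b)),
      forall a b, S a -> S b -> S (a ** b)
    & forall a, S a -> S (star a)].

Record cstar_sub (R : realType) (A : cstarType R) := CStarSub {
  csub_set :> set A;
  csubP : is_cstar_sub csub_set
}.

Fact cgen_subproof (R : realType) (A : cstarType R) (X : set A) :
  is_cstar_sub (smallest (@is_cstar_sub R A) X).
Proof.
split.
- by apply: closed_bigI => S [[]].
- split=> [S [[_ [S0 _] _ _] _] //|k a b Sa Sb S SX].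
  have [[_ [_ h] _ _] _] := SX; exact: h (Sa _ SX) (Sb _ SX).
- move=> a b Sa Sb S SX; have [[_ _ h _] _] := SX.
  exact: h (Sa _ SX) (Sb _ SX).
- move=> a Sa S SX; have [[_ _ _ h] _] := SX; exact: h (Sa _ SX).
Qed.

(* the C*-subalgebra generated by a set *)
Definition cgen (R : realType) (A : cstarType R) (X : set A) : cstar_sub A :=
  CStarSub (cgen_subproof X).

(* a C*-subalgebra as a C*-algebra in its own right *)
Record cstar_sub_type (R : realType) (A : cstarType R) (S : cstar_sub A) :=
  CStarSubElt { csub_val :> A; csub_valP : csub_set S csub_val }.

Section SubCStar.
Variables (R : realType) (A : cstarType R) (S : cstar_sub A).
Notation T := (cstar_sub_type S).
Implicit Types x y z : T.

HB.instance Definition _ := gen_eqMixin T.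
HB.instance Definition _ := gen_choiceMixin T.

Lemma csub_val_inj : injective (@csub_val R A S).
Proof.
move=> [a Sa] [b Sb] /= ab; subst b.
by congr CStarSubElt; exact: Prop_irrelevance.
Qed.

Fact csub0_subproof : csub_set S 0.
Proof. by case: (csubP S) => _ []. Qed.

Fact csubD_subproof x y : csub_set S (csub_val x + csub_val y).
Proof.
have [_ [_ h] _ _] := csubP S.
by rewrite -[csub_val x]scale1r; apply: h; exact: csub_valP.
Qed.

Fact csubZ_subproof (k : R[i]) x : csub_set S (k *: csub_val x).
Proof.
have [_ [S0 h] _ _] := csubP S.
by rewrite -[k *: _]addr0; apply: h => //; exact: csub_valP.
Qed.

Fact csubN_subproof x : csub_set S (- csub_val x).
Proof. by rewrite -scaleN1r; exact: csubZ_subproof. Qed.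

Fact csubM_subproof x y : csub_set S (csub_val x ** csub_val y).
Proof. by have [_ _ h _] := csubP S; apply: h; exact: csub_valP. Qed.

Fact csub_star_subproof x : csub_set S (star (csub_val x)).
Proof. by have [_ _ _ h] := csubP S; apply: h; exact: csub_valP. Qed.

Definition csub0 : T := CStarSubElt csub0_subproof.
Definition csubD x y : T := CStarSubElt (csubD_subproof x y).
Definition csubN x : T := CStarSubElt (csubN_subproof x).
Definition csubZ k x : T := CStarSubElt (csubZ_subproof k x).
Definition csubM x y : T := CStarSubElt (csubM_subproof x y).
Definition csub_star x : T := CStarSubElt (csub_star_subproof x).
Definition csub_norm x : R[i] := `|csub_val x|.

Fact csubDA : associative csubD.
Proof. by move=> x y z; apply: csub_val_inj; rewrite /= addrA. Qed.
Fact csubDC : commutative csubD.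
Proof. by move=> x y; apply: csub_val_inj; rewrite /= addrC. Qed.
Fact csub0D : left_id csub0 csubD.
Proof. by move=> x; apply: csub_val_inj; rewrite /= add0r. Qed.
Fact csubND : left_inverse csub0 csubN csubD.
Proof. by move=> x; apply: csub_val_inj; rewrite /= addNr. Qed.
HB.instance Definition _ := GRing.isZmodule.Build T csubDA csubDC csub0D csubND.

Fact csubZA (k l : R[i]) x : csubZ k (csubZ l x) = csubZ (k * l) x.
Proof. by apply: csub_val_inj; rewrite /= scalerA. Qed.
Fact csub1Z : left_id 1 csubZ.
Proof. by move=> x; apply: csub_val_inj; rewrite /= scale1r. Qed.
Fact csubZDr : right_distributive csubZ +%R.
Proof. by move=> k x y; apply: csub_val_inj; rewrite /= scalerDr. Qed.
Fact csubZDl x : {morph csubZ^~ x : k l / k + l}.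
Proof. by move=> k l; apply: csub_val_inj; rewrite /= scalerDl. Qed.
HB.instance Definition _ :=
  GRing.Zmodule_isLmodule.Build R[i] T csubZA csub1Z csubZDr csubZDl.

Fact csub_val_linear : linear (@csub_val R A S).
Proof. by []. Qed.
HB.instance Definition _ :=
  GRing.isLinear.Build R[i] T A *:%R (@csub_val R A S) csub_val_linear.

Fact csub_complete (F : set_system T) : ProperFilter F ->
  (forall e, 0 < e -> exists x, F [set y | csub_norm (x - y) < e]) ->
  exists l, forall e, 0 < e -> F [set y | csub_norm (l - y) < e].
Proof.
move=> FF Fc.
have : cvg (@csub_val R A S @ F).
  apply: cauchy_cvg; apply: cauchy_exP => e /Fc[x Fx].
  by exists (csub_val x); rewrite -ball_normE.
move=> /cvg_ex[l Fl].
have Sl : csub_set S l.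
  have [Scl _ _ _] := csubP S.
  have FS : \forall x \near F, csub_set S (csub_val x).
    by apply: nearW => x; exact: csub_valP.
  exact: (@closed_cvg _ _ F _ (@csub_val R A S) (csub_set S) Scl FS l).
exists (CStarSubElt Sl) => e e0.
by have /cvgrPdist_lt/(_ e e0) := Fl.
Qed.

Fact csub_normD x y : csub_norm (x + y) <= csub_norm x + csub_norm y.
Proof. exact: ler_normD. Qed.
Fact csub_normZ k x : csub_norm (k *: x) = `|k| * csub_norm x.
Proof. exact: normrZ. Qed.
Fact csub_norm0 x : csub_norm x = 0 -> x = 0.
Proof. by move=> /normr0_eq0 x0; exact: csub_val_inj. Qed.
Fact csubMA : associative csubM.
Proof. by move=> x y z; apply: csub_val_inj; exact: amulA. Qed.
Fact csubMDl : left_distributive csubM +%R.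
Proof. by move=> x y z; apply: csub_val_inj; exact: amulDl. Qed.
Fact csubMDr : right_distributive csubM +%R.
Proof. by move=> x y z; apply: csub_val_inj; exact: amulDr. Qed.
Fact csubMZl k x y : csubM (k *: x) y = k *: csubM x y.
Proof. by apply: csub_val_inj; exact: amulZl. Qed.
Fact csubMZr k x y : csubM x (k *: y) = k *: csubM x y.
Proof. by apply: csub_val_inj; exact: amulZr. Qed.
Fact csub_starK : involutive csub_star.
Proof. by move=> x; apply: csub_val_inj; exact: starK. Qed.
Fact csub_starD : {morph csub_star : x y / x + y}.
Proof. by move=> x y; apply: csub_val_inj; exact: starD. Qed.
Fact csub_starZ (k : R[i]) x : csub_star (k *: x) = k^* *: csub_star x.
Proof. by apply: csub_val_inj; exact: starZ. Qed.
Fact csub_starM x y : csub_star (csubM x y) = csubM (csub_star y) (csub_star x).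
Proof. by apply: csub_val_inj; exact: starM. Qed.
Fact csub_normM x y : csub_norm (csubM x y) <= csub_norm x * csub_norm y.
Proof. exact: norm_amul. Qed.
Fact csub_cstar x : csub_norm (csubM (csub_star x) x) = csub_norm x ^+ 2.
Proof. exact: cstar_norm. Qed.

HB.instance Definition _ := @Lmodule_isCStar.Build R T csub_norm csub_normD
  csub_normZ csub_norm0 csub_complete csubM csub_star csubMA csubMDl
  csubMDr csubMZl csubMZr csub_starK csub_starD csub_starZ csub_starM
  csub_normM csub_cstar.

End SubCStar.

Definition is_star_hom (R : realType) (A B : cstarType R) (f : A -> B) :=
  [/\ linear f, forall a b, f (a ** b) = f a ** f b
    & forall a, f (star a) = star (f a)].

Definition clspan (K : numFieldType) (V : normedModType K) (X : set V) : set V :=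
  smallest [set S | closed S /\
    S 0 /\ forall (k : K) u v, S u -> S v -> S (k *: u + v)] X.

Section Strict.
Variables (R : realType).

Definition nondegenerate (A B : cstarType R) (f : A -> 'M(B)) :=
  clspan [set b | exists a b', b = lmul (f a) b'] = setT.

(* Continuity on the unit ball of V for the strict topologies, where V is
   A or M(A) and carries the strict topology of M(A) through j. The basic
   neighbourhoods of x0 are given by finitely many seminorms
   x |-> |(x - x0) a| and x |-> |a (x - x0)|. *)
Definition strict_on_ball (A B : cstarType R) (V : normedModType R[i])
    (j : V -> 'M(A)) (F : V -> 'M(B)) :=
  forall x0 : V, `|x0| <= 1 -> forall (b : B) (e : R[i]), 0 < e ->
  exists (s : seq A) (d : R[i]), 0 < d /\
  forall x : V, `|x| <= 1 ->
    (forall a, a \in s ->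
       `|lmul (j x - j x0) a| < d /\ `|rmul (j x - j x0) a| < d) ->
    `|lmul (F x - F x0) b| < e /\ `|rmul (F x - F x0) b| < e.

Definition is_strict_hom (A B : cstarType R) (f : A -> 'M(B)) :=
  is_star_hom f /\ strict_on_ball (@memb R A) f.

(* The extension of a strict *-homomorphism A -> M(B) to M(A) -> M(B); it is
   unique since the unit ball of A is strictly dense in that of M(A). Here and
   below, xget selects the unique element with the stated property. *)
Definition mext (A B : cstarType R) (f : A -> 'M(B)) : 'M(A) -> 'M(B) :=
  xget (fun=> 0) [set F | [/\ is_star_hom F, forall a, F (memb a) = f a
                            & strict_on_ball id F]].

End Strict.

Record dual (R : realType) (A : cstarType R) := Dual {
  dual_fun :> {linear A -> R[i]^o};
  dual_continuous : continuous dual_fun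
}.

Definition is_rep (R : realType) (A : cstarType R) (H : hilbertType R)
    (p : A -> H -> H) :=
  [/\ forall a, linear (p a) /\ bounded_op (p a),
      forall h, linear (fun a => p a h),
      forall a b h, p (a ** b) h = p a (p b h)
    & forall a h k, hip (p a h) k = hip h (p (star a) k)].

Definition is_faithful_rep (R : realType) (A : cstarType R) (H : hilbertType R)
    (p : A -> H -> H) :=
  is_rep p /\ forall a, (forall h, p a h = 0) -> a = 0.

(* the square of the norm of \sum_(p <- v) p.1 (x) p.2 in the Hilbert space
   tensor product of H and K *)
Definition tens_sq (R : realType) (H K : hilbertType R) (v : seq (H * K)) : R[i] :=
  \sum_(p <- v) \sum_(q <- v) hip p.1 q.1 * hip p.2 q.2.

(* the operator \sum_(x <- s) p(x.1) (x) q(x.2) on the Hilbert space tensor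
   product of H and K has norm at most M *)
Definition tens_op_le (R : realType) (A B : cstarType R) (H K : hilbertType R)
    (p : A -> H -> H) (q : B -> K -> K) (s : seq (A * B)) (M : R[i]) :=
  forall v : seq (H * K),
    tens_sq [seq (p x.1 h.1, q x.2 h.2) | x <- s, h <- v]
      <= M ^+ 2 * tens_sq v.

(* A minimal tensor product of A and B: a completion of their algebraic tensor
   product for the spatial norm, i.e. the operator norm in p (x) q for faithful
   representations p and q of A and B, which does not depend on p and q. It is
   determined by A and B up to a unique isomorphism. *)
Record min_tensor (R : realType) (A B : cstarType R) := MinTensor {
  mt_alg : cstarType R;
  tens : A -> B -> mt_alg;
  tens_linearl : forall b, linear (tens^~ b);
  tens_linearr : forall a, linear (tens a);
  tensM : forall a a' b b', tens a b ** tens a' b' = tens (a ** a') (b ** b');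
  tens_star : forall a b, star (tens a b) = tens (star a) (star b);
  tens_dense : clspan [set x | exists a b, x = tens a b] = setT;
  tens_faithful : exists (H K : hilbertType R) (p : A -> H -> H)
    (q : B -> K -> K), is_faithful_rep p /\ is_faithful_rep q;
  tens_norm : forall (H K : hilbertType R) (p : A -> H -> H) (q : B -> K -> K),
    is_faithful_rep p -> is_faithful_rep q ->
    forall (s : seq (A * B)) (M : R[i]), 0 <= M ->
    (`|\sum_(x <- s) tens x.1 x.2| <= M <-> tens_op_le p q s M)
}.

(* a choice of a minimal tensor product for any two C*-algebras *)
Definition tensor_products (R : realType) :=
  forall A B : cstarType R, min_tensor A B.

Section TensorProducts.
Variables (R : realType) (T : tensor_products R).

Definition ctens (A B : cstarType R) : cstarType R := mt_alg (T A B).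
Local Notation "A ⊗ B" := (ctens A B) (at level 40, left associativity).

Definition etens (A B : cstarType R) (a : A) (b : B) : A ⊗ B := tens (T A B) a b.
Local Notation "a ⊠ b" := (etens a b) (at level 40, left associativity).

(* x (x) y in M(A (x) B), for x in M(A) and y in M(B) *)
Definition mtens (A B : cstarType R) (x : 'M(A)) (y : 'M(B)) : 'M(A ⊗ B) :=
  xget 0 [set z | forall a b,
    lmul z (a ⊠ b) = lmul x a ⊠ lmul y b /\
    rmul z (a ⊠ b) = rmul x a ⊠ rmul y b].

(* f (x) g : A (x) B -> M(A' (x) B') *)
Definition htens (A B A' B' : cstarType R) (f : A -> 'M(A')) (g : B -> 'M(B')) :
    A ⊗ B -> 'M(A' ⊗ B') :=
  xget (fun=> 0) [set F | is_star_hom F /\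
                          forall a b, F (a ⊠ b) = mtens (f a) (g b)].

Definition tassoc (A B C : cstarType R) : A ⊗ (B ⊗ C) -> A ⊗ B ⊗ C :=
  xget (fun=> 0) [set F | is_star_hom F /\
                          forall a b c, F (a ⊠ (b ⊠ c)) = a ⊠ b ⊠ c].

(* id (x) w : X (x) A -> X *)
Definition slice0 (X A : cstarType R) (w : dual A) : X ⊗ A -> X :=
  xget (fun=> 0) [set F | [/\ linear F, continuous F
                            & forall x a, F (x ⊠ a) = w a *: x]].

(* id (x) w : M(X (x) A) -> M(X) *)
Definition slice (X A : cstarType R) (w : dual A) : 'M(X ⊗ A) -> 'M(X) :=
  xget (fun=> 0) [set F | [/\ linear F,
                              forall y, F (memb y) = memb (slice0 w y)
                            & strict_on_ball id F]].

(* For a C*-subalgebra C of B, C (x) A is identified with the closed linear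
   span of its elementary tensors in B (x) A. *)
Definition slice_map_property (A : cstarType R) :=
  forall (B : cstarType R) (C : cstar_sub B) (x : B ⊗ A),
    (forall w : dual A, csub_set C (slice0 w x)) ->
    clspan [set y | exists c a, csub_set C c /\ y = c ⊠ a] x.

(* id_X (x) D : M(X (x) A) -> M(X (x) A (x) A) *)
Definition id_tens (A : cstarType R) (D : A -> 'M(A ⊗ A)) (X : cstarType R) :
    'M(X ⊗ A) -> 'M(X ⊗ A ⊗ A) :=
  mext (@memb R _ \o @tassoc X A A) \o mext (htens (@memb R X) D).

(* f (x) id_A : B (x) A -> M(B' (x) A) *)
Definition tens_id (A B B' : cstarType R) (f : B -> 'M(B')) :
    B ⊗ A -> 'M(B' ⊗ A) :=
  htens f (@memb R A).

Definition is_bialgebra (A : cstarType R) (D : A -> 'M(A ⊗ A)) :=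
  [/\ is_star_hom D, nondegenerate D
    & forall a, mext (tens_id D) (D a) = id_tens D (D a)].

(* 1 (x) a in M(X (x) A) *)
Definition leg (X A : cstarType R) (a : A) : 'M(X ⊗ A) :=
  mtens (mone X) (memb a).

Section Coactions.
Variables (A : cstarType R) (D : A -> 'M(A ⊗ A)).

Definition is_partial_coaction (C : cstarType R) (d : C -> 'M(C ⊗ A)) :=
  [/\ is_strict_hom d,
      forall c a, range (@memb R (C ⊗ A)) (d c ** leg C a)
    & forall c, mext (tens_id d) (d c) =
        mtens (mext d (mone C)) (mone A) ** id_tens D (d c)].

(* M(C (x) A) (x) A is identified with the closed linear span of its elementary
   tensors in M(C (x) A (x) A). *)
Definition is_regular (C : cstarType R) (d : C -> 'M(C ⊗ A)) :=
  forall c a,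
    clspan [set y | exists (m : 'M(C ⊗ A)) (a' : A), y = mtens m (memb a')]
      (id_tens D (d c) ** leg (C ⊗ A) a).

Definition is_coaction (B : cstarType R) (d : B -> 'M(B ⊗ A)) :=
  [/\ is_star_hom d, injective d,
      forall b a, range (@memb R (B ⊗ A)) (d b ** leg B a)
    & forall b a y, memb y = d b ** leg B a ->
        tens_id d y = id_tens D (d b) ** leg (B ⊗ A) a].

Definition is_dilation (C : cstarType R) (dC : C -> 'M(C ⊗ A))
    (B : cstarType R) (dB : B -> 'M(B ⊗ A)) (i : C -> B) :=
  [/\ is_coaction dB, is_star_hom i, injective i
    & forall c c' a,
        memb (lmul (dB (i c)) (i c' ⊠ a)) =
        tens_id (@memb R B \o i) (lmul (dC c) (c' ⊠ a))].

(* The slices of dB (i c) lie in B, viewed inside M(B). *)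
Definition is_minimal_dilation (C : cstarType R) (dC : C -> 'M(C ⊗ A))
    (B : cstarType R) (dB : B -> 'M(B ⊗ A)) (i : C -> B) :=
  is_dilation dC dB i /\
  csub_set (cgen ([set memb (i c) | c in [set: C]] `|`
                  [set x | exists (w : dual A) c, x = slice w (dB (i c))]))
  = range (@memb R B).

Definition dilation_alg (C : cstarType R) (d : C -> 'M(C ⊗ A)) :
    cstar_sub 'M(C ⊗ A) :=
  cgen ([set x | exists (w : dual A) c, x = slice w (id_tens D (d c))] `|`
        range d).

(* id_X (x) D restricts to the map dG : G -> M(G (x) A) on a C*-subalgebra G of
   M(X (x) A): the elements dG(g) (1 (x) a) of G (x) A are mapped to
   (id_X (x) D)(g) (1 (x) 1 (x) a) by the inclusion of G (x) A into
   M(X (x) A (x) A). *)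
Definition restricts_to (X : cstarType R) (G : cstar_sub 'M(X ⊗ A))
    (dG : cstar_sub_type G -> 'M(cstar_sub_type G ⊗ A)) :=
  forall (g : cstar_sub_type G) (a : A), exists2 y : cstar_sub_type G ⊗ A,
    memb y = dG g ** leg (cstar_sub_type G) a &
    tens_id (@csub_val R _ G) y =
      id_tens D (csub_val g) ** leg (X ⊗ A) a.

End Coactions.

End TensorProducts.

(* Main.v *)
(* For g in G := G(C), the map tau := delta ⊗ id satisfies
   tau(g y) = (id ⊗ Delta)(g) tau(y) on Y := C ⊗ A: the set of such g is a
   C*-algebra that contains delta(C) by the partial coaction identity, and the
   slices by coassociativity and naturality of id ⊗ Delta. Since tau is injective,
   id ⊗ Delta is injective on G.

   For g in G, the element (id ⊗ Delta)(g)(1 ⊗ 1 ⊗ a) lies in G ⊗ A, embedded by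
   V into M(Y ⊗ A). For g = delta(c) it lies in M(Y) ⊗ A by regularity and its
   slices are generators of G, so that the slice map property applies; for slices
   this follows from coassociativity and the nondegeneracy of Delta; and the set
   of all such g is closed under products. Hence multiplication by (id ⊗ Delta)(g)
   preserves the image of V, which defines dG(g) in M(G ⊗ A). The identities
   required of dG are checked after applying V or V ⊗ id.

   Faithful representations, on the Hilbert space of a positive kernel, and
   approximate units are constructed from the axioms of C*-algebras without
   spectral theory: the only functional calculus is the square root
   sqrt(1 - k) = 1 - y, with y the limit of y_{n+1} = (k + y_n^2) / 2. *)

From HB Require Import structures.
From mathcomp Require Import all_boot all_order all_algebra complex.
From mathcomp Require Import all_classical all_reals all_analysis.
From mathcomp Require Import ring.
Require Import Defs.

Set Implicit Arguments.
Unset Strict Implicit.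
Unset Printing Implicit Defensive.

Import Order.TTheory GRing.Theory Num.Theory.
Import numFieldNormedType.Exports.

Local Open Scope classical_set_scope.
Local Open Scope ring_scope.
Local Open Scope cstar_scope.

(** * Linear maps and closed linear spans *)

(** [mtens], [htens], [tassoc], [slice] and [mext] are selected by [xget] with default zero, so each
    needs an existence proof. The tensor norm is accessible only through [tens_norm], which compares
    formal finite sums in pairs of faithful representations; estimates are therefore made for finite
    sums and then extended to the completion.

    A partial coaction is strict but possibly degenerate. Hence [mext delta] has to be built as a
    strict limit along an approximate unit, not by a formula on products [delta(c) y], and
    naturality of [id ⊗ Delta] is stated as an intertwining relation that does not mention [f ⊗ id]
    on multipliers.

    Two devices take the place of factorization theorems: elements [e] with [|1 - e| <= 1], hence of
    norm at most 2, serve as approximate unit, and a functional [w] is approximated in norm by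
    [w(. a)]. The loss of factors 2 is harmless, because these bounds enter only limits, boundedness
    and injectivity; an injective homomorphism is isometric afterwards. *)

Section LinearMaps.
Variables (K : numFieldType).

Section Lmodule.
Variables (V W : lmodType K) (f : V -> W).
Hypothesis lf : linear f.

Lemma linD x y : f (x + y) = f x + f y.
Proof. by have := lf 1 x y; rewrite !scale1r. Qed.

Lemma lin0 : f 0 = 0.
Proof. by apply: (addrI (f 0)); rewrite -linD !addr0. Qed.

Lemma linZ k x : f (k *: x) = k *: f x.
Proof. by have := lf k x 0; rewrite lin0 !addr0. Qed.

Lemma linN x : f (- x) = - f x.
Proof. by rewrite -scaleN1r linZ scaleN1r. Qed.

Lemma linB x y : f (x - y) = f x - f y.
Proof. by rewrite linD linN. Qed.

Lemma lin_sum (I : Type) (s : seq I) (F : I -> V) :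
  f (\sum_(i <- s) F i) = \sum_(i <- s) f (F i).
Proof.
elim: s => [|i s IH]; first by rewrite !big_nil lin0.
by rewrite !big_cons linD IH.
Qed.
End Lmodule.

Lemma lin_comp (U V W : lmodType K) (f : V -> W) (g : U -> V) :
  linear f -> linear g -> linear (f \o g).
Proof. by move=> lf lg k x y /=; rewrite lg lf. Qed.

Variables (V W : normedModType K).

Lemma bounded_opP (f : V -> W) : bounded_op f ->
  exists2 M : K, 0 <= M & forall x, `|f x| <= M * `|x|.
Proof.
move=> [m fm]; exists `|m| => // x.
have mb : m * `|x| \is Num.real by apply: ger0_real (le_trans _ (fm x)).
rewrite (le_trans (fm x)) // (le_trans (real_ler_norm mb)) //.
by rewrite normrM normr_id.
Qed.

Lemma blin_continuous (f : V -> W) : linear f -> bounded_op f -> continuous f.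
Proof.
move=> lf /bounded_opP[M M0 fM] x; apply/cvgrPdist_lt => e e0.
have M1 : 0 < M + 1 by rewrite ltr_wpDl.
apply/nbhs_normP; exists (e / (M + 1)); rewrite /= ?divr_gt0 // => y /=.
rewrite ltr_pdivlMr // => xy; rewrite -linB // (le_lt_trans (fM _)) //.
by rewrite (le_lt_trans _ xy) // mulrC ler_wpM2l // lerDl.
Qed.

Lemma continuous_blin (f : V -> W) : linear f -> continuous f -> bounded_op f.
Proof.
move=> lf cf; have f0 := lin0 lf.
have /cvgrPdist_lt/(_ 1 ltr01) := cf 0; rewrite f0 => /nbhs_norm0P[d /= d0 hd].
exists (2 / d) => x.
have [->|x0] := eqVneq x 0; first by rewrite f0 !normr0 mulr0.
have nx : 0 < `|x| by rewrite normr_gt0.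
have c0 : 0 < d / 2 / `|x| by rewrite !divr_gt0.
have h : `|(d / 2 / `|x|) *: x| < d.
  rewrite normrZ (gtr0_norm c0) mulfVK ?gt_eqF //.
  by rewrite ltr_pdivrMr // ltr_pMr // ltr1n.
move/hd: h; rewrite /= sub0r normrN linZ // normrZ (gtr0_norm c0) => h.
apply: ltW; move: h; rewrite mulrAC ltr_pdivrMr // mul1r -ltr_pdivlMl ?divr_gt0 //.
by rewrite invf_div.
Qed.

End LinearMaps.

Section Clspan.
Variables (K : numFieldType) (V : normedModType K).
Implicit Types X S : set V.

Lemma sub_clspan X : X `<=` clspan X.
Proof. by move=> x Xx S [_ XS]; exact: XS. Qed.

Lemma clspan_ind X S : closed S -> S 0 ->
  (forall (k : K) u v, S u -> S v -> S (k *: u + v)) -> X `<=` S ->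
  clspan X `<=` S.
Proof. by move=> cS S0 SD XS x; apply; split. Qed.

Lemma closed_clspan X : closed (clspan X).
Proof. by apply: closed_bigI => S [[]]. Qed.

Lemma clspan0 X : clspan X 0.
Proof. by move=> S [[_ []]]. Qed.

Lemma clspanP X k u v : clspan X u -> clspan X v -> clspan X (k *: u + v).
Proof.
by move=> Xu Xv S SX; have [[_ [_ h]] _] := SX; apply: h; [exact: Xu|exact: Xv].
Qed.

Lemma closed_approx S : (forall v, (forall e, 0 < e -> exists2 u, S u & `|v - u| < e) -> S v)
  -> closed S.
Proof.
move=> h v cv; apply: h => e e0.
have [u [Su]] := cv _ (nbhsx_ballx v e e0).
by rewrite -ball_normE /ball_ /= => vu; exists u.
Qed.

Lemma approx_closed S v : closed S ->
  (forall e, 0 < e -> exists2 u, S u & `|v - u| < e) -> S v.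
Proof.
move=> cS h; apply: cS => B /nbhs_normP[e /= e0 eB].
by have [u Su vu] := h e e0; exists u; split => //; exact: eB.
Qed.

(** The vectors approximable by finite combinations form a closed subspace. This is how the
    impredicative [clspan] is turned into explicit sums. *)
Lemma clspan_approx (I : Type) (e : I -> V) v : clspan (range e) v ->
  forall d, 0 < d -> exists s : seq (K * I),
    `|v - \sum_(p <- s) p.1 *: e p.2| < d.
Proof.
have scale_s k (s : seq (K * I)) : exists t : seq (K * I),
    \sum_(p <- t) p.1 *: e p.2 = k *: \sum_(p <- s) p.1 *: e p.2.
  exists [seq (k * p.1, p.2) | p <- s]; rewrite big_map scaler_sumr.
  by apply: eq_bigr => p _; rewrite scalerA.
move: v; apply: clspan_ind.
- apply: closed_approx => v h d d0; have d2 := divr_gt0 d0 (ltr0n _ 2).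
  have [u /(_ _ d2)[s us] vu] := h _ d2; exists s.
  by rewrite (splitr d) -(subrKA u) (le_lt_trans (ler_normD _ _)) // ltrD.
- by move=> d d0; exists [::]; rewrite big_nil subr0 normr0.
- move=> k u v hu hv d d0; have d2 := divr_gt0 d0 (ltr0n _ 2).
  have k1 : 0 < `|k| + 1 by rewrite ltr_wpDl.
  have [s us] := hu _ (divr_gt0 d2 k1); have [t vt] := hv _ d2.
  have [s' es'] := scale_s k s; exists (s' ++ t); rewrite big_cat /= es'.
  rewrite opprD addrACA -scalerBr (splitr d) (le_lt_trans (ler_normD _ _)) //.
  apply: ltrD => //; rewrite normrZ.
  move: us; rewrite ltr_pdivlMr // mulrC; apply: le_lt_trans.
  by rewrite ler_wpM2r // lerDl.
- move=> _ [i _ <-] d d0; exists [:: (1, i)].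
  by rewrite big_cons big_nil /= scale1r addr0 subrr normr0.
Qed.

Lemma continuous_eq_closed (T : topologicalType) (f g : T -> V) :
  continuous f -> continuous g -> closed [set x | f x = g x].
Proof.
move=> cf cg; have h : closed [set v : V | v = 0].
  apply: closed_approx => v h; apply/eqP; rewrite -normr_le0.
  by apply/ler_addgt0Pr => e /h[u ->]; rewrite subr0 add0r => /ltW.
have -> : [set x | f x = g x] = (fun x => f x - g x) @^-1` [set v | v = 0].
  by apply/seteqP; split=> x /=; [move=> ->; rewrite subrr|move/subr0_eq].
apply: preimage_closed => // x _; exact: (cvgB (cf x) (cg x)).
Qed.

(** The vectors on which two bounded linear maps agree form a closed subspace. Identities between
    maps on tensor products are reduced to elementary tensors in this way. *)
Lemma clspan_eq (W : normedModType K) X (f g : V -> W) :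
  clspan X = setT -> linear f -> bounded_op f -> linear g -> bounded_op g ->
  (forall x, X x -> f x = g x) -> f =1 g.
Proof.
move=> XT lf bf lg bg fg v.
have : clspan X v by rewrite XT.
move: v; apply: clspan_ind.
- have cf := blin_continuous lf bf; have cg := blin_continuous lg bg.
  apply: closed_approx => v h; apply/eqP; rewrite -subr_eq0 -normr_le0.
  apply/ler_addgt0Pr => e e0; rewrite add0r.
  have /bounded_opP[M M0 fM] := bf; have /bounded_opP[N N0 gN] := bg.
  have MN : 0 < M + N + 1 by rewrite ltr_wpDl // addr_ge0.
  have [u /= fgu vu] := h _ (divr_gt0 e0 MN).
  rewrite -(subrKA (f u)) {2}fgu -!linB // (le_trans (ler_normD _ _)) //.
  rewrite (le_trans (lerD (fM _) (gN _))) // (distrC u v) -mulrDl.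
  move: vu; rewrite ltr_pdivlMr // mulrC => /ltW; apply: le_trans.
  by rewrite ler_wpM2r // lerDl.
- by rewrite /= (lin0 lf) (lin0 lg).
- by move=> k u v /= fu fv; rewrite lf lg fu fv.
- exact: fg.
Qed.

End Clspan.

(** * Extension by continuity from a total family *)

Section BLT.
Variables (K : numFieldType) (V : normedModType K) (W : completeNormedModType K).
Variables (I : Type) (e : I -> V) (g : I -> W) (M : K).
Hypothesis e_total : clspan (range e) = setT.
Local Notation comb h s := (\sum_(p <- s) p.1 *: h p.2).
Hypothesis gM : forall s : seq (K * I), `|comb g s| <= M * `|comb e s|.

(** [M] is an arbitrary complex number; since the order forces both sides of an inequality to differ
    by a real, [gM] at a combination with nonzero [comb e s] makes [M] nonnegative. Such a
    combination exists near any nonzero [v]. *)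
Let M0 : `|M| = M \/ forall v : V, v = 0.
Proof.
have [[v v0]|h] := pselect (exists v : V, v != 0); last first.
  right=> v; apply/eqP; apply: contrapT => /negP v0; apply: h; by exists v.
left; apply/normr_idP.
have nv : 0 < `|v| by rewrite normr_gt0.
have [|s vs] := @clspan_approx _ _ _ e v _ _ nv; first by rewrite e_total.
have s0 : 0 < `|comb e s|.
  rewrite normr_gt0; apply/eqP => s0; move: vs.
  by rewrite s0 subr0 ltxx.
by rewrite -(pmulr_lge0 _ s0) (le_trans _ (gM s)).
Qed.

Let gM' (s : seq (K * I)) : `|comb g s| <= `|M| * `|comb e s|.
Proof.
have [->//|v0] := M0.
by rewrite (le_trans (gM s)) // (v0 (comb e s)) normr0 !mulr0.
Qed.

Let Lcomb k (s t : seq (K * I)) : exists r : seq (K * I),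
  comb e r = k *: comb e s + comb e t /\ comb g r = k *: comb g s + comb g t.
Proof.
exists ([seq (k * p.1, p.2) | p <- s] ++ t); rewrite !big_cat !big_map /= !scaler_sumr.
by split; congr (_ + _); apply: eq_bigr => p _; rewrite scalerA.
Qed.

(** The value is the limit along the filter generated by the images of all combinations close to
    [v]. The estimate against every [s] pins down [w], and linearity of the extension is read off
    from it alone. *)
Let ext v : exists w, forall s, `|w - comb g s| <= `|M| * `|v - comb e s|.
Proof.
pose F : set_system W := [set S | exists2 d, 0 < d &
  forall s, `|v - comb e s| < d -> S (comb g s)].
have ex d : 0 < d -> exists s, `|v - comb e s| < d.
  by move=> d0; apply: clspan_approx => //; rewrite e_total.
have FF : ProperFilter F.
  split=> [[d /ex[s vs] h]|]; first exact: h vs.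
  split=> [|P Q [d d0 hP] [c c0 hQ]|P Q PQ [d d0 hP]].
  - by exists 1.
  (* A positive number below both [d] and [c]. The order on complex numbers is partial, so this
     quotient is used in place of a minimum, here and later. *)
  - have dc : 0 < d * c / (d + c) by rewrite divr_gt0 ?mulr_gt0 ?addr_gt0.
    exists (d * c / (d + c)) => // s vs; split.
      apply/hP/(lt_le_trans vs); rewrite ler_pdivrMr ?addr_gt0 // mulrDr lerDr.
      by rewrite mulr_ge0 ?ltW.
    apply/hQ/(lt_le_trans vs); rewrite ler_pdivrMr ?addr_gt0 // mulrDr.
    by rewrite mulrC lerDl mulr_ge0 ?ltW.
  - by exists d => // s /hP/PQ.
have diff s t : `|comb g s - comb g t| <= `|M| * `|comb e s - comb e t|.
  have [r [re rg]] := Lcomb (-1) t s.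
  by move: (gM' r); rewrite re rg !scaleN1r ![- _ + _]addrC.
have Fc : cvg F.
  apply: cauchy_cvg; apply: cauchy_exP => d d0.
  have M1 : 0 < `|M| + 1 by rewrite ltr_wpDl.
  have d1 := divr_gt0 (divr_gt0 d0 M1) (ltr0n _ 2).
  have [s vs] := ex _ d1.
  exists (comb g s); exists (d / (`|M| + 1) / 2) => // t vt.
  rewrite -ball_normE /ball_ /= (le_lt_trans (diff _ _)) //.
  rewrite (@le_lt_trans _ _ ((`|M| + 1) * `|comb e s - comb e t|)) //.
    by rewrite ler_wpM2r // lerDl.
  rewrite mulrC -ltr_pdivlMr // (splitr (d / _)) -(subrKA v).
  by rewrite (le_lt_trans (ler_normD _ _)) // distrC ltrD.
exists (lim F) => s; apply/ler_addgt0Pr => d d0.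
have M1 : 0 < `|M| + 1 by rewrite ltr_wpDl.
have d2 := divr_gt0 d0 (ltr0n _ 2).
have /(_ (ball (lim F) (d / 2)) (nbhsx_ballx _ _ d2)) := Fc.
move=> [c c0 hc].
have cd : 0 < c * (d / 2 / (`|M| + 1)) / (c + (d / 2 / (`|M| + 1))).
  by rewrite divr_gt0 ?mulr_gt0 ?addr_gt0 ?divr_gt0.
set dd := d / 2 / (`|M| + 1) in cd.
have dd0 : 0 < dd by rewrite !divr_gt0.
have [t vt] := ex _ cd.
have : `|v - comb e t| < c.
  apply: lt_le_trans vt _; rewrite ler_pdivrMr ?addr_gt0 // mulrDr lerDr.
  by rewrite mulr_ge0 ?ltW.
move=> /hc; rewrite -ball_normE /ball_ /= => wt.
have vt2 : `|v - comb e t| < dd.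
  apply: lt_le_trans vt _; rewrite ler_pdivrMr ?addr_gt0 // mulrDr.
  by rewrite mulrC lerDl mulr_ge0 ?ltW.
rewrite -(subrKA (comb g t)) (le_trans (ler_normD _ _)) //.
have -> : `|M| * `|v - comb e s| + d = d / 2 + (`|M| * `|v - comb e s| + d / 2).
  by rewrite addrCA -splitr.
apply: lerD; first exact: ltW.
rewrite (le_trans (diff _ _)) // -(subrKA v) .
rewrite (le_trans (ler_wpM2l _ (ler_normD _ _))) // mulrDr addrC lerD //.
rewrite (@le_trans _ _ ((`|M| + 1) * `|comb e t - v|)) //.
  by rewrite ler_wpM2r // lerDl.
by rewrite mulrC -ler_pdivlMr // distrC ltW.
Qed.

Lemma bounded_linear_extension : exists F : V -> W,
  [/\ linear F, forall v, `|F v| <= M * `|v| & forall i, F (e i) = g i].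
Proof.
have [F FP] := choice ext.
have bF v : `|F v| <= `|M| * `|v|.
  by have := FP v [::]; rewrite !big_nil !subr0.
exists F; split.
- move=> k u v; apply/eqP; rewrite -subr_eq0 -normr_le0.
  apply/ler_addgt0Pr => d d0; rewrite add0r.
  have M1 : 0 < (`|M| + 1) * ((`|k| + 1) * 4).
    by rewrite !mulr_gt0 ?ltr_wpDl.
  have d1 := divr_gt0 d0 M1.
  have [|s us] := @clspan_approx _ _ _ e u _ _ d1; first by rewrite e_total.
  have [|t vt] := @clspan_approx _ _ _ e v _ _ d1; first by rewrite e_total.
  have [r [re rg]] := Lcomb k s t.
  set c := d / _ in us vt d1.
  have h1 : `|F (k *: u + v) - comb g r| <= `|M| * ((`|k| + 1) * c).
    rewrite (le_trans (FP _ r)) // ler_wpM2l // re opprD addrACA -scalerBr.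
    rewrite (le_trans (ler_normD _ _)) // normrZ mulrDl mul1r lerD ?ler_wpM2l //.
      exact: ltW.
    exact: ltW.
  have h2 : `|comb g r - (k *: F u + F v)| <= `|M| * ((`|k| + 1) * c).
    rewrite rg opprD addrACA -scalerBr (le_trans (ler_normD _ _)) // normrZ.
    rewrite mulrDl mul1r mulrDr lerD //.
      rewrite mulrCA ler_wpM2l // distrC (le_trans (FP _ _)) // ler_wpM2l //.
      exact: ltW.
    by rewrite distrC (le_trans (FP _ _)) // ler_wpM2l // ltW.
  rewrite -(subrKA (comb g r)) (le_trans (ler_normD _ _)) //.
  rewrite (le_trans (lerD h1 h2)) // -mulr2n -mulr_natl.
  have -> : d = (`|M| + 1) * ((`|k| + 1) * 4) * c by rewrite mulrC mulfVK ?gt_eqF.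
  have -> : 2 * (`|M| * ((`|k| + 1) * c)) = `|M| * ((`|k| + 1) * 2) * c by ring.
  rewrite ler_wpM2r ?(ltW d1) // ler_pM ?mulr_ge0 ?addr_ge0 ?lerDl //.
  by rewrite ler_wpM2l ?addr_ge0 // ler_nat.
- move=> v; have [<-//|v0] := M0.
  by rewrite (le_trans (bF v)) // (v0 v) normr0 !mulr0.
- move=> i; apply/eqP; rewrite -subr_eq0 -normr_le0.
  have := FP (e i) [:: (1, i)].
  by rewrite !big_cons !big_nil !addr0 /= !scale1r subrr normr0 mulr0.
Qed.

End BLT.

(** * The complex numbers as a complete normed space *)

Section ComplexComplete.
Variable R : realType.

Lemma rcD (x y : R) : (x + y)%:C%C = x%:C%C + y%:C%C.
Proof. by apply/eqP; rewrite eq_complex /= addr0 !eqxx. Qed.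

Lemma rcM (x y : R) : (x * y)%:C%C = x%:C%C * y%:C%C.
Proof. by apply/eqP; rewrite eq_complex /= !mul0r mulr0 subr0 addr0 !eqxx. Qed.

Lemma rc2V : (2^-1 : R)%:C%C = 2^-1.
Proof.
apply: (mulfI (_ : 2 != 0 :> R[i])); first by rewrite pnatr_eq0.
rewrite mulfV ?pnatr_eq0 //.
have -> : (2 : R[i]) = (2 : R)%:C%C by apply/eqP; rewrite eq_complex /= addr0 !eqxx.
by rewrite -rcM mulfV ?pnatr_eq0.
Qed.
Local Notation C := (R[i]^o).

Lemma normc_ge_Im (z : R[i]) : `|complex.Im z|%:C%C <= `|z|.
Proof.
rewrite -[complex.Im z]opprK normrN -ReiNIm (le_trans (normc_ge_Re _)) //.
have i1 : `|'i%C : R[i]| = 1 by rewrite normc_def /= expr0n /= add0r expr1n sqrtr1.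
by rewrite normrM i1 mulr1.
Qed.

Lemma normc_le_ReIm (z : R[i]) :
  `|z| <= `|complex.Re z|%:C%C + `|complex.Im z|%:C%C.
Proof.
have i1 : `|'i%C : R[i]| = 1 by rewrite normc_def /= expr0n /= add0r expr1n sqrtr1.
have nR (x : R) : `|x%:C%C| = `|x|%:C%C by rewrite normc_def /= expr0n /= addr0 sqrtr_sqr.
by rewrite {1}[z]complexE (le_trans (ler_normD _ _)) // normrM i1 mul1r !nR.
Qed.

Fact complex_complete (F : set_system C) : ProperFilter F -> cauchy F -> cvg F.
Proof.
move=> FF /cauchy_ballP Fc.
have part (p : R[i] -> R) : (forall x y, `|p x - p y|%:C%C <= `|x - y|) ->
    cvg (p @ F).
  move=> hp; apply: cauchy_cvg; apply: cauchy_exP => e e0.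
  have e0' : 0 < e%:C%C by rewrite ltcR.
  have /cauchyP /(_ _ e0') [x Fx] : cauchy F by apply/cauchy_ballP.
  exists (p x); apply: (@filterS _ F _ (ball x e%:C%C) _ _ Fx) => y.
  rewrite -!ball_normE /ball_ /= => xy.
  by have := le_lt_trans (hp x y) xy; rewrite ltcR.
have hRe (x y : R[i]) : `|complex.Re x - complex.Re y|%:C%C <= `|x - y|.
  by rewrite (le_trans _ (normc_ge_Re _)) //; case: x; case: y.
have hIm (x y : R[i]) : `|complex.Im x - complex.Im y|%:C%C <= `|x - y|.
  by have := normc_ge_Im (x - y); case: x; case: y.
have /cvg_ex[a /cvgrPdist_lt Fa] := part (@complex.Re R) hRe.
have /cvg_ex[b /cvgrPdist_lt Fb] := part (@complex.Im R) hIm.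
apply/cvg_ex; exists (a +i* b)%C; apply/cvgrPdist_lt => e e0.
have eR : e = (complex.Re e)%:C%C by rewrite ReK // ltW.
have e2 : 0 < complex.Re e / 2.
  by rewrite divr_gt0 // -ltcR -eR.
apply: filterS2 (Fa _ e2) (Fb _ e2) => z za zb.
rewrite (le_lt_trans (normc_le_ReIm _)) // eR (splitr (complex.Re e)) rcD.
by rewrite ltrD // ltcR; case: z za zb.
Qed.

(* [R^o] for [R : realType] already is the canonical complete instance keyed on
   the regular module, hence this explicit structure. *)
Definition complexC : completeNormedModType R[i] :=
  HB.pack C (Uniform_isComplete.Build C complex_complete).

End ComplexComplete.

Section Limits.
Variables (R : realType).
Local Notation C := R[i].

(** Nonnegativity of a complex number is the closed condition [|z| = z], so it survives the limit of
    [v - u]. *)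
Lemma le_cvg (T : Type) (F : set_system T) {FF : ProperFilter F}
    (u v : T -> C^o) (a b : C^o) :
  u @ F --> a -> v @ F --> b -> (\forall x \near F, (u x <= v x)%R) -> (a <= b)%R.
Proof.
move=> ua vb uv; rewrite -subr_ge0 -[(0 <= _)%R]/(0 <= (b - a : C)).
have cl : closed [set z : C^o | `|z| = z].
  apply: (@continuous_eq_closed _ _ _ (fun z : C^o => `|z| : C^o) id) => [z|z].
    exact: norm_continuous.
  exact: cvg_id.
rewrite ger0_def; apply/eqP.
apply: (@closed_cvg _ _ F _ (fun x => v x - u x) _ cl) => [|].
  by apply: filterS uv => x uvx /=; rewrite ger0_norm // subr_ge0.
exact: (@cvgB C C^o T F FF v u b a vb ua).
Qed.

End Limits.

(** * Square roots by iteration *)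

Section Sqrt.
Variables (R : realType) (A : cstarType R).
Local Notation C := R[i].

Lemma amul_continuousl (a : A) : continuous (fun x : A => a ** x).
Proof.
apply: blin_continuous; first by move=> k x y; rewrite amulDr amulZr.
by exists `|a| => x; exact: norm_amul.
Qed.

Lemma amul_continuousr (a : A) : continuous (fun x : A => x ** a).
Proof.
apply: blin_continuous; first by move=> k x y; rewrite amulDl amulZl.
by exists `|a| => x; rewrite mulrC norm_amul.
Qed.

Lemma star_continuous : continuous (@star R A).
Proof.
move=> x; apply/cvgrPdist_lt => e e0; apply/nbhs_normP; exists e => // y /=.
by rewrite -starB norm_star.
Qed.

Fixpoint sqrt_iter (k : A) (n : nat) : A :=
  if n is m.+1 then 2^-1 *: (k + sqrt_iter k m ** sqrt_iter k m) else 0.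

(* p_n dominates the norms of the increments of [sqrt_iter], which makes the
   iteration converge even on the boundary [`|k| = 1] *)
Fixpoint sqrt_maj (n : nat) : R :=
  if n is m.+1 then 2^-1 * (1 + sqrt_maj m * sqrt_maj m) else 0.

Lemma sqrt_maj_bound n : 0 <= sqrt_maj n <= 1.
Proof.
elim: n => [|n /andP[p0 p1]] /=; first by rewrite lexx ler01.
rewrite mulr_ge0 ?addr_ge0 ?mulr_ge0 //= -[leRHS](@mulVf _ 2) //.
rewrite ler_pM2l // (_ : 2 = 1 + 1) // lerD2l -[leRHS]mulr1.
by rewrite ler_pM.
Qed.

Lemma sqrt_maj_le n : sqrt_maj n <= sqrt_maj n.+1.
Proof.
elim: n => [|n IH] /=; first by rewrite mul0r addr0 mulr1.
have /andP[p0 _] := sqrt_maj_bound n.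
by rewrite ler_pM2l // lerD2l ler_pM.
Qed.

Lemma sqrt_maj_homo : {homo sqrt_maj : m n / (m <= n)%N >-> m <= n}.
Proof. by apply: homo_leq => // [x y z|]; [exact: le_trans|exact: sqrt_maj_le]. Qed.

Variable k : A.
Hypothesis k1 : `|k| <= 1.

Lemma sqrt_iter_norm n : `|sqrt_iter k n| <= (sqrt_maj n)%:C%C.
Proof.
elim: n => [|n IH] /=; first by rewrite normr0.
rewrite normrZ ger0_norm ?invr_ge0 // rcM rc2V rcD rcM.
rewrite ler_pM2l ?invr_gt0 // (le_trans (ler_normD _ _)) // lerD //.
by rewrite (le_trans (norm_amul _ _)) // ler_pM.
Qed.

(** The difference of two squares is [y (y - x) + (y - x) x], which needs no commutativity. The
    majorant satisfies the same recursion with equality, so induction compares the two term by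
    term. *)
Lemma sqrt_iter_incr n :
  `|sqrt_iter k n.+1 - sqrt_iter k n| <= (sqrt_maj n.+1 - sqrt_maj n)%:C%C.
Proof.
elim: n => [|n IH].
  rewrite /= amul0l mul0r !subr0 !addr0 mulr1 normrZ ger0_norm ?invr_ge0 //.
  by rewrite rc2V ger_pMr ?invr_gt0.
set y := sqrt_iter k n.+1 in IH *; set x := sqrt_iter k n in IH *.
have -> : sqrt_iter k n.+2 - y = 2^-1 *: (y ** (y - x) + (y - x) ** x).
  have -> : y = 2^-1 *: (k + x ** x) by [].
  rewrite -[2^-1 *: (k + x ** x)]/y [in LHS]/= -/y.
  have {2}-> : y = 2^-1 *: (k + x ** x) by [].
  rewrite -scalerBr; congr (_ *: _).
  by rewrite amulBr amulBl subrKA opprD addrACA subrr add0r.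
set q := sqrt_maj n.+1 in IH *; set p := sqrt_maj n in IH *.
have -> : sqrt_maj n.+2 - q = 2^-1 * (q * (q - p) + (q - p) * p).
  have -> : sqrt_maj n.+2 = 2^-1 * (1 + q * q) by [].
  have {3}-> : q = 2^-1 * (1 + p * p) by [].
  by ring.
have hy : `|y| <= q%:C%C by exact: sqrt_iter_norm.
have hx : `|x| <= p%:C%C by exact: sqrt_iter_norm.
clearbody x y q p.
rewrite normrZ ger0_norm ?invr_ge0 // rcM rc2V.
rewrite ler_pM2l ?invr_gt0 // rcD !rcM (le_trans (ler_normD _ _)) // lerD //.
  by rewrite (le_trans (norm_amul _ _)) // ler_pM.
by rewrite (le_trans (norm_amul _ _)) // ler_pM.
Qed.

Lemma sqrt_iter_dist m n : (m <= n)%N ->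
  `|sqrt_iter k n - sqrt_iter k m| <= (sqrt_maj n - sqrt_maj m)%:C%C.
Proof.
elim: n => [|n IH]; first by rewrite leqn0 => /eqP ->; rewrite !subrr normr0.
rewrite leq_eqVlt => /predU1P[->|mn]; first by rewrite !subrr normr0.
rewrite -(subrKA (sqrt_iter k n)) (le_trans (ler_normD _ _)) //.
rewrite -(subrKA (sqrt_maj n)) rcD lerD //; last exact: IH.
exact: sqrt_iter_incr.
Qed.

Lemma sqrt_iter_cvg : cvgn (sqrt_iter k).
Proof.
have : cvgn sqrt_maj.
  apply: nondecreasing_is_cvgn; first exact: sqrt_maj_homo.
  by exists 1 => _ [n _ <-]; have /andP[] := sqrt_maj_bound n.
move=> /cvg_ex[l /cvgrPdist_lt hl]; apply: cauchy_cvg; apply: cauchy_exP => e e0.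
have eR : e = (complex.Re e)%:C%C by rewrite ReK // ltW.
have e2 : 0 < complex.Re e / 2 by rewrite divr_gt0 // -ltcR -eR.
have [N _ hN] := hl _ e2.
exists (sqrt_iter k N), N => // n /= Nn.
rewrite -ball_normE /ball_ /= distrC (le_lt_trans (sqrt_iter_dist Nn)) // eR ltcR.
rewrite -(subrKA l) (splitr (complex.Re e)) (le_lt_trans (ler_norm _)) //.
rewrite (le_lt_trans (ler_normD _ _)) // ltrD //.
  by rewrite distrC; exact: hN.
exact: hN (leqnn N).
Qed.

(* [1 - y] is a square root of [1 - k] *)
Lemma sqrt_exists : exists y : A, [/\ `|y| <= 1, y + y = k + y ** y,
  star k = k -> star y = y & forall z, z ** k = k ** z -> z ** y = y ** z].
Proof.
pose y : A := limn (sqrt_iter k).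
have yl : sqrt_iter k @ \oo --> y := sqrt_iter_cvg.
exists y; split.
- have := @le_cvg R _ \oo _ (fun n => `|sqrt_iter k n|) (fun=> 1) `|y| 1.
  apply; first exact: cvg_norm.
    exact: cvg_cst.
  apply: nearW => n; rewrite (le_trans (sqrt_iter_norm n)) // -[1]/(1%:C%C) lecR.
  by have /andP[] := sqrt_maj_bound n.
- have h0 : (fun n => sqrt_iter k n.+1) @ \oo --> y.
    by have := yl; rewrite -cvg_shiftS.
  have h1 : (fun n => sqrt_iter k n.+1 + sqrt_iter k n.+1) @ \oo --> y + y.
    exact: (cvgD h0 h0).
  have h2 : (fun n => k + sqrt_iter k n ** sqrt_iter k n) @ \oo --> k + y ** y.
    apply: cvgD; first exact: cvg_cst.
    apply/cvgrPdist_le => e e0.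
    have e2 := divr_gt0 e0 (ltr0n _ 2).
    have y1 : 0 < `|y| + 1 by rewrite ltr_wpDl.
    have /cvgrPdist_le/(_ _ (divr_gt0 e2 y1)) := yl.
    apply: filterS => n h.
    rewrite -(subrKA (y ** sqrt_iter k n)) -amulBr -amulBl.
    rewrite (le_trans (ler_normD _ _)) // (splitr e) lerD //.
      rewrite (le_trans (norm_amul _ _)) //.
      rewrite (le_trans (ler_wpM2l _ h)) // mulrCA ger_pMr //.
      by rewrite ler_pdivrMr // mul1r lerDl.
    rewrite (le_trans (norm_amul _ _)) // (le_trans (ler_wpM2r _ h)) //.
    rewrite -mulrA ger_pMr // ler_pdivrMl // mulr1.
    rewrite (le_trans (sqrt_iter_norm n)) // (@le_trans _ _ 1) ?lerDr //.
    by rewrite -[1]/(1%:C%C) lecR; have /andP[] := sqrt_maj_bound n.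
  have h : (fun n => sqrt_iter k n.+1 + sqrt_iter k n.+1) =
      (fun n => k + sqrt_iter k n ** sqrt_iter k n).
    apply/funext => n /=; rewrite -scalerDl -mulr2n -[_ *+ 2]mulr_natr mulVf ?pnatr_eq0 //.
    by rewrite scale1r.
  rewrite h in h1.
  exact: (@cvg_unique _ (@norm_hausdorff _ A) _ _ _ _ h1 h2).
- move=> ks.
  have st n : star (sqrt_iter k n) = sqrt_iter k n.
    elim: n => [|n IH] /=; first by rewrite star0.
    by rewrite starZ starD ks starM IH conj_Creal // ger0_real // invr_ge0.
  have h : (fun n => star (sqrt_iter k n)) @ \oo --> star y.
    by apply: continuous_cvg => //; exact: star_continuous.
  rewrite (_ : (fun n => _) = sqrt_iter k) in h; last by apply/funext.
  exact: (@cvg_unique _ (@norm_hausdorff _ A) _ _ _ _ h yl).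
- move=> z kz.
  have st n : z ** (sqrt_iter k n) = sqrt_iter k n ** z.
    elim: n => [|n IH] /=; first by rewrite amul0l amul0r.
    by rewrite amulZr amulZl amulDr amulDl kz amulA IH -amulA IH amulA.
  have h1 : (fun n => z ** (sqrt_iter k n)) @ \oo --> z ** y.
    exact: (@cvg_comp _ _ _ (sqrt_iter k) (fun x => z ** x) _ _ _ yl (@amul_continuousl z y)).
  have h2 : (fun n => (sqrt_iter k n) ** z) @ \oo --> y ** z.
    exact: (@cvg_comp _ _ _ (sqrt_iter k) (fun x => x ** z) _ _ _ yl (@amul_continuousr z y)).
  rewrite (_ : (fun n => _) = (fun n => (sqrt_iter k n) ** z)) in h1; last by apply/funext.
  exact: (@cvg_unique _ (@norm_hausdorff _ A) _ _ _ _ h1 h2).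
Qed.
End Sqrt.

(** * The Hilbert space of a positive kernel *)

(** The hypothesis is [0 <= <x + l y, x + l y>] with [a = <x, x>], [b = <x, y>], [c = <y, y>]. Take
    [l = - b / c]; if [c = 0] and [b] is nonzero, take [l = - t b] with [t] such that the value is
    [-1]. *)
Lemma cauchy_schwarz_discr (R : realType) (a b c : R[i]) : 0 <= a -> 0 <= c ->
  (forall l : R[i], 0 <= a + l^* * b + l * b^* + l * l^* * c) -> `|b| ^+ 2 <= a * c.
Proof.
move=> a0 c0 h; have [cz|cnz] := eqVneq c 0.
  have [->|b0] := eqVneq b 0; first by rewrite normr0 expr0n mulr_ge0.
  have nb : 0 < b * b^* by rewrite -normCK exprn_gt0 // normr_gt0.
  pose t := (a + 1) / (2 * (b * b^*)).
  have tr : t^* = t.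
    have t0 : 0 <= t.
      apply: divr_ge0; first exact: addr_ge0.
      by apply: mulr_ge0 => //; exact: ltW.
    exact: conj_Creal (ger0_real t0).
  have := h (- t * b); rewrite cz mulr0 addr0 rmorphM rmorphN /= tr.
  have -> : a + - t * b^* * b + - t * b * b^* = a - t * (2 * (b * b^*)) by ring.
  have -> : t * (2 * (b * b^*)) = a + 1.
    by rewrite /t mulfVK // mulf_neq0 ?pnatr_eq0 ?gt_eqF.
  rewrite opprD addrA subrr add0r.
  by rewrite oppr_ge0 ler10.
have cp : 0 < c by rewrite lt0r cnz.
have cr : c^* = c := conj_Creal (ger0_real c0).
have := h (- b / c); rewrite rmorphM rmorphN fmorphV /= cr.
have -> : a + - b^* / c * b + - b / c * b^* + - b / c * (- b^* / c) * c =
  a - b * b^* / c.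
  by field.
by rewrite subr_ge0 ler_pdivrMr // -normCK.
Qed.

Section Kolmogorov.
Variables (R : realType) (I : Type) (kappa : I -> I -> R[i]).
Local Notation C := R[i].
Implicit Types v w : seq (C * I).

Definition ksum v w := \sum_(p <- v) \sum_(q <- w) p.1 * q.1^* * kappa p.2 q.2.

Hypothesis kappa_herm : forall i j, kappa j i = (kappa i j)^*.
Hypothesis kappa_pos : forall v, 0 <= ksum v v.

Lemma ksum_herm v w : ksum w v = (ksum v w)^*.
Proof.
rewrite /ksum exchange_big rmorph_sum; apply: eq_bigr => p _.
rewrite rmorph_sum; apply: eq_bigr => q _.
by rewrite !rmorphM /= conjCK -kappa_herm [q.1 * _]mulrC.
Qed.

Definition kscale (k : C) v := [seq (k * p.1, p.2) | p <- v].

Lemma ksum_catl v v' w : ksum (v ++ v') w = ksum v w + ksum v' w.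
Proof. by rewrite /ksum big_cat. Qed.

Lemma ksum_catr v w w' : ksum v (w ++ w') = ksum v w + ksum v w'.
Proof. by rewrite /ksum -big_split; apply: eq_bigr => p _; rewrite big_cat. Qed.

Lemma ksum_scalel k v w : ksum (kscale k v) w = k * ksum v w.
Proof.
rewrite /ksum /kscale big_map mulr_sumr; apply: eq_bigr => p _.
by rewrite mulr_sumr; apply: eq_bigr => q _ /=; rewrite !mulrA.
Qed.

Lemma ksum_scaler k v w : ksum v (kscale k w) = k^* * ksum v w.
Proof. by rewrite ksum_herm ksum_scalel rmorphM /= -ksum_herm. Qed.

Definition knorm v : C := sqrtC (ksum v v).

Lemma knorm_ge0 v : 0 <= knorm v.
Proof. by rewrite sqrtC_ge0. Qed.

Lemma knorm_sqr v : knorm v ^+ 2 = ksum v v.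
Proof. exact: sqrtCK. Qed.

Lemma knorm_scale k v : knorm (kscale k v) = `|k| * knorm v.
Proof.
apply/eqP; rewrite -(@eqrXn2 _ 2) ?mulr_ge0 ?knorm_ge0 //.
by rewrite exprMn !knorm_sqr ksum_scalel ksum_scaler mulrA -normCK.
Qed.

Lemma ksum_le v w : `|ksum v w| <= knorm v * knorm w.
Proof.
rewrite -(@ler_pXn2r _ 2) ?nnegrE ?mulr_ge0 ?knorm_ge0 // exprMn !knorm_sqr.
apply: cauchy_schwarz_discr => // l.
have := kappa_pos (v ++ kscale l w).
rewrite ksum_catl !ksum_catr !ksum_scalel !ksum_scaler -(ksum_herm v w).
by congr (0 <= _); ring.
Qed.

(** A vector [x] is encoded by the function [i |-> <x, phi i>]; for such an [f] this is the inner
    product of [x] with the combination [w], antilinear in [w]. *)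
Definition kpair (f : I -> C) w := \sum_(q <- w) q.1^* * f q.2.

Definition kbounded (f : I -> C) (M : C) :=
  forall w, `|kpair f w| <= M * knorm w.

Definition kcomb v : I -> C := fun i => \sum_(p <- v) p.1 * kappa p.2 i.

Lemma kpair_comb v w : kpair (kcomb v) w = ksum v w.
Proof.
rewrite /kpair /ksum exchange_big; apply: eq_bigr => q _.
by rewrite /kcomb mulr_sumr; apply: eq_bigr => p _; rewrite mulrCA mulrA.
Qed.

Lemma kpairD f g w : kpair (f + g) w = kpair f w + kpair g w.
Proof. by rewrite /kpair -big_split; apply: eq_bigr => q _; exact: mulrDr. Qed.

Lemma kpairZ (k : C) f w : kpair (fun i => k * f i) w = k * kpair f w.
Proof. by rewrite /kpair mulr_sumr; apply: eq_bigr => q _; rewrite mulrCA. Qed.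

Lemma kpairB f g w : kpair (f - g) w = kpair f w - kpair g w.
Proof.
by rewrite /kpair -sumrB; apply: eq_bigr => q _; rewrite -mulrBr.
Qed.

Lemma kpair_scale (k : C) f w : kpair f (kscale k w) = k^* * kpair f w.
Proof.
rewrite /kpair /kscale big_map mulr_sumr; apply: eq_bigr => q _ /=.
by rewrite rmorphM mulrA.
Qed.

Lemma kboundedD f g M N : kbounded f M -> kbounded g N -> kbounded (f + g) (M + N).
Proof.
move=> fM gN w; rewrite kpairD mulrDl (le_trans (ler_normD _ _)) //.
by rewrite lerD.
Qed.

Lemma kboundedZ (k : C) f M : kbounded f M -> kbounded (fun i => k * f i) (`|k| * M).
Proof. by move=> fM w; rewrite kpairZ normrM -mulrA ler_wpM2l. Qed.

Lemma kbounded_le f M N : M <= N -> kbounded f M -> kbounded f N.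
Proof. by move=> MN fM w; rewrite (le_trans (fM w)) // ler_wpM2r // knorm_ge0. Qed.

Lemma kbounded_comb v : kbounded (kcomb v) (knorm v).
Proof. by move=> w; rewrite kpair_comb ksum_le. Qed.

(* The Hilbert space of the kernel: limits of the functions [kcomb v] for the
   norm dual to [knorm]. *)
Record kspace := KSpace { kfun : I -> C;
  kfunP : forall e, 0 < e -> exists v, kbounded (kfun - kcomb v) e }.

Lemma kspace_eq (f g : kspace) : kfun f = kfun g -> f = g.
Proof. by case: f g => [f hf] [g hg] /= e; subst g; congr KSpace; exact: Prop_irrelevance. Qed.

HB.instance Definition _ := gen_eqMixin kspace.
HB.instance Definition _ := gen_choiceMixin kspace.

Lemma kcomb_cat v w : kcomb (v ++ w) = kcomb v + kcomb w.
Proof. by apply/funext => i; rewrite /kcomb big_cat. Qed.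

Lemma kcomb_scale k v : kcomb (kscale k v) = (fun i => k * kcomb v i).
Proof.
apply/funext => i; rewrite /kcomb /kscale big_map mulr_sumr.
by apply: eq_bigr => p _ /=; rewrite mulrA.
Qed.

Lemma kbounded0 M : 0 <= M -> kbounded (0 : I -> C) M.
Proof.
move=> M0 w; rewrite /kpair big1 ?normr0 ?mulr_ge0 ?knorm_ge0 // => q _.
by rewrite mulr0.
Qed.

Fact kspace0_subproof e : 0 < e -> exists v, kbounded ((0 : I -> C) - kcomb v) e.
Proof.
move=> e0; exists [::]; rewrite (_ : _ - _ = 0); first exact/kbounded0/ltW.
by apply/funext => i; rewrite /kcomb !fctE big_nil subr0.
Qed.

Fact kspaceD_subproof (f g : kspace) e :
  0 < e -> exists v, kbounded ((kfun f + kfun g) - kcomb v) e.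
Proof.
move=> e0; have e2 := divr_gt0 e0 (ltr0n _ 2).
have [v hv] := kfunP f e2; have [w hw] := kfunP g e2; exists (v ++ w).
by rewrite kcomb_cat opprD addrACA (splitr e); exact: kboundedD.
Qed.

Fact kspaceZ_subproof (k : C) (f : kspace) e :
  0 < e -> exists v, kbounded ((fun i => k * kfun f i) - kcomb v) e.
Proof.
move=> e0; have k1 : 0 < `|k| + 1 by rewrite ltr_wpDl.
have [v hv] := kfunP f (divr_gt0 e0 k1); exists (kscale k v).
rewrite (_ : _ - _ = (fun i => k * (kfun f - kcomb v) i)).
  apply: kbounded_le (kboundedZ k hv).
  by rewrite mulrCA ger_pMr // ler_pdivrMr // mul1r lerDl.
by rewrite kcomb_scale; apply/funext => i; rewrite !fctE mulrBr.
Qed.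

Definition kspace0 := KSpace kspace0_subproof.
Definition kspaceD f g := KSpace (@kspaceD_subproof f g).
Definition kspaceZ k f := KSpace (@kspaceZ_subproof k f).
Definition kspaceN f := kspaceZ (-1) f.

Fact kspaceDA : associative kspaceD.
Proof. by move=> f g h; apply: kspace_eq; rewrite /= addrA. Qed.
Fact kspaceDC : commutative kspaceD.
Proof. by move=> f g; apply: kspace_eq; rewrite /= addrC. Qed.
Fact kspace0D : left_id kspace0 kspaceD.
Proof. by move=> f; apply: kspace_eq; rewrite /= add0r. Qed.
Fact kspaceND : left_inverse kspace0 kspaceN kspaceD.
Proof. by move=> f; apply: kspace_eq; apply/funext => i; rewrite /= !fctE mulN1r addNr. Qed.
HB.instance Definition _ :=
  GRing.isZmodule.Build kspace kspaceDA kspaceDC kspace0D kspaceND.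

Fact kspaceZA (k l : C) f : kspaceZ k (kspaceZ l f) = kspaceZ (k * l) f.
Proof. by apply: kspace_eq; apply/funext => i; rewrite /= mulrA. Qed.
Fact kspace1Z : left_id 1 kspaceZ.
Proof. by move=> f; apply: kspace_eq; apply/funext => i; rewrite /= mul1r. Qed.
Fact kspaceZDr : right_distributive kspaceZ +%R.
Proof. by move=> k f g; apply: kspace_eq; apply/funext => i; rewrite /= !fctE mulrDr. Qed.
Fact kspaceZDl f : {morph kspaceZ^~ f : k l / k + l}.
Proof. by move=> k l; apply: kspace_eq; apply/funext => i; rewrite /= !fctE mulrDl. Qed.
HB.instance Definition _ :=
  GRing.Zmodule_isLmodule.Build C kspace kspaceZA kspace1Z kspaceZDr kspaceZDl.

Definition kdual_norm (f : kspace) : C :=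
  (sup [set complex.Re `|kpair (kfun f) w| | w in [set w | knorm w <= 1]])%:C%C.

Lemma kbounded_kspace (f : kspace) : exists2 M, 0 <= M & kbounded (kfun f) M.
Proof.
have [v hv] := kfunP f (@ltr01 C); exists (1 + knorm v).
  by rewrite addr_ge0 ?knorm_ge0.
by rewrite -[kfun f](subrK (kcomb v)); apply: kboundedD => //; exact: kbounded_comb.
Qed.

Let kdual_ub (f : kspace) :
  has_ubound [set complex.Re `|kpair (kfun f) w| | w in [set w | knorm w <= 1]].
Proof.
have [M M0 fM] := kbounded_kspace f; exists (complex.Re M) => _ [w /= w1 <-].
rewrite -lecR !ReK // (le_trans (fM w)) // -[leRHS]mulr1 ler_wpM2l //.
Qed.

Lemma kdual_norm_ge0 f : 0 <= kdual_norm f.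
Proof.
rewrite /kdual_norm (_ : 0 = (0 : R)%:C%C) // lecR.
apply: (ub_le_sup (kdual_ub f)); exists [::].
  by rewrite /= /knorm /ksum big_nil sqrtC0.
by rewrite /kpair big_nil normr0.
Qed.

Lemma kdual_normP f k : 0 <= k -> (kdual_norm f <= k <-> kbounded (kfun f) k).
Proof.
move=> k0; split=> [h w|h].
  have [M M0 fM] := kbounded_kspace f.
  have [w0|wn] := eqVneq (knorm w) 0.
    by have := fM w; rewrite w0 !mulr0.
  have wp : 0 < knorm w by rewrite lt0r wn knorm_ge0.
  have wr : (knorm w)^-1^* = (knorm w)^-1.
    by rewrite fmorphV /= conj_Creal // ger0_real // knorm_ge0.
  have : complex.Re `|kpair (kfun f) (kscale (knorm w)^-1 w)| <= complex.Re k.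
    rewrite (@le_trans _ _ (complex.Re (kdual_norm f))) //.
      apply: (ub_le_sup (kdual_ub f)); exists (kscale (knorm w)^-1 w) => //=.
      by rewrite knorm_scale ger0_norm ?invr_ge0 ?knorm_ge0 // mulVf.
    by rewrite -lecR !ReK ?kdual_norm_ge0.
  rewrite -lecR !ReK // kpair_scale wr normrM ger0_norm ?invr_ge0 ?knorm_ge0 //.
  by rewrite ler_pdivrMl // mulrC.
rewrite -(ReK k0) lecR; apply: ge_sup.
  exists (complex.Re `|kpair (kfun f) [::]|), [::] => //=.
  by rewrite /knorm /ksum big_nil sqrtC0.
move=> _ [w /= w1 <-]; rewrite -lecR !ReK // (le_trans (h w)) //.
by rewrite -[leRHS]mulr1 ler_wpM2l.
Qed.

Lemma kdual_norm_bounded f : kbounded (kfun f) (kdual_norm f).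
Proof. by apply/kdual_normP => //; exact: kdual_norm_ge0. Qed.

Fact kdual_normD f g : kdual_norm (f + g) <= kdual_norm f + kdual_norm g.
Proof.
apply/kdual_normP; first by rewrite addr_ge0 ?kdual_norm_ge0.
by apply: kboundedD; exact: kdual_norm_bounded.
Qed.

Lemma kdual_normZ_le (k : C) f : kdual_norm (k *: f) <= `|k| * kdual_norm f.
Proof.
apply/kdual_normP; first by rewrite mulr_ge0 ?kdual_norm_ge0.
by apply: kboundedZ; exact: kdual_norm_bounded.
Qed.

Fact kdual_normZ (k : C) f : kdual_norm (k *: f) = `|k| * kdual_norm f.
Proof.
apply/eqP; rewrite eq_le kdual_normZ_le /=.
have [->|k0] := eqVneq k 0; first by rewrite normr0 mul0r kdual_norm_ge0.
rewrite -ler_pdivlMl ?normr_gt0 // -normfV.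
by rewrite (le_trans _ (kdual_normZ_le _ _)) // scalerA mulVf // scale1r.
Qed.

Lemma kfun_le f i : `|kfun f i| <= kdual_norm f * knorm [:: (1, i)].
Proof.
have := kdual_norm_bounded f [:: (1, i)].
by rewrite /kpair big_cons big_nil /= conjC1 mul1r addr0.
Qed.

Fact kdual_norm0 f : kdual_norm f = 0 -> f = 0.
Proof.
move=> f0; apply: kspace_eq; apply/funext => i; apply/eqP.
by rewrite -normr_le0 (le_trans (kfun_le f i)) // f0 mul0r.
Qed.

HB.instance Definition _ :=
  Lmodule_isNormed.Build C kspace kdual_normD kdual_normZ kdual_norm0.

Lemma kfunB (f g : kspace) i : kfun (f - g) i = kfun f i - kfun g i.
Proof. by rewrite /= !fctE mulN1r. Qed.

Fact kspace_complete (F : set_system kspace) : ProperFilter F -> cauchy F -> cvg F.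
Proof.
move=> FF /cauchy_ballP Fc.
have ex e : 0 < e -> exists x : kspace, F [set y | `|x - y| < e].
  move=> e0; have /cauchyP /(_ e e0) [x Fx] : cauchy F by apply/cauchy_ballP.
  by exists x; move: Fx; rewrite -ball_normE.
have ev_cvg i : cvg ((fun f => kfun f i : C^o) @ F).
  apply: complex_complete; apply: cauchy_exP => e e0.
  have k1 : 0 < knorm [:: (1, i)] + 1 by rewrite ltr_wpDl ?knorm_ge0.
  have [x Fx] := ex _ (divr_gt0 e0 k1).
  exists (kfun x i : C^o); apply: (@filterS _ F _ _ _ _ Fx) => y /=.
  rewrite -ball_normE /ball_ /= ltr_pdivlMr // => xy.
  rewrite -kfunB (le_lt_trans (kfun_le _ i)) // (le_lt_trans _ xy) //.
  by rewrite ler_wpM2l ?kdual_norm_ge0 ?lerDl.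
pose l i : C := lim ((fun f => kfun f i : C^o) @ F).
have pcvg w : (fun f => kpair (kfun f) w : C^o) @ F --> (kpair l w : C^o).
  rewrite /kpair; elim: w => [|q w IH].
    rewrite big_nil (_ : (fun _ => _) = fun=> 0); first exact: cvg_cst.
    by apply/funext => f; rewrite big_nil.
  rewrite big_cons (_ : (fun _ => _) = fun f => (q.1^* * kfun f q.2 : C^o) + (\sum_(q <- w) q.1^* * kfun f q.2 : C^o)).
    have qcvg : (fun f : kspace => q.1^* * kfun f q.2 : C^o) @ F --> (q.1^* * l q.2 : C^o).
      exact: (cvgZl_tmp (k := q.1^*) (ev_cvg q.2)).
    exact: (@cvgD C C^o kspace F _ _ _ _ _ qcvg IH).
  by apply/funext => f; rewrite big_cons.
have dist e x : 0 < e -> F [set y | `|x - y| < e] -> kbounded (kfun x - l) e.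
  move=> e0 Fx w.
  rewrite kpairB.
  apply: (@le_cvg R _ F _ (fun f => `|kpair (kfun x) w - kpair (kfun f) w|) (fun=> e * knorm w)).
  - apply: (@cvg_norm C C^o); apply: (@cvgB C C^o) => //; exact: cvg_cst.
  - exact: cvg_cst.
  - apply: filterS Fx => f /= xf.
    have := @kdual_norm_bounded (x - f) w.
    have -> : kpair (kfun (x - f)) w = kpair (kfun x) w - kpair (kfun f) w.
      by rewrite -kpairB; congr kpair; apply/funext => i; rewrite kfunB.
    move=> /le_trans; apply; rewrite ler_wpM2r ?knorm_ge0 //; exact: ltW.
have lP e : 0 < e -> exists v, kbounded (l - kcomb v) e.
  move=> e0; have e2 := divr_gt0 e0 (ltr0n _ 2).
  have [x Fx] := ex _ e2; have [v hv] := kfunP x e2; exists v.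
  rewrite -(subrKA (kfun x)) (splitr e); apply: kboundedD => //.
  have := kboundedZ (-1) (dist _ _ e2 Fx); rewrite normrN1 mul1r.
  by congr kbounded; apply/funext => i; rewrite !fctE mulN1r opprB.
apply/cvg_ex; exists (KSpace lP); apply/cvgrPdist_lt => e e0.
have e4 : 0 < e / 4 by rewrite divr_gt0.
have [x Fx] := ex _ e4.
have lx : `|KSpace lP - x| <= e / 4.
  apply/kdual_normP; first exact: ltW.
  have := kboundedZ (-1) (dist _ _ e4 Fx); rewrite normrN1 mul1r.
  by congr kbounded; apply/funext => i; rewrite kfunB !fctE mulN1r opprB.
apply: filterS Fx => y /= xy.
rewrite -(subrKA x) (le_lt_trans (ler_normD _ _)) //.
rewrite (le_lt_trans (lerD lx (ltW xy))) //.
rewrite -mulrDl ltr_pdivrMr // -mulr2n -(mulr_natr e) ltr_pM2l //.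
by rewrite ltr_nat.
Qed.

HB.instance Definition _ := Uniform_isComplete.Build kspace kspace_complete.

Fact kcomb_kspace v e : 0 < e -> exists w, kbounded (kcomb v - kcomb w) e.
Proof. by move=> e0; exists v; rewrite subrr; exact/kbounded0/ltW. Qed.

Definition kembed v : kspace := KSpace (@kcomb_kspace v).
Definition kpoint i : kspace := kembed [:: (1, i)].

Lemma kpointE i j : kfun (kpoint i) j = kappa i j.
Proof. by rewrite /= /kcomb big_cons big_nil addr0 mul1r. Qed.

Lemma kembedE v : kembed v = \sum_(p <- v) p.1 *: kpoint p.2.
Proof.
apply: kspace_eq; elim: v => [|p v IH].
  by rewrite big_nil; apply/funext => i; rewrite /= /kcomb big_nil.
rewrite big_cons /= -IH; apply/funext => i.
by rewrite !fctE /= /kcomb !big_cons big_nil addr0 mul1r.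
Qed.

Lemma norm_kembed v : `|kembed v| = knorm v.
Proof.
apply/eqP; rewrite eq_le; apply/andP; split.
  by apply/kdual_normP; [exact: knorm_ge0|exact: kbounded_comb].
have [->|v0] := eqVneq (knorm v) 0; first exact: kdual_norm_ge0.
have vp : 0 < knorm v by rewrite lt0r v0 knorm_ge0.
have := kdual_norm_bounded (kembed v) v.
rewrite kpair_comb ger0_norm // -knorm_sqr expr2 ler_pM2r //.
Qed.

Lemma kpoint_total : clspan (range kpoint) = setT.
Proof.
apply/seteqP; split=> // f _; apply: approx_closed; first exact: closed_clspan.
move=> e e0; have e2 := divr_gt0 e0 (ltr0n _ 2).
have [v hv] := kfunP f e2; exists (kembed v).
  rewrite kembedE; elim: v {hv} => [|p v IH]; first by rewrite big_nil; exact: clspan0.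
  by rewrite big_cons; apply: clspanP => //; apply: sub_clspan; exists p.2.
apply: (@le_lt_trans _ _ (e / 2)); last by rewrite ltr_pdivrMr // ltr_pMr // ltr1n.
apply/kdual_normP; first exact: ltW.
by congr kbounded: hv; apply/funext => i; rewrite kfunB.
Qed.

(** The functional [g |-> <g, f>]: its values on the points are forced, and the bound needed to
    extend it is the definition of the dual norm of [f] together with [norm_kembed]. The inner
    product [kip] is its conjugate. *)
Let hex (f : kspace) : exists F : kspace -> C^o, [/\ linear F,
  forall g, `|F g| <= `|f| * `|g| & forall i, F (kpoint i) = (kfun f i)^*].
Proof.
apply: (@bounded_linear_extension C kspace (complexC R) I kpoint (fun i => (kfun f i)^*) _ kpoint_total) => s.
rewrite -kembedE norm_kembed.
have -> : \sum_(p <- s) p.1 *: ((kfun f p.2)^* : complexC R) = (kpair (kfun f) s)^*.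
  rewrite /kpair rmorph_sum; apply: eq_bigr => p _ /=.
  by rewrite rmorphM /= conjCK.
by rewrite norm_conjC; exact: kdual_norm_bounded.
Qed.

Let H (f : kspace) : kspace -> C^o := projT1 (cid (hex f)).
Let HP f : [/\ linear (H f),
  forall g, `|H f g| <= `|f| * `|g| & forall i, H f (kpoint i) = (kfun f i)^*].
Proof. exact: (projT2 (cid (hex f))). Qed.

Let Hbd f : bounded_op (H f).
Proof. by exists `|f|; case: (HP f). Qed.

Definition kip (f g : kspace) : C := (H f g)^*.

Fact kip_linear (k : C) (f g h : kspace) : kip (k *: f + g) h = k * kip f h + kip g h.
Proof.
have [lf _ Pf] := HP f; have [lg _ Pg] := HP g; have [l _ P] := HP (k *: f + g).
rewrite /kip -[in RHS](conjCK k) -rmorphM -rmorphD /=; congr (_^*).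
apply: (@clspan_eq C kspace C^o _ (H (k *: f + g)) (fun h => k^* * H f h + H g h) kpoint_total l) => //.
- by move=> c x y; rewrite lf lg; rewrite -![_ *: _]/(_ * _); ring.
- exists (`|k| * `|f| + `|g|) => x; rewrite (le_trans (ler_normD _ _)) // mulrDl lerD //.
    rewrite normrM norm_conjC -mulrA ler_wpM2l //; by case: (HP f).
  by case: (HP g).
- by move=> _ [i _ <-]; rewrite P Pf Pg /= fctE rmorphD rmorphM.
Qed.

Let Hpoint i g : H (kpoint i) g = kfun g i.
Proof.
have [l _ P] := HP (kpoint i).
apply: (@clspan_eq C kspace C^o _ (H (kpoint i)) (fun g => kfun g i : C^o) kpoint_total l) => //.
- exists (knorm [:: (1, i)]) => x; rewrite mulrC; exact: kfun_le.
- by move=> _ [j _ <-]; rewrite P !kpointE -kappa_herm.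
Qed.

Fact kip_herm f g : kip g f = (kip f g)^*.
Proof.
rewrite /kip conjCK.
have [lg _ Pg] := HP g.
suff -> : H g f = (H f g)^* by rewrite conjCK.
apply: (@clspan_eq C kspace C^o _ (H g) (fun f => (H f g)^* : C^o) kpoint_total lg) => //.
- by move=> c x y; exact: kip_linear.
- by exists `|g| => x; rewrite norm_conjC mulrC; case: (HP x).
- by move=> _ [i _ <-]; rewrite Pg Hpoint.
Qed.

Let kip_le f g : `|kip f g| <= `|f| * `|g|.
Proof. by rewrite norm_conjC; case: (HP f). Qed.

Let kip_embed f v : kip f (kembed v) = kpair (kfun f) v.
Proof.
have [l _ P] := HP f; rewrite /kip kembedE (lin_sum l) /kpair rmorph_sum.
apply: eq_bigr => p _; rewrite (linZ l) P -[_ *: _]/(_ * _) rmorphM /=.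
by rewrite conjCK.
Qed.

Fact kip_norm f : kip f f = `|f| ^+ 2.
Proof.
apply/eqP; rewrite -subr_eq0 -normr_le0; apply/ler_addgt0Pr => e e0; rewrite add0r.
have f1 : 0 < 4 * `|f| + 2 by rewrite ltr_wpDl // mulr_ge0.
(* With [u] within [d] of [f] and [|u| <= |f| + 1], the three error terms add up to [d (4 |f| + 2)].
   The form [t / (1 + t)] keeps [d] below both [t = e / (4 |f| + 2)] and [1]. *)
pose d := e / (4 * `|f| + 2) / (1 + e / (4 * `|f| + 2)).
have d00 : 0 < e / (4 * `|f| + 2) by rewrite divr_gt0.
have d0 : 0 < d by rewrite divr_gt0 // addr_gt0.
have d1 : d <= 1 by rewrite ler_pdivrMr ?addr_gt0 // mul1r lerDr.
have de : d * (4 * `|f| + 2) <= e.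
  rewrite -ler_pdivlMr // ler_pdivrMr ?addr_gt0 // mulrDr mulr1 lerDl mulr_ge0 //; exact: ltW.
have [|v] := @clspan_approx C kspace I kpoint f _ d d0.
  by rewrite kpoint_total.
rewrite -kembedE; set u := kembed v => fu.
have hu : kip u u = `|u| ^+ 2 by rewrite kip_embed kpair_comb norm_kembed knorm_sqr.
have nu : `|u| <= `|f| + 1.
  rewrite -[u](subrK f) addrC (le_trans (ler_normD _ _)) // lerD //.
  by rewrite distrC (le_trans (ltW fu)).
have lin2 x y z : kip x (y - z) = kip x y - kip x z.
  rewrite kip_herm -scaleN1r addrC kip_linear rmorphD rmorphM /= -!kip_herm.
  by rewrite rmorphN1 mulN1r addrC.
have lin1 x y z : kip (x - y) z = kip x z - kip y z.
  by rewrite -scaleN1r addrC kip_linear mulN1r addrC.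
have -> : kip f f - `|f| ^+ 2 = kip (f - u) f + kip u (f - u) - (`|f| - `|u|) * (`|f| + `|u|).
  by rewrite lin1 lin2 hu; ring.
apply: le_trans de.
have hn : `| `|f| - `|u| | <= d.
  have h1 := lerB_dist f u; have h2 := lerB_dist u f; rewrite distrC in h2.
  rewrite real_ler_norml ?realB ?normr_real //.
  rewrite (le_trans h1 (ltW fu)) andbT lerNl opprB; exact: le_trans h2 (ltW fu).
rewrite (le_trans (ler_normB _ _)) // normrM.
rewrite (@le_trans _ _ (d * `|f| + (`|f| + 1) * d + d * (`|f| + (`|f| + 1)))) //; last first.
  by rewrite le_eqVlt; apply/orP; left; apply/eqP; ring.
apply: lerD; last first.
  apply: ler_pM => //; rewrite ger0_norm ?addr_ge0 //; exact: lerD.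
rewrite (le_trans (ler_normD _ _)) // lerD //.
  by rewrite (le_trans (kip_le _ _)) // ler_wpM2r // ltW.
by rewrite (le_trans (kip_le _ _)) // ler_pM // ltW.
Qed.

HB.instance Definition _ :=
  CompleteNormedModule_isHilbert.Build R kspace kip_linear kip_herm kip_norm.

Lemma kolmogorov_subproof : exists (K : hilbertType R) (phi : I -> K),
  (forall i j, hip (phi i) (phi j) = kappa i j) /\ clspan (range phi) = setT.
Proof.
exists kspace, kpoint; split=> [i j|]; last exact: kpoint_total.
by rewrite -[LHS]/(kip _ _) kip_embed /kpair big_cons big_nil addr0 conjC1 mul1r kpointE.
Qed.
End Kolmogorov.

(** * Representations of C*-algebras *)

Section HilbertTheory.
Variables (R : realType) (H : hilbertType R).
Local Notation C := R[i].
Implicit Types x y z : H.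

Lemma hipDl x y z : hip (x + y) z = hip x z + hip y z.
Proof. by have := hip_linear 1 x y z; rewrite scale1r mul1r. Qed.

Lemma hip0l z : hip 0 z = 0.
Proof. by apply: (addrI (hip 0 z)); rewrite -hipDl !addr0. Qed.

Lemma hipZl (k : C) x z : hip (k *: x) z = k * hip x z.
Proof. by have := hip_linear k x 0 z; rewrite hip0l !addr0. Qed.

Lemma hipDr x y z : hip z (x + y) = hip z x + hip z y.
Proof. by rewrite hip_herm hipDl rmorphD /= -!hip_herm. Qed.

Lemma hipZr (k : C) x z : hip z (k *: x) = k^* * hip z x.
Proof. by rewrite hip_herm hipZl rmorphM /= -hip_herm. Qed.

Lemma hip0r z : hip z 0 = 0.
Proof. by rewrite hip_herm hip0l conjC0. Qed.

Lemma hipNl x z : hip (- x) z = - hip x z.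
Proof. by rewrite -scaleN1r hipZl mulN1r. Qed.

Lemma hipNr x z : hip z (- x) = - hip z x.
Proof. by rewrite hip_herm hipNl rmorphN /= -hip_herm. Qed.

Lemma hipBl x y z : hip (x - y) z = hip x z - hip y z.
Proof. by rewrite hipDl hipNl. Qed.

Lemma hipBr x y z : hip z (x - y) = hip z x - hip z y.
Proof. by rewrite hipDr hipNr. Qed.

Lemma hip_suml (I : Type) (s : seq I) (F : I -> H) z :
  hip (\sum_(i <- s) F i) z = \sum_(i <- s) hip (F i) z.
Proof.
elim: s => [|i s IH]; first by rewrite !big_nil hip0l.
by rewrite !big_cons hipDl IH.
Qed.

Lemma hip_sumr (I : Type) (s : seq I) (F : I -> H) z :
  hip z (\sum_(i <- s) F i) = \sum_(i <- s) hip z (F i).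
Proof.
elim: s => [|i s IH]; first by rewrite !big_nil hip0r.
by rewrite !big_cons hipDr IH.
Qed.

Lemma hip_ge0 x : 0 <= hip x x.
Proof. by rewrite hip_norm exprn_ge0. Qed.

Lemma hip_le x y : `|hip x y| <= `|x| * `|y|.
Proof.
rewrite -(@ler_pXn2r _ 2) ?nnegrE ?mulr_ge0 // exprMn -!hip_norm.
apply: cauchy_schwarz_discr; rewrite ?hip_ge0 // => l.
have := hip_ge0 (x + l *: y).
by rewrite hipDl !hipDr !hipZl !hipZr -hip_herm; congr (0 <= _); ring.
Qed.

Lemma hip_eq0 (I : Type) (e : I -> H) x : clspan (range e) = setT ->
  (forall i, hip x (e i) = 0) -> x = 0.
Proof.
move=> eT h; suff hx : forall y, hip y x = 0.
  by apply/eqP; rewrite -normr_eq0 -sqrf_eq0 -hip_norm hx.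
apply: (@clspan_eq C H C^o _ (fun y => hip y x : C^o) (fun=> 0) eT).
- by move=> k u v; rewrite hip_linear.
- by exists `|x| => y; rewrite mulrC hip_le.
- by move=> k u v; rewrite scaler0 addr0.
- by exists 0 => y; rewrite normr0 mul0r.
- by move=> _ [i _ <-]; rewrite hip_herm h conjC0.
Qed.

Lemma hip_ext (I : Type) (e : I -> H) x y : clspan (range e) = setT ->
  (forall i, hip x (e i) = hip y (e i)) -> x = y.
Proof.
move=> eT h; apply/eqP; rewrite -subr_eq0; apply/eqP.
by apply: (hip_eq0 eT) => i; rewrite hipBl h subrr.
Qed.

End HilbertTheory.

(** All that is used of the concrete space [kspace] is a total family with prescribed inner
    products. Every Hilbert space constructed below comes from a suitable kernel. *)
Lemma kolmogorov (R : realType) (I : Type) (kappa : I -> I -> R[i]) :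
  (forall i j, kappa j i = (kappa i j)^*) ->
  (forall v : seq (R[i] * I),
    0 <= \sum_(p <- v) \sum_(q <- v) p.1 * q.1^* * kappa p.2 q.2) ->
  exists (K : hilbertType R) (phi : I -> K),
  (forall i j, hip (phi i) (phi j) = kappa i j) /\ clspan (range phi) = setT.
Proof. exact: kolmogorov_subproof. Qed.

(* With [1 - star a a = (1 - y)^2], the right-hand side exceeds the left-hand
   one by the square of the norm of [xi - eta y]. *)
Lemma star_action_le (R : realType) (A : cstarType R) (H : hilbertType R)
    (xi : H) (eta : A -> H) : linear eta ->
  (forall a b, hip (eta a) (eta b) = hip xi (eta (star a ** b))) ->
  (forall a, hip (eta a) xi = hip xi (eta (star a))) ->
  forall a, `|eta a| <= `|a| * `|xi|.
Proof.
move=> le h1 h2 a.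
have [->|a0] := eqVneq a 0; first by rewrite (lin0 le) !normr0 mul0r.
have na : 0 < `|a| by rewrite normr_gt0.
rewrite -ler_pdivrMl //.
set b := `|a|^-1 *: a.
have nb : `|b| = 1 by rewrite normfZV.
have -> : `|a|^-1 * `|eta a| = `|eta b|.
  by rewrite (linZ le) normrZ ger0_norm // invr_ge0.
have k1 : `|star b ** b| <= 1 by rewrite cstar_norm nb expr1n.
have [y [_ yk ys _]] := sqrt_exists k1.
have sy : star y = y by apply: ys; rewrite starM starK.
rewrite -(@ler_pXn2r _ 2) ?nnegrE // -subr_ge0 -!hip_norm h1.
have := hip_ge0 (xi - eta y).
rewrite hipBl !hipBr h2 h1 !sy; congr (0 <= _).
have -> : star b ** b = y + y - y ** y by rewrite yk addrK.
rewrite (linB le) (linD le) hipBr hipDr; ring.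
Qed.

Section Representations.
Variables (R : realType) (A : cstarType R).
Local Notation C := R[i].

Lemma rep_le (H : hilbertType R) (p : A -> H -> H) : is_rep p ->
  forall a h, `|p a h| <= `|a| * `|h|.
Proof.
move=> [_ pl pM ps] a h; move: a.
apply: (star_action_le (eta := fun a => p a h)) => // a b; first by rewrite ps -pM.
Qed.

Lemma rep_lin (H : hilbertType R) (p : A -> H -> H) : is_rep p ->
  forall a, linear (p a).
Proof. by move=> [pb _ _ _] a; case: (pb a). Qed.

(** Boundedness is automatic: for a finite combination [xi] of the points, [star_action_le] bounds
    its image under [a] by [|a| |xi|]. So only an action on the indices has to be given, and it
    extends by continuity. *)
Lemma total_rep (H : hilbertType R) (I : Type) (phi : I -> H) (pi : A -> I -> I) :
  clspan (range phi) = setT ->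
  (forall k a b i, phi (pi (k *: a + b) i) = k *: phi (pi a i) + phi (pi b i)) ->
  (forall a b i, phi (pi (a ** b) i) = phi (pi a (pi b i))) ->
  (forall a i j, hip (phi (pi a i)) (phi j) = hip (phi i) (phi (pi (star a) j))) ->
  exists p : A -> H -> H, is_rep p /\ forall a i, p a (phi i) = phi (pi a i).
Proof.
move=> phiT pil piM pis.
have bd a (s : seq (C * I)) :
    `|\sum_(q <- s) q.1 *: phi (pi a q.2)| <= `|a| * `|\sum_(q <- s) q.1 *: phi q.2|.
  move: a; apply: (@star_action_le R A H _ (fun a => \sum_(q <- s) q.1 *: phi (pi a q.2))).
  - move=> k a b; rewrite scaler_sumr -big_split; apply: eq_bigr => q _ /=.
    by rewrite pil scalerDr !scalerA [k * _]mulrC.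
  - move=> a b; rewrite !hip_suml; apply: eq_bigr => q _.
    rewrite !hip_sumr; apply: eq_bigr => r _.
    by rewrite !hipZl !hipZr pis piM.
  - move=> a; rewrite !hip_suml; apply: eq_bigr => q _.
    rewrite !hip_sumr; apply: eq_bigr => r _.
    by rewrite !hipZl !hipZr pis.
have ex a := @bounded_linear_extension C H H I phi (phi \o pi a) `|a| phiT (bd a).
have [p pP] := choice ex.
have pl a : linear (p a) by case: (pP a).
have pb a : bounded_op (p a) by exists `|a|; case: (pP a).
have pphi a i : p a (phi i) = phi (pi a i) by case: (pP a).
have Dl (f g : H -> H) : linear f -> linear g -> forall k : C, linear (fun h => k *: f h + g h).
  move=> lf lg k c x y; rewrite lf lg !scalerDr addrACA; congr (_ + _ + _).
  by rewrite !scalerA mulrC.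
have Db (f g : H -> H) : bounded_op f -> bounded_op g -> forall k : C, bounded_op (fun h => k *: f h + g h).
  move=> [m fm] [n gn] k; exists (`|k| * m + n) => h.
  by rewrite (le_trans (ler_normD _ _)) // mulrDl lerD // normrZ -mulrA ler_wpM2l.
exists p; split=> //; split=> //.
- move=> h k a b; move: h.
  apply: (clspan_eq phiT); rewrite ?pl //; first exact: Dl; first exact: Db.
  by move=> _ [i _ <-]; rewrite !pphi pil.
- move=> a b h; move: h; apply: (clspan_eq phiT) => //.
  + exact: lin_comp.
  + have /bounded_opP[m m0 fm] := pb a; have [n gn] := pb b.
    by exists (m * n) => h; rewrite (le_trans (fm _)) // -mulrA ler_wpM2l.
  + by move=> _ [i _ <-]; rewrite !pphi piM.
- have hipl (f : H -> H) k : linear f -> linear (fun h => hip (f h) k : C^o).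
    by move=> lf c x y; rewrite lf hip_linear.
  have hipb (f : H -> H) k : bounded_op f -> bounded_op (fun h => hip (f h) k : C^o).
    move=> [m fm]; exists (m * `|k|) => h; rewrite (le_trans (hip_le _ _)) //.
    by rewrite mulrAC ler_wpM2r.
  have step a i k : hip (p a (phi i)) k = hip (phi i) (p (star a) k).
    rewrite hip_herm [RHS]hip_herm; congr (_^*); move: k.
    apply: (@clspan_eq C H C^o _ (fun k => hip k (p a (phi i)) : C^o)
      (fun k => hip (p (star a) k) (phi i) : C^o) phiT) => //.
    + exact: (hipl id).
    + by apply: (hipb id); exists 1 => x; rewrite mul1r.
    + exact: hipl.
    + exact: hipb.
    + by move=> _ [j _ <-]; rewrite !pphi pis starK.
  move=> a h k; move: h.
  apply: (@clspan_eq C H C^o _ (fun h => hip (p a h) k : C^o)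
      (fun h => hip h (p (star a) k) : C^o) phiT) => //.
  + exact: hipl.
  + exact: hipb.
  + exact: (hipl id).
  + by apply: (hipb id); exists 1 => x; rewrite mul1r.
  + by move=> _ [j _ <-].
Qed.

Lemma sum_herm_pos (H : hilbertType R) (I : Type) (f : I -> H) (v : seq (C * I)) :
  0 <= \sum_(p <- v) \sum_(q <- v) p.1 * q.1^* * hip (f p.2) (f q.2).
Proof.
have -> : \sum_(p <- v) \sum_(q <- v) p.1 * q.1^* * hip (f p.2) (f q.2) =
  hip (\sum_(p <- v) p.1 *: f p.2) (\sum_(p <- v) p.1 *: f p.2).
  rewrite hip_suml; apply: eq_bigr => q _.
  rewrite hip_sumr; apply: eq_bigr => r _.
  by rewrite hipZl hipZr mulrA.
exact: hip_ge0.
Qed.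

End Representations.

Section MultiplierRep.
Variables (R : realType) (A : cstarType R).
Local Notation C := R[i].

(** The vector [phi (a, h)] stands for [p a h], so [K] is a copy of the essential subspace of [p].
    Multipliers act there through the first argument, even when [p] is degenerate. *)
Lemma rep_multiplier (H : hilbertType R) (p : A -> H -> H) : is_rep p ->
  exists (K : hilbertType R) (P : 'M(A) -> K -> K) (phi : A * H -> K),
  [/\ is_rep P, clspan (range phi) = setT,
    forall x y, hip (phi x) (phi y) = hip (p x.1 x.2) (p y.1 y.2)
    & forall m a h, P m (phi (a, h)) = phi (lmul m a, h)].
Proof.
move=> [pb pl pM ps].
have [||K [phi [hphi phiT]]] := @kolmogorov R (A * H)%type
  (fun x y => hip (p x.1 x.2) (p y.1 y.2)).
- by move=> x y; rewrite -hip_herm.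
- by move=> v; exact: (@sum_herm_pos R H _ (fun x : A * H => p x.1 x.2)).
have [|||P [Prep PE]] := @total_rep R _ K _ phi (fun (m : 'M(A)) (x : A * H) => (lmul m x.1, x.2)) phiT.
- move=> k a b i; apply: (hip_ext phiT) => j.
  rewrite hip_linear !hphi /= -hip_linear; congr hip.
  exact: (pl i.2).
- by [].
- move=> a i j; rewrite !hphi /= !ps -!pM; congr (hip _ (p _ _)).
  by have := lrmul (star a : 'M(A)) (star i.1) j.1; rewrite /= starK => ->.
- by exists K, P, phi; split=> // m a h; rewrite PE.
Qed.
End MultiplierRep.

(** [F] is known to be bounded by some unspecified constant [M]; approximation by combinations
    improves that constant to [c]. *)
Lemma bounded_total (K : numFieldType) (V W : normedModType K) (I : Type)
    (e : I -> V) (F : V -> W) (c : K) : clspan (range e) = setT -> linear F ->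
  bounded_op F -> 0 <= c ->
  (forall s : seq (K * I), `|F (\sum_(p <- s) p.1 *: e p.2)| <=
     c * `|\sum_(p <- s) p.1 *: e p.2|) ->
  forall v, `|F v| <= c * `|v|.
Proof.
move=> eT lF /bounded_opP[M M0 FM] c0 h v; apply/ler_addgt0Pr => d d0.
have cM : 0 < c + M + 1 by rewrite ltr_wpDl // addr_ge0.
have [|s vs] := @clspan_approx _ _ _ e v _ _ (divr_gt0 d0 cM).
  by rewrite eT.
set u := \sum_(p <- s) _ in vs h; have hu := h s.
rewrite -[v in F v](subrK u) (linD lF) (le_trans (ler_normD _ _)) //.
have nu : `|u| <= `|v| + `|v - u|.
  by rewrite -[u in `|u|](subrK v) addrC (le_trans (ler_normD _ _)) // lerD // distrC.
rewrite (le_trans (lerD (FM _) (le_trans hu (ler_wpM2l c0 nu)))) //.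
rewrite mulrDr addrCA lerD // -mulrDl.
move: vs; rewrite ltr_pdivlMr // => /ltW; apply: le_trans; rewrite mulrC ler_wpM2l //.
by rewrite addrC lerDl.
Qed.

Section CStarExtra.
Variables (R : realType) (A : cstarType R).
Local Notation C := R[i].

Lemma memb_norm (a : A) : `|memb a| = `|a|.
Proof.
apply/eqP; rewrite eq_le; apply/andP; split.
  by apply/mnormP => // b; exact: norm_amul.
have [->|a0] := eqVneq a 0; first by rewrite normr0.
have na : 0 < `|a| by rewrite normr_gt0.
rewrite -(ler_pM2r na) -expr2 -cstar_norm_r -[in leRHS](norm_star a).
exact: (le_mnorm (memb a)).
Qed.

Lemma mulm1 (x : 'M(A)) : x ** mone A = x. Proof. exact: multiplier_eq. Qed.
Lemma mul1m (x : 'M(A)) : mone A ** x = x. Proof. exact: multiplier_eq. Qed.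
Lemma star1 : star (mone A : 'M(A)) = mone A.
Proof. by apply: multiplier_eq => a; rewrite /= starK. Qed.
Lemma mone_norm : `|mone A : 'M(A)| <= 1.
Proof. by apply/mnormP => // a; rewrite mul1r. Qed.

(** The left action determines the right one by [rmul x a ** c = a ** lmul x c], since only [0]
    annihilates all of [A]. *)
Lemma multiplier_lext (x y : 'M(A)) : lmul x =1 lmul y -> x = y.
Proof.
move=> h; apply: multiplier_eq => // a; apply/eqP; rewrite -subr_eq0; apply/eqP.
by apply: amul_eq0r => c; rewrite amulBl -!lrmul h subrr.
Qed.

Lemma membM (a b : A) : memb (a ** b) = memb a ** memb b.
Proof. by apply: multiplier_lext => c /=; rewrite amulA. Qed.
Lemma memb_star (a : A) : memb (star a) = star (memb a).
Proof. by apply: multiplier_lext => c /=; rewrite starM starK. Qed.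
Lemma memb_linear : linear (@memb R A).
Proof. by move=> k a b; apply: multiplier_lext => c /=; rewrite amulDl amulZl. Qed.
Lemma memb_inj : injective (@memb R A).
Proof.
move=> a b ab; apply/eqP; rewrite -subr_eq0 -normr_eq0 -memb_norm.
by rewrite (linB memb_linear) ab subrr normr0.
Qed.
Lemma mul_memb (m : 'M(A)) a : m ** memb a = memb (lmul m a).
Proof. by apply: multiplier_lext => c /=; rewrite lmulM. Qed.
Lemma memb_mul (m : 'M(A)) a : memb a ** m = memb (rmul m a).
Proof. by apply: multiplier_lext => c /=; rewrite lrmul. Qed.

(** As [h] and [s] commute, [h ** h + s ** s = u ** star u] for [u = h + 'i *: s], and [h] is the
    real part of [u]. This inequality takes the place of the order on positive elements. *)
Lemma sum_squares_le (h s : A) : star h = h -> star s = s -> h ** s = s ** h ->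
  `|h| ^+ 2 <= `|h ** h + s ** s|.
Proof.
move=> sh ss hs; pose u := h + 'i *: s.
have su : star u = h - 'i *: s by rewrite starD starZ sh ss conjCi scaleNr.
have -> : h ** h + s ** s = u ** star u.
  rewrite su amulBr !amulDl !amulZl !amulZr hs scalerA -expr2 sqrCi scaleN1r.
  rewrite opprD opprK addrA; congr (_ + _); rewrite [X in _ = X - _]addrC.
  by rewrite [RHS]addrAC subrr add0r.
rewrite cstar_norm_r lerXn2r ?nnegrE //.
have -> : h = 2^-1 *: (u + star u).
  rewrite su /u addrACA subrr addr0 -mulr2n -[h *+ 2]scaler_nat scalerA.
  by rewrite mulVf ?pnatr_eq0 // scale1r.
rewrite normrZ ger0_norm ?invr_ge0 // ler_pdivrMl // mulr_natl mulr2n.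
by rewrite (le_trans (ler_normD _ _)) // norm_star.
Qed.
End CStarExtra.

Section UnitalRoot.
Variables (R : realType) (A : cstarType R).
Local Notation e := (mone A : 'M(A)).
Implicit Types k h z : 'M(A).

Lemma unital_sqrt k : `|k| <= 1 -> star k = k -> exists s : 'M(A),
  [/\ star s = s, s ** s = e - k, `|e - s| <= 1
    & forall z, z ** k = k ** z -> z ** s = s ** z].
Proof.
move=> k1 sk; have [y [y1 yk ys yz]] := sqrt_exists k1; exists (e - y); split.
- by rewrite starB star1 ys.
- rewrite amulBl !amulBr !mul1m mulm1.
  rewrite (_ : k = y + y - y ** y); last by rewrite yk addrK.
  by rewrite !opprB -addrA; congr (_ + _); rewrite opprD addrCA.
- by rewrite opprB addrC subrK.
- by move=> z /yz h; rewrite amulBr amulBl mulm1 mul1m h.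
Qed.

(** A square root [s] of [e - h ** h] commutes with [h], so [sum_squares_le] gives
    [|s|^2 <= |s ** s + h ** h| = |e|]. *)
Lemma unital_sub_square_le h : `|h| <= 1 -> star h = h -> `|e - h ** h| <= 1.
Proof.
move=> h1 sh; have hh1 : `|h ** h| <= 1.
  by rewrite (le_trans (norm_amul _ _)) // mulr_ile1.
have [|s [ss sE _ sz]] := unital_sqrt hh1; first by rewrite starM sh.
rewrite -sE (le_trans (norm_amul _ _)) // -expr2.
apply: (@le_trans _ _ `|s ** s + h ** h|).
  by apply: sum_squares_le => //; rewrite sz // amulA.
by rewrite sE subrK mone_norm.
Qed.

End UnitalRoot.

(** * Faithful representations are isometric *)

Section Isometry.
Variables (R : realType).
Local Notation C := R[i].

(** Evaluate the quadratic form at [xi + P t xi]: the diagonal terms vanish and each of the two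
    cross terms equals [|P t xi|^2]. *)
Lemma rep_herm_eq0 (B : cstarType R) (K : hilbertType R) (P : B -> K -> K) t :
  is_rep P -> star t = t -> (forall xi, hip (P t xi) xi = 0) ->
  forall xi, P t xi = 0.
Proof.
move=> rP st h xi; have [_ _ _ Ps] := rP; have lP := rep_lin rP t.
have := h (xi + P t xi).
have e2 : hip (P t (P t xi)) xi = hip (P t xi) (P t xi) by rewrite Ps st.
rewrite (linD lP) hipDl !hipDr !h add0r addr0 e2 -mulr2n => /eqP.
by rewrite mulrn_eq0 /= hip_norm sqrf_eq0 normr_eq0 => /eqP.
Qed.

Lemma real_norm_sub_ge0 (a q : C) : q^* = q -> `|q| <= a -> 0 <= a - q.
Proof.
move=> qr qa; rewrite subr_ge0 (le_trans _ qa) // real_ler_norm //.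
by apply/CrealP.
Qed.

Lemma rep_hip_real (B : cstarType R) (K : hilbertType R) (P : B -> K -> K) t xi :
  is_rep P -> star t = t -> (hip (P t xi) xi)^* = hip (P t xi) xi.
Proof. by move=> [_ _ _ Ps] st; rewrite -hip_herm Ps st. Qed.

(* If [|P g xi| <= d |xi|] with [d < |g| = 1], the positive elements
   [y = (d^2 - g^2) / 2] (in the representation) and [z = |y|] are equal, so
   that [g^2 + 2 y = d^2] with [y] a square commuting with [g]. *)
Lemma unital_rep_isometric (A : cstarType R) (K : hilbertType R)
    (P : 'M(A) -> K -> K) (g : 'M(A)) (d : C) :
  is_faithful_rep P -> (forall xi, P (mone A) xi = xi) -> star g = g -> 0 <= d ->
  (forall xi, `|P g xi| <= d * `|xi|) -> `|g| <= d.
Proof.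
move=> [rP fP] P1 sg d0 gd; have [_ Pl PM Ps] := rP.
case: (real_leP (normr_real g) (ger0_real d0)) => // dg; exfalso.
have ng : 0 < `|g| := le_lt_trans d0 dg.
pose h := `|g|^-1 *: g; pose c := `|g|^-1 * d.
have hE xi : P h xi = `|g|^-1 *: P g xi by exact: (linZ (Pl xi)).
have nV : 0 <= `|g|^-1 by rewrite invr_ge0.
have c0 : 0 <= c by rewrite mulr_ge0.
have c1 : c < 1 by rewrite /c mulrC ltr_pdivrMr // mul1r.
have hc xi : `|P h xi| <= c * `|xi|.
  by rewrite hE normrZ ger0_norm // -mulrA ler_wpM2l.
have h1 : `|h| = 1 by rewrite normfZV // -normr_gt0.
have sh : star h = h by rewrite starZ sg conj_Creal // ger0_real.
clearbody h c; clear g d sg d0 gd dg ng hE nV.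
pose r := c ^+ 2.
have r0 : 0 <= r by rewrite exprn_ge0.
have rc : r^* = r := conj_Creal (ger0_real r0).
have r1 : r < 1 by rewrite expr_lt1.
pose e : 'M(A) := mone A.
have sk : star (h ** h) = h ** h by rewrite starM sh.
have nk : `|h ** h| <= 1 by rewrite (le_trans (norm_amul _ _)) // h1 mulr1.
pose y : 'M(A) := 2^-1 *: (r *: e - h ** h).
have sy : star y = y.
  rewrite starZ starB starZ star1 sk rc conj_Creal // ger0_real // invr_ge0 //.
have ny : `|y| <= 1.
  rewrite normrZ ger0_norm ?invr_ge0 // ler_pdivrMl // mulr1.
  rewrite (le_trans (ler_normB _ _)) // -[leRHS]/(1 + 1) lerD // normrZ ger0_norm //.
  by rewrite mulr_ile1 ?mone_norm // ltW.
have nk0 := unital_sub_square_le ny sy.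
(* The root is taken for [k = mone A - y ** y], so that [z ** z = y ** y]. The bound
   [|mone A - z| <= 1] is what makes the form of [P z] nonnegative. *)
have [|z [sz zz nz cz]] := unital_sqrt nk0; first by rewrite starB star1 starM sy.
rewrite opprB addrC subrK in zz.
have yk0 : y ** (mone A - y ** y) = (mone A - y ** y) ** y.
  by rewrite amulBr amulBl mulm1 mul1m amulA.
have yz : y ** z = z ** y := cz _ yk0.
have Pz xi : 0 <= hip (P z xi) xi.
  have -> : P z xi = xi - P (e - z) xi.
    by rewrite (linB (Pl xi)) P1 opprB addrC subrK.
  rewrite hipBl; apply: real_norm_sub_ge0.
    by rewrite (rep_hip_real _ rP) // starB star1 sz.
  rewrite hip_norm (le_trans (hip_le _ _)) // expr2 ler_wpM2r //.
  by rewrite (le_trans (rep_le rP _ _)) // ler_piMl.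
have Py xi : 0 <= hip (P y xi) xi.
  rewrite (linZ (Pl xi)) (linB (Pl xi)) (linZ (Pl xi)) P1 hipZl hipBl hipZl.
  rewrite mulr_ge0 ?invr_ge0 // PM Ps sh !hip_norm subr_ge0.
  by rewrite /r -exprMn lerXn2r ?nnegrE ?mulr_ge0.
pose D := z - y.
have sD : star D = D by rewrite starB sz sy.
have DD : (z + y) ** D = 0.
  by rewrite amulBr !amulDl yz zz [z ** y + _]addrC subrr.
(* The forms of [P z] and [P y] are nonnegative and their sum vanishes at [P D xi], because
   [(z + y) ** D = 0]. So both vanish there, and with them the form of [D] at [P D xi]. *)
have key xi : hip (P (D ** (D ** D)) xi) xi = 0.
  rewrite PM Ps sD PM; set eta := P D xi.
  have : hip (P z eta) eta + hip (P y eta) eta = 0.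
    rewrite -hipDl -(linD (Pl eta)) -PM DD (lin0 (Pl xi)) hip0l //.
  move=> /eqP; rewrite paddr_eq0 // => /andP[/eqP e1 /eqP e2].
  by rewrite (linB (Pl eta)) hipBl e1 e2 subrr.
have D3 : D ** (D ** D) = 0.
  apply: fP; apply: rep_herm_eq0 => //.
  by rewrite !starM !sD amulA.
have D0 : D = 0.
  have h2 : `|D ** D| = `|D| ^+ 2 by rewrite -{1}sD cstar_norm.
  have : `|(D ** D) ** (D ** D)| = `|D ** D| ^+ 2.
    by rewrite -{1}(_ : star (D ** D) = D ** D) ?cstar_norm // starM sD.
  rewrite -amulA D3 amul0r normr0 h2 => /esym/eqP.
  by rewrite !expf_eq0 /= normr_eq0 => /eqP.
have zy : z = y by apply/eqP; rewrite -subr_eq0 -/D D0.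
have [|v [sv vv _ cv]] := unital_sqrt nz; first by rewrite starB star1 sz.
rewrite opprB addrC subrK zy in vv.
have hy : h ** y = y ** h.
  by rewrite amulZr amulZl amulBr amulBl amulZr amulZl mulm1 mul1m amulA.
have hz : h ** z = z ** h.
  apply: cz; rewrite amulBr amulBl mulm1 mul1m; congr (_ - _).
  by rewrite amulA hy -amulA hy amulA.
have hv : h ** v = v ** h.
  by apply: cv; rewrite amulBr amulBl mulm1 mul1m hz.
have s2 : (sqrtC 2)^* = sqrtC (2 : C).
  by rewrite conj_Creal // ger0_real // sqrtC_ge0.
have := @sum_squares_le R _ h (sqrtC 2 *: v) sh.
rewrite starZ sv s2 => /(_ erefl); rewrite amulZr amulZl hv => /(_ erefl).
rewrite amulZl amulZr vv scalerA -expr2 sqrtCK scalerA mulfV ?pnatr_eq0 // scale1r.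
rewrite addrC subrK h1 expr1n normrZ ger0_norm // => h'.
have := lt_le_trans r1 h'; rewrite -subr_gt0 => h''.
have : r * `|e| <= r by rewrite ler_piMr // mone_norm.
by move=> /(le_trans h') /(lt_le_trans r1); rewrite ltxx.
Qed.

Section Rep.
Variables (A : cstarType R) (H : hilbertType R) (p : A -> H -> H).
Hypothesis rp : is_faithful_rep p.

Lemma rep_multiplier_faithful (K : hilbertType R) (P : 'M(A) -> K -> K)
    (phi : A * H -> K) : is_rep P ->
  (forall x y, hip (phi x) (phi y) = hip (p x.1 x.2) (p y.1 y.2)) ->
  (forall m a h, P m (phi (a, h)) = phi (lmul m a, h)) -> is_faithful_rep P.
Proof.
move=> rP hphi PE; split=> // m h; apply: multiplier_lext => a /=.
rewrite amul0l; apply: rp.2 => k; have := hphi (lmul m a, k) (lmul m a, k).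
rewrite -PE h hip0l /= hip_norm => /esym/eqP.
by rewrite sqrf_eq0 normr_eq0 => /eqP.
Qed.

(** The bound is carried over to the space of [rep_multiplier], where [mone A] acts as the identity,
    and to the adjoint operator. [unital_rep_isometric] then applies to the self-adjoint
    [star a ** a] with the constant [c ^+ 2]. *)
Lemma faithful_rep_isometric a (c : C) : 0 <= c ->
  (forall h, `|p a h| <= c * `|h|) -> `|a| <= c.
Proof.
move=> c0 hc; have [K [P [phi [rP phiT hphi PE]]]] := rep_multiplier rp.1.
have fP := rep_multiplier_faithful rP hphi PE.
have [_ Pl PM Ps] := rP; have [_ pl pM ps] := rp.1.
have hb xi : `|P (memb a) xi| <= c * `|xi|.
  move: xi; apply: (bounded_total phiT (rep_lin rP _)) => //.
    by case: rP => /(_ (memb a))[].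
  move=> s; rewrite -(@ler_pXn2r _ 2) ?nnegrE ?mulr_ge0 // exprMn -!hip_norm.
  have hs (b : A -> A) : hip (\sum_(q <- s) q.1 *: phi (b q.2.1, q.2.2))
      (\sum_(q <- s) q.1 *: phi (b q.2.1, q.2.2)) =
      hip (\sum_(q <- s) q.1 *: p (b q.2.1) q.2.2) (\sum_(q <- s) q.1 *: p (b q.2.1) q.2.2).
    rewrite !hip_suml; apply: eq_bigr => q _; rewrite !hip_sumr; apply: eq_bigr => t _.
    by rewrite !hipZl !hipZr hphi.
  have := hs id; rewrite (eq_bigr (fun q => q.1 *: phi q.2)); last first.
    by move=> q _; case: q => ? [].
  move=> ->; rewrite (lin_sum (rep_lin rP _)).
  rewrite (eq_bigr (fun q => q.1 *: phi (a ** q.2.1, q.2.2))); last first.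
    by move=> [k [b h]] _; rewrite (linZ (rep_lin rP _)) PE.
  rewrite (hs (amul a)) (eq_bigr (fun q => p a (q.1 *: p q.2.1 q.2.2))); last first.
    by move=> [k [b h]] _; rewrite (linZ (rep_lin rp.1 _)) pM.
  rewrite -(lin_sum (rep_lin rp.1 _)) !hip_norm -exprMn lerXn2r ?nnegrE ?mulr_ge0 //.
have hbs xi : `|P (star (memb a)) xi| <= c * `|xi|.
  have [->|x0] := eqVneq (P (star (memb a)) xi) 0; first by rewrite normr0 mulr_ge0.
  have nx : 0 < `|P (star (memb a)) xi| by rewrite normr_gt0.
  rewrite -(ler_pM2r nx) -expr2 -hip_norm Ps starK.
  rewrite (le_trans (real_ler_norm _)) //.
    by apply: ger0_real; rewrite -{1}[memb a]starK -Ps hip_ge0.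
  rewrite (le_trans (hip_le _ _)) // [c * _]mulrC -mulrA ler_wpM2l //.
have sg : star (memb (star a ** a)) = memb (star a ** a).
  by rewrite -memb_star starM starK.
have P1 xi : P (mone A) xi = xi.
  move: xi; apply: (clspan_eq phiT (rep_lin rP _)) => //.
  - by case: rP => /(_ (mone A))[].
  - by exists 1 => x; rewrite mul1r.
  - by move=> _ [[b h] _ <-]; rewrite PE.
have := unital_rep_isometric fP P1 sg (exprn_ge0 2 c0).
rewrite memb_norm cstar_norm => h.
rewrite -(@ler_pXn2r _ 2) ?nnegrE //; apply: h => xi.
rewrite membM memb_star PM (le_trans (hbs _)) // expr2 -mulrA ler_wpM2l //.
Qed.

End Rep.
End Isometry.

(** * Approximate units *)

Lemma complex_archi (R : realType) (e : R[i]) : 0 < e -> exists n : nat, n.+1%:R^-1 <= e.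
Proof.
move=> e0; have eR : e = (complex.Re e)%:C%C by rewrite ReK // ltW.
have e1 : 0 < complex.Re e by rewrite -ltcR -eR.
exists (Num.truncn (complex.Re e)^-1).
have h := truncnS_gt (complex.Re e)^-1.
rewrite invf_ple ?posrE ?ltr0Sn // eR.
have -> : ((complex.Re e)%:C%C)^-1 = ((complex.Re e)^-1)%:C%C.
  apply: (mulfI (_ : (complex.Re e)%:C%C != 0)); first by rewrite -eR gt_eqF.
  rewrite mulfV -?eR ?gt_eqF // {1}eR -rcM mulfV ?gt_eqF //.
have -> : (Num.truncn (complex.Re e)^-1).+1%:R = ((Num.truncn (complex.Re e)^-1).+1%:R : R)%:C%C :> R[i].
  elim: (_.+1) => [|n IH]; first by [].
  by rewrite -natr1 IH -natr1 rcD.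
by rewrite lecR ltW.
Qed.

Section ApproximateUnits.
Variables (R : realType) (T : tensor_products R).
Local Notation C := R[i].

(** Read off from the field [tens_faithful] of the tensor product of [A] with itself, which
    postulates such representations. *)
Lemma faithful_rep (A : cstarType R) :
  exists (H : hilbertType R) (p : A -> H -> H), is_faithful_rep p.
Proof. by have [H [K [p [q [fp _]]]]] := tens_faithful (T A A); exists H, p. Qed.

(** Expresses [|1 - e| <= 1] without a unit, on both sides. Unlike [|e| <= 1], this is stable under
    [1 - (1 - e)(1 - f)]; the price is that [e] is only bounded by [2]. *)
Definition near_unit (A : cstarType R) (e : A) :=
  forall y, `|y - y ** e| <= `|y| /\ `|y - e ** y| <= `|y|.

Section Algebra.
Variable A : cstarType R.
Implicit Types (a e x y : A).

Lemma near_unit_norm e : near_unit e -> `|e| <= 2.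
Proof.
move=> /(_ (star e))[h _].
have [->|e0] := eqVneq e 0; first by rewrite normr0.
have ne : 0 < `|e| by rewrite normr_gt0.
rewrite -(ler_pM2r ne) -expr2 -cstar_norm.
rewrite -[star e ** e](subKr (star e)) (le_trans (ler_normB _ _)) //.
by rewrite mulr_natl mulr2n lerD // -?(norm_star e).
Qed.

(** The element for which [1 - unit_iter k n] is the power [(1 - k)^n], written without a unit. *)
Fixpoint unit_iter (k : A) n :=
  if n is m.+1 then unit_iter k m + (k - k ** unit_iter k m) else 0.

Lemma unit_iter_memb k n : mone A - memb (unit_iter k n.+1) =
  (mone A - memb k) ** (mone A - memb (unit_iter k n)).
Proof.
rewrite /= (linD (@memb_linear _ _)) (linB (@memb_linear _ _)) membM.
rewrite amulBl !amulBr !mul1m mulm1 opprD !opprB.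
by rewrite addrA.
Qed.

Lemma unit_iter_comm k n : k ** unit_iter k n = unit_iter k n ** k.
Proof.
elim: n => [|n IH] /=; first by rewrite amul0l amul0r.
by rewrite amulDr amulDl amulBr amulBl IH amulA IH.
Qed.

Lemma memb_sub_mul y e : memb (y - y ** e) = memb y ** (mone A - memb e).
Proof. by rewrite (linB (@memb_linear _ _)) membM amulBr mulm1. Qed.

(** For [|x| <= 1] let [u n] be the [n]-th power of [1 - x^* x]. Each factor decreases [|u n xi|^2]
    by at least [|x u n xi|^2], and these amounts decrease in [n] because
    [x (1 - x^* x) = (1 - x x^* ) x]. Hence [n |x u n xi|^2 <= |xi|^2], so [x u n] tends to [0] in
    norm. *)
Lemma single_near_unit x (d : C) : 0 < d ->
  exists e, [/\ near_unit e, star e = e & `|x - x ** e| <= d].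
Proof.
move=> d0; wlog x1 : x d d0 / `|x| <= 1 => [wl|].
  have [->|x0] := eqVneq x 0.
    exists 0; split; rewrite ?star0 ?amul0r ?subr0 ?normr0 //; last exact: ltW.
    by move=> y; rewrite amul0r amul0l !subr0.
  have nx : 0 < `|x| by rewrite normr_gt0.
  have [||e [ue se xe]] := wl (`|x|^-1 *: x) (d / `|x|).
  - by rewrite divr_gt0.
  - by rewrite normfZV.
  exists e; split=> //; move: xe.
  rewrite amulZl -scalerBr normrZ ger0_norm ?invr_ge0 // mulrC ler_pM2r //.
  by rewrite invr_gt0.
have [H [p fp]] := faithful_rep A.
have [K [P [phi [rP phiT hphi PE]]]] := rep_multiplier fp.1.
have fP := rep_multiplier_faithful fp rP hphi PE.
have [_ Pl PM Ps] := rP.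
have P1 xi : P (mone A) xi = xi.
  move: xi; apply: (clspan_eq phiT (rep_lin rP _)) => //.
  - by case: rP => /(_ (mone A))[].
  - by exists 1 => z; rewrite mul1r.
  - by move=> _ [[b h] _ <-]; rewrite PE.
(* With [k = star z ** z] the left side is [|xi|^2 - 2 |z xi|^2 + |k xi|^2], and
   [|k xi| <= |z xi|]. *)
have dec (z : A) : `|z| <= 1 -> forall xi,
    `|P (mone A - memb (star z ** z)) xi| ^+ 2 <= `|xi| ^+ 2 - `|P (memb z) xi| ^+ 2.
  move=> z1 xi; rewrite -hip_norm (linB (Pl xi)) P1 hipBl !hipBr hip_norm.
  have sk : star (memb (star z ** z)) = memb (star z ** z).
    by rewrite -memb_star starM starK.
  have e1 : hip (P (memb (star z ** z)) xi) xi = `|P (memb z) xi| ^+ 2.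
    by rewrite membM memb_star PM Ps starK hip_norm.
  have e2 : hip xi (P (memb (star z ** z)) xi) = `|P (memb z) xi| ^+ 2.
    by rewrite -[in LHS]sk -Ps e1.
  rewrite e1 e2 hip_norm gerBl subr_ge0.
  rewrite lerXn2r ?nnegrE // membM PM (le_trans (rep_le rP _ _)) //.
  by rewrite ler_piMl // memb_norm norm_star.
pose u n : 'M(A) := mone A - memb (unit_iter (star x ** x) n).
have uS n xi : P (u n.+1) xi = P (mone A - memb (star x ** x)) (P (u n) xi).
  by rewrite /u unit_iter_memb PM.
have u0 xi : P (u 0%N) xi = xi.
  by rewrite /u /= (lin0 (@memb_linear _ _)) subr0 P1.
have main n xi : n%:R * `|P (memb x) (P (u n) xi)| ^+ 2 + `|P (u n) xi| ^+ 2 <= `|xi| ^+ 2.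
  elim: n => [|n IH]; first by rewrite mul0r add0r u0.
  rewrite (le_trans _ IH) // uS; set eta := P (u n) xi.
  have h1 : `|P (memb x) (P (mone A - memb (star x ** x)) eta)| <= `|P (memb x) eta|.
    rewrite -PM (_ : memb x ** _ = (mone A - memb (x ** star x)) ** memb x); last first.
      by rewrite amulBr amulBl mul1m mulm1 -!membM amulA.
    rewrite PM -(@ler_pXn2r _ 2) ?nnegrE //.
    have := dec (star x); rewrite norm_star starK => /(_ x1 (P (memb x) eta)) h.
    by rewrite (le_trans h) // lerBlDr lerDl exprn_ge0.
  have h2 := dec x x1 eta.
  rewrite (le_trans (lerD (ler_wpM2l _ (lerXn2r 2 _ _ h1)) h2)) ?nnegrE //.
  by rewrite -natr1 mulrDl mul1r -addrA [X in _ + X]addrCA subrr addr0.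
have un n : `|u n| <= 1.
  apply: (faithful_rep_isometric fP) => // xi; rewrite mul1r.
  rewrite -(@ler_pXn2r _ 2) ?nnegrE //; apply: le_trans (main n xi).
  by rewrite lerDr mulr_ge0 // exprn_ge0.
have [n hn] := complex_archi (exprn_gt0 2 d0).
have xun : `|memb x ** u n.+1| <= d.
  apply: (faithful_rep_isometric fP); first exact: ltW.
  move=> xi; rewrite PM -(@ler_pXn2r _ 2) ?nnegrE ?mulr_ge0 ?(ltW d0) // exprMn.
  have h : n.+1%:R * `|P (memb x) (P (u n.+1) xi)| ^+ 2 <= `|xi| ^+ 2.
    by apply: le_trans (main n.+1 xi); rewrite lerDl exprn_ge0.
  move: h; rewrite -ler_pdivlMl ?ltr0Sn // => /le_trans; apply.
  by rewrite ler_wpM2r ?exprn_ge0.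
have sk : star (star x ** x) = star x ** x by rewrite starM starK.
have su m : star (unit_iter (star x ** x) m) = unit_iter (star x ** x) m.
  elim: m => [|m IH] /=; first by rewrite star0.
  by rewrite starD starB [star (_ ** unit_iter _ _)]starM IH sk unit_iter_comm.
have yu y : `|y - y ** unit_iter (star x ** x) n.+1| <= `|y|.
  rewrite -memb_norm memb_sub_mul.
  rewrite (le_trans (norm_amul _ _)) // memb_norm ler_piMr //; exact: un.
exists (unit_iter (star x ** x) n.+1); split=> // [y|]; last first.
  rewrite -memb_norm memb_sub_mul; exact: xun.
split=> //; rewrite -norm_star starB starM su -[leRHS]norm_star; exact: yu.
Qed.

(** [1 - (e + f - e ** f)] is the product [(1 - e)(1 - f)], here applied from the right to [y]. *)
Lemma sub_mul_compr y e f :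
  y - y ** (e + f - e ** f) = (y - y ** e) - (y - y ** e) ** f.
Proof. by rewrite amulBr amulDr amulA amulBl -(addrA (y ** e)) opprD addrA. Qed.

Lemma sub_mul_compl y e f :
  y - (e + f - e ** f) ** y = (y - f ** y) - e ** (y - f ** y).
Proof.
by rewrite amulBl amulDl amulBr amulA (addrC (e ** y)) -(addrA (f ** y)) opprD addrA.
Qed.

Lemma near_unit_comp e f : near_unit e -> near_unit f -> near_unit (e + f - e ** f).
Proof.
move=> ue uf y; rewrite sub_mul_compr sub_mul_compl; split.
  by rewrite (le_trans (uf _).1) // (ue _).1.
by rewrite (le_trans (ue _).2) // (uf _).2.
Qed.

(** The new factor is chosen for the defect [x - x ** e] left over by the earlier ones; on the other
    elements it does no harm, since multiplication by [1 - f] does not increase norms. *)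
Lemma right_near_unit (s : seq A) (d : C) : 0 < d ->
  exists e, near_unit e /\ forall a, a \in s -> `|a - a ** e| <= d.
Proof.
move=> d0; elim: s => [|x s [e [ue he]]].
  exists 0; split=> // y; by rewrite amul0r amul0l !subr0.
have [f [uf _ hf]] := single_near_unit (x - x ** e) d0.
exists (e + f - e ** f); split=> [|a]; first exact: near_unit_comp.
rewrite inE sub_mul_compr => /predU1P[->//|/he h].
by rewrite (le_trans (uf _).1).
Qed.

Lemma near_unit_star e : near_unit e -> near_unit (star e).
Proof.
move=> ue y; split.
  by rewrite -norm_star starB starM starK -[leRHS]norm_star (ue _).2.
by rewrite -norm_star starB starM starK -[leRHS]norm_star (ue _).1.
Qed.

(** The approximate unit of [A] as a filter on [A]: near units that act almost as the identity on a
    finite list, from both sides. No net or increasing order is needed. *)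
Definition aunit : set_system A := [set S | exists (s : seq A) (d : C), 0 < d /\
  forall e, near_unit e ->
    (forall a, a \in s -> `|a - a ** e| <= d /\ `|a - e ** a| <= d) -> S e].

Lemma aunit_proper : ProperFilter aunit.
Proof.
split=> [[s [d [d0 h]]]|].
  have [r [ur hr]] := right_near_unit s d0.
  have [l [ul hl]] := right_near_unit [seq star a | a <- s] d0.
  have usl := near_unit_star ul.
  (* [r] is a right unit for [s] and [star l] a left unit, because [l] is a right unit for the
     adjoints. In [(1 - r)(1 - star l)] one factor is small on each side and the other does not
     increase norms. *)
  apply: (h (r + star l - r ** star l)); first exact: near_unit_comp.
  move=> a sa; rewrite sub_mul_compr sub_mul_compl; split.
    by rewrite (le_trans (usl _).1) // hr.
  rewrite (le_trans (ur _).2) // -norm_star starB starM starK.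
  by apply: hl; exact: map_f.
split=> [|P Q [s [d [d0 hP]]] [t [c [c0 hQ]]]|P Q PQ [s [d [d0 hP]]]].
- by exists [::], 1.
- exists (s ++ t), (d * c / (d + c)); split; first by rewrite divr_gt0 ?mulr_gt0 ?addr_gt0.
  have l1 : d * c / (d + c) <= d.
    rewrite ler_pdivrMr ?addr_gt0 // mulrDr lerDr mulr_ge0 //; exact: ltW.
  have l2 : d * c / (d + c) <= c.
    rewrite ler_pdivrMr ?addr_gt0 // mulrDr mulrC lerDl mulr_ge0 //; exact: ltW.
  move=> e ue h; split; [apply: hP => // a sa|apply: hQ => // a sa].
    by have [|h1 h2] := h a; [rewrite mem_cat sa|split; exact: le_trans l1].
  by have [|h1 h2] := h a; [rewrite mem_cat sa orbT|split; exact: le_trans l2].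
- by exists s, d; split=> // e ue he; apply: PQ; exact: hP.
Qed.

Lemma aunit_near : \forall e \near aunit, near_unit e.
Proof. by exists [::], 1. Qed.

Lemma aunit_cvgr a : (fun e => a ** e) @ aunit --> a.
Proof.
have FF := aunit_proper; apply/cvgrPdist_le => d d0; exists [:: a], d; split=> // e _.
by move=> /(_ a); rewrite inE eqxx => /(_ isT)[].
Qed.

Lemma aunit_cvgl a : (fun e => e ** a) @ aunit --> a.
Proof.
have FF := aunit_proper; apply/cvgrPdist_le => d d0; exists [:: a], d; split=> // e _.
by move=> /(_ a); rewrite inE eqxx => /(_ isT)[].
Qed.

End Algebra.

Section StarHom.
Variables (A B : cstarType R) (f : A -> B).
Hypothesis hf : is_star_hom f.

Lemma rep_star_hom (H : hilbertType R) (p : B -> H -> H) :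
  is_rep p -> is_rep (p \o f).
Proof.
case: hf => fl fM fs [pb pl pM ps]; split=> /=.
- by move=> a; exact: pb.
- by move=> h k a b; rewrite fl pl.
- by move=> a b h; rewrite fM pM.
- by move=> a h k; rewrite ps fs.
Qed.

Lemma star_hom_le a : `|f a| <= `|a|.
Proof.
have [H [p fp]] := faithful_rep B.
apply: (faithful_rep_isometric fp) => // h.
exact: (rep_le (rep_star_hom fp.1) a h).
Qed.

Lemma star_hom_bounded : bounded_op f.
Proof. by exists 1 => a; rewrite mul1r star_hom_le. Qed.

(** If [p] is faithful, so is [p \o f]; its operator norm computes [|a|] and is at most [|f a|]. *)
Lemma star_hom_isometric : injective f -> forall a, `|f a| = `|a|.
Proof.
move=> fi a; apply/eqP; rewrite eq_le star_hom_le /=.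
have [H [p fp]] := faithful_rep B.
have fl : linear f by case: hf.
have fr : is_faithful_rep (p \o f).
  split; first exact: rep_star_hom fp.1.
  move=> b /= h; apply: fi; rewrite (lin0 fl); exact: fp.2.
apply: (faithful_rep_isometric fr) => // h /=.
exact: rep_le fp.1 _ _.
Qed.
End StarHom.

End ApproximateUnits.

(** * Minimal tensor products *)

Section HilbertTensor.
Variables (R : realType) (T : tensor_products R).
Local Notation C := R[i].

Section Zero.
Variable A : cstarType R.

Fact zero_sub_subproof : is_cstar_sub [set 0 : A].
Proof.
split.
- by apply: closed_approx => v h; apply/eqP; rewrite -normr_le0;
    apply/ler_addgt0Pr => e /h[u ->]; rewrite subr0 add0r => /ltW.
- by split=> // k a b -> ->; rewrite scaler0 addr0.
- by move=> a b -> ->; rewrite amul0l.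
- by move=> a ->; rewrite star0.
Qed.

Definition zero_sub : cstar_sub A := CStarSub zero_sub_subproof.

Lemma zero_rep (H : hilbertType R) :
  @is_faithful_rep R (cstar_sub_type zero_sub) H (fun _ _ => 0).
Proof.
split=> [|[a a0] _]; last by apply: csub_val_inj; exact: a0.
split=> //.
- by move=> a; split; [move=> k x y; rewrite scaler0 addr0|exists 0 => x; rewrite normr0 mul0r].
- by move=> h k a b; rewrite scaler0 addr0.
- by move=> a h k; rewrite hip0l hip0r.
Qed.

(* [tens_op_le] for the empty sum and [M = 1] reads [0 <= tens_sq v]; the zero
   algebra has a faithful representation on every Hilbert space. *)
Lemma tens_sq_ge0 (H K : hilbertType R) (v : seq (H * K)) : 0 <= tens_sq v.
Proof.
have := tens_norm (T (cstar_sub_type zero_sub) (cstar_sub_type zero_sub))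
  (zero_rep H) (zero_rep K) [::] (@ler01 C).
rewrite big_nil normr0 ler01 => -[/(_ isT) /(_ v) h _]; move: h.
by rewrite /= {1}/tens_sq big_nil expr1n mul1r.
Qed.
End Zero.

Section Tensor.
Variables (A0 : cstarType R) (H K : hilbertType R).

Definition is_hilbert_tensor (L : hilbertType R) (phi : H -> K -> L) :=
  (forall h h' k k', hip (phi h k) (phi h' k') = hip h h' * hip k k') /\
  clspan (range (fun x : H * K => phi x.1 x.2)) = setT.

(** Positivity of the product kernel is the Schur product theorem; after moving the coefficients
    into the first factors it is exactly [tens_sq_ge0]. *)
Lemma hilbert_tensor : exists (L : hilbertType R) (phi : H -> K -> L),
  is_hilbert_tensor phi.
Proof.
have [||L [phi [hphi phiT]]] := @kolmogorov R (H * K)%type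
  (fun x y => hip x.1 y.1 * hip x.2 y.2).
- by move=> x y; rewrite rmorphM /= -!hip_herm.
- move=> v; have := tens_sq_ge0 A0 [seq (p.1 *: p.2.1, p.2.2) | p <- v].
  rewrite /tens_sq big_map; congr (0 <= _); apply: eq_bigr => p _.
  rewrite big_map; apply: eq_bigr => q _ /=.
  by rewrite hipZl hipZr; ring.
exists L, (fun h k => phi (h, k)); split=> [h h' k k'|]; first by rewrite hphi.
by rewrite (_ : (fun x => _) = phi) //; apply/funext => -[].
Qed.

Variables (L : hilbertType R) (phi : H -> K -> L).
Hypothesis hphi : is_hilbert_tensor phi.

Lemma htensor_linl k : linear (phi^~ k).
Proof.
move=> c h h'; apply: (hip_ext hphi.2) => -[x y] /=.
by rewrite hip_linear !hphi.1 hip_linear mulrDl mulrA.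
Qed.

Lemma htensor_linr h : linear (phi h).
Proof.
move=> c k k'; apply: (hip_ext hphi.2) => -[x y] /=.
by rewrite hip_linear !hphi.1 hip_linear mulrDr mulrCA.
Qed.

Lemma htensor_norm h k : `|phi h k| = `|h| * `|k|.
Proof.
apply/eqP; rewrite -(@eqrXn2 _ 2) ?mulr_ge0 //.
by rewrite exprMn -!hip_norm hphi.1.
Qed.

Lemma tens_sqE v : tens_sq v = `|\sum_(x <- v) phi x.1 x.2| ^+ 2.
Proof.
rewrite -hip_norm hip_suml; apply: eq_bigr => x _; rewrite hip_sumr.
by apply: eq_bigr => y _; rewrite hphi.1.
Qed.

Lemma htensor_scale (s : seq (C * (H * K))) :
  \sum_(p <- s) p.1 *: phi p.2.1 p.2.2 =
  \sum_(x <- [seq (p.1 *: p.2.1, p.2.2) | p <- s]) phi x.1 x.2.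
Proof.
by rewrite big_map; apply: eq_bigr => p _ /=; rewrite (linZ (@htensor_linl _)).
Qed.

(** Identifies the formal inequality of [tens_op_le] with an operator norm on a completed Hilbert
    space tensor product, where bounded linear maps can be handled. *)
Lemma tens_op_leP (X : Type) (p : X -> H -> H) (q : X -> K -> K) (w : X -> L -> L)
    (s : seq X) (M : C) : 0 <= M ->
  (forall x, linear (w x)) -> (forall x, bounded_op (w x)) ->
  (forall x h k, w x (phi h k) = phi (p x h) (q x k)) ->
  (forall v : seq (H * K),
    tens_sq [seq (p x h.1, q x h.2) | x <- s, h <- v] <= M ^+ 2 * tens_sq v) <->
  (forall xi, `|\sum_(x <- s) w x xi| <= M * `|xi|).
Proof.
move=> M0 wl wb wE.
have E (v : seq (H * K)) : \sum_(y <- [seq (p x h.1, q x h.2) | x <- s, h <- v]) phi y.1 y.2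
    = \sum_(x <- s) w x (\sum_(y <- v) phi y.1 y.2).
  rewrite big_allpairs_dep; apply: eq_bigr => x _ /=.
  by rewrite (lin_sum (wl x)); apply: eq_bigr => y _; rewrite wE.
split=> h; last first.
  by move=> v; rewrite !tens_sqE -exprMn lerXn2r ?nnegrE ?mulr_ge0 // E.
apply: (bounded_total hphi.2) => //.
- move=> k x y; rewrite scaler_sumr -big_split; apply: eq_bigr => i _; exact: wl.
- elim: s {h E} => [|x s [m hm]].
    by exists 0 => xi; rewrite big_nil normr0 mul0r.
  have [n hn] := wb x; exists (n + m) => xi.
  by rewrite big_cons (le_trans (ler_normD _ _)) // mulrDl lerD.
- move=> t; rewrite htensor_scale -E.
  rewrite -(@ler_pXn2r _ 2) ?nnegrE ?mulr_ge0 // exprMn -!tens_sqE; exact: h.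
Qed.

Section Reps.
Variables (A B : cstarType R) (p : A -> H -> H) (q : B -> K -> K).
Hypotheses (rp : is_rep p) (rq : is_rep q).

Lemma tensor_rep_l : exists P : A -> L -> L, is_rep P /\
  forall a h k, P a (phi h k) = phi (p a h) k.
Proof.
case: rp => pb pl pM ps.
have [|||P [rP PE]] := @total_rep R A L (H * K)%type (fun x => phi x.1 x.2)
  (fun a x => (p a x.1, x.2)) hphi.2.
- by move=> k a b i /=; rewrite -(htensor_linl); congr (phi _ _); exact: pl.
- by move=> a b i /=; rewrite pM.
- by move=> a i j /=; rewrite !hphi.1 ps.
- by exists P; split=> // a h k; exact: (PE a (h, k)).
Qed.

Lemma tensor_rep_r : exists Q : B -> L -> L, is_rep Q /\
  forall b h k, Q b (phi h k) = phi h (q b k).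
Proof.
case: rq => pb pl pM ps.
have [|||P [rP PE]] := @total_rep R B L (H * K)%type (fun x => phi x.1 x.2)
  (fun a x => (x.1, q a x.2)) hphi.2.
- by move=> k a b i /=; rewrite -(htensor_linr); congr (phi _ _); exact: pl.
- by move=> a b i /=; rewrite pM.
- by move=> a i j /=; rewrite !hphi.1 ps.
- by exists P; split=> // a h k; exact: (PE a (h, k)).
Qed.

End Reps.
End Tensor.

(** [D] is the direct sum of [H] with the space of a faithful representation, and [j] the inclusion
    of [H]. Since [tens_norm] speaks of faithful representations only, this is how its upper bound
    reaches all representations. *)
Lemma faithful_rep_extends (A : cstarType R) (H : hilbertType R) (p : A -> H -> H) :
  is_rep p -> exists (D : hilbertType R) (r : A -> D -> D) (j : H -> D),
  [/\ is_faithful_rep r, forall h h', hip (j h) (j h') = hip h h'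
    & forall a h, r a (j h) = j (p a h)].
Proof.
move=> rp; have [H0 [p0 fp0]] := faithful_rep T A; have rp0 := fp0.1.
have [||D [psi [hpsi psiT]]] := @kolmogorov R (H * H0)%type
  (fun x y => hip x.1 y.1 + hip x.2 y.2).
- by move=> x y; rewrite rmorphD /= -!hip_herm.
- move=> v; have h1 := @sum_herm_pos R H _ (fun x : H * H0 => x.1) v.
  have h2 := @sum_herm_pos R H0 _ (fun x : H * H0 => x.2) v.
  apply: le_trans (addr_ge0 h1 h2) _; rewrite -big_split ler_sum // => x _ /=.
  by rewrite -big_split ler_sum // => y _ /=; rewrite mulrDr.
case: (rp) => pb pl pM ps; case: (rp0) => pb0 pl0 pM0 ps0.
have [|||r [rr rE]] := @total_rep R A D _ psi (fun a x => (p a x.1, p0 a x.2)) psiT.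
- move=> k a b i; apply: (hip_ext psiT) => j; rewrite hip_linear !hpsi /=.
  by rewrite mulrDr addrACA -!hip_linear pl pl0.
- by move=> a b i; rewrite /= pM pM0.
- by move=> a i j; rewrite !hpsi /= ps ps0.
exists D, r, (fun h => psi (h, 0)); split.
- split=> // a h; apply: fp0.2 => h0.
  have := hpsi (p a 0, p0 a h0) (p a 0, p0 a h0).
  rewrite -(rE a (0, h0)) h hip0l /= (lin0 (rep_lin rp a)) hip0l add0r hip_norm.
  by move=> /esym/eqP; rewrite sqrf_eq0 normr_eq0 => /eqP.
- by move=> h h'; rewrite hpsi /= hip0l addr0.
- by move=> a h; rewrite rE /= (lin0 (rep_lin rp0 a)).
Qed.

End HilbertTensor.

(** * The spatial norm and bounded maps on tensor products *)

Section TensorNorm.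
Variables (R : realType) (T : tensor_products R).
Local Notation C := R[i].
Local Notation "A ⊗ B" := (ctens T A B) (at level 40, left associativity).
Local Notation "a ⊠ b" := (etens T a b) (at level 40, left associativity).

Section Two.
Variables (A B : cstarType R).
Implicit Types (a : A) (b : B).

Lemma etens_linl b : linear (fun a => a ⊠ b : A ⊗ B).
Proof. exact: (tens_linearl (T A B) b). Qed.

Lemma etens_linr a : linear (fun b => a ⊠ b : A ⊗ B).
Proof. exact: (tens_linearr (T A B) a). Qed.

Lemma etensM a a' b b' : (a ⊠ b) ** (a' ⊠ b') = (a ** a') ⊠ (b ** b').
Proof. exact: tensM. Qed.

Lemma etens_star a b : star (a ⊠ b) = star a ⊠ star b.
Proof. exact: tens_star. Qed.

Lemma etens_total : clspan (range (fun x : A * B => x.1 ⊠ x.2)) = setT.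
Proof.
rewrite -(tens_dense (T A B)); congr clspan; apply/seteqP; split=> y /=.
  by move=> [[a b] _ <-]; exists a, b.
by move=> [a [b ->]]; exists (a, b).
Qed.

Lemma etens_scale (s : seq (C * (A * B))) :
  \sum_(p <- s) p.1 *: (p.2.1 ⊠ p.2.2) =
  \sum_(x <- [seq (p.1 *: p.2.1, p.2.2) | p <- s]) x.1 ⊠ x.2.
Proof.
by rewrite big_map; apply: eq_bigr => p _ /=; rewrite (linZ (@etens_linl _)).
Qed.

Lemma tens_op_le_rep (H K : hilbertType R) (p : A -> H -> H) (q : B -> K -> K)
    (s : seq (A * B)) (M : C) : is_rep p -> is_rep q -> 0 <= M ->
  `|\sum_(x <- s) x.1 ⊠ x.2| <= M -> tens_op_le p q s M.
Proof.
move=> rp rq M0 sM v.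
have [D [r [j [fr hj rj]]]] := faithful_rep_extends T rp.
have [D' [r' [j' [fr' hj' rj']]]] := faithful_rep_extends T rq.
have /(_ [seq (j x.1, j' x.2) | x <- v]) := (tens_norm (T A B) fr fr' s M0).1 sM.
have sq (u : seq (H * K)) : tens_sq [seq (j x.1, j' x.2) | x <- u] = tens_sq u.
  rewrite /tens_sq big_map; apply: eq_bigr => x _; rewrite big_map.
  by apply: eq_bigr => y _; rewrite hj hj'.
rewrite sq; congr (_ <= _); rewrite -sq; congr tens_sq.
elim: s {sM} => [|x s IH] //=; rewrite map_cat -IH; congr (_ ++ _).
by rewrite -!map_comp; apply: eq_map => y /=; rewrite rj rj'.
Qed.

Section Op.
Variables (H K L : hilbertType R) (phi : H -> K -> L).
Hypothesis hphi : is_hilbert_tensor phi.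
Variables (p : A -> H -> H) (q : B -> K -> K) (w : A * B -> L -> L).
Hypotheses (wl : forall x, linear (w x)) (wb : forall x, bounded_op (w x)).
Hypothesis wE : forall x h k, w x (phi h k) = phi (p x.1 h) (q x.2 k).

Lemma norm_tens_op s xi : is_rep p -> is_rep q ->
  `|\sum_(x <- s) w x xi| <= `|\sum_(x <- s) x.1 ⊠ x.2| * `|xi|.
Proof.
move=> rp rq; move: xi.
apply/(tens_op_leP hphi s (normr_ge0 _) wl wb wE).
exact: tens_op_le_rep.
Qed.

Lemma norm_tens_le s M : is_faithful_rep p -> is_faithful_rep q -> 0 <= M ->
  (forall xi, `|\sum_(x <- s) w x xi| <= M * `|xi|) ->
  `|\sum_(x <- s) x.1 ⊠ x.2| <= M.
Proof.
move=> fp fq M0 h; apply/(tens_norm (T A B) fp fq s M0).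
exact/(tens_op_leP hphi s M0 wl wb wE).
Qed.
End Op.

End Two.
End TensorNorm.

Section BoundedLinear.
Variables (K : numFieldType).

Definition blin (V W : normedModType K) (f : V -> W) := linear f /\ bounded_op f.

Lemma blin_comp (U V W : normedModType K) (f : V -> W) (g : U -> V) :
  blin f -> blin g -> blin (f \o g).
Proof.
move=> [lf /bounded_opP[m m0 fm]] [lg [n gn]]; split; first exact: lin_comp.
by exists (m * n) => x; rewrite (le_trans (fm _)) // -mulrA ler_wpM2l.
Qed.

Lemma blin0 (V W : normedModType K) : @blin V W (fun=> 0).
Proof.
split; first by move=> k x y; rewrite scaler0 addr0.
by exists 0 => x; rewrite normr0 mul0r.
Qed.

Lemma blinD (V W : normedModType K) (f g : V -> W) :
  blin f -> blin g -> blin (fun x => f x + g x).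
Proof.
move=> [lf [m fm]] [lg [n gn]]; split.
  by move=> k x y; rewrite lf lg scalerDr addrACA.
by exists (m + n) => x; rewrite (le_trans (ler_normD _ _)) // mulrDl lerD.
Qed.

Lemma blinZ (V W : normedModType K) (k : K) (f : V -> W) :
  blin f -> blin (fun x => k *: f x).
Proof.
move=> [lf [m fm]]; split.
  by move=> c x y; rewrite lf scalerDr !scalerA mulrC.
by exists (`|k| * m) => x; rewrite normrZ -mulrA ler_wpM2l.
Qed.

Lemma blin_sum (V W : normedModType K) (I : Type) (s : seq I) (f : I -> V -> W) :
  (forall i, blin (f i)) -> blin (fun x => \sum_(i <- s) f i x).
Proof.
move=> bf; elim: s => [|i s IH].
  rewrite (_ : (fun _ => _) = fun=> 0); first exact: blin0.
  by apply/funext => x; rewrite big_nil.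
rewrite (_ : (fun _ => _) = fun x => f i x + \sum_(j <- s) f j x); first exact: blinD.
by apply/funext => x; rewrite big_cons.
Qed.

Lemma blin_eq (V W : normedModType K) (X : set V) (f g : V -> W) :
  clspan X = setT -> blin f -> blin g -> (forall x, X x -> f x = g x) -> f =1 g.
Proof. by move=> XT [lf bf] [lg bg]; exact: clspan_eq. Qed.

Lemma blin_cvg (V W : normedModType K) (f : V -> W) (U : Type) (F : set_system U)
    (u : U -> V) (v : V) : Filter F -> blin f -> u @ F --> v -> (f \o u) @ F --> f v.
Proof.
move=> FF [lf bf] uv; apply: (@cvg_comp _ _ _ u f _ _ _ uv).
exact: blin_continuous.
Qed.

Lemma total_bilinear (U V W : normedModType K) (I J : Type) (e : I -> U) (f : J -> V)
    (b : U -> V -> W) : clspan (range e) = setT -> clspan (range f) = setT ->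
  (forall v, blin (b^~ v)) -> (forall u, blin (b u)) ->
  clspan (range (fun x : U * V => b x.1 x.2)) = setT ->
  clspan (range (fun x : I * J => b (e x.1) (f x.2))) = setT.
Proof.
move=> eT fT bl br bT; set X := clspan (range _).
have closed_pre (Y Z : normedModType K) (h : Y -> Z) (S : set Z) :
    blin h -> closed S -> closed (h @^-1` S).
  by move=> [lh bh] cS; apply: preimage_closed => // y _; exact: blin_continuous.
have s1 i v : X (b (e i) v).
  have : clspan (range f) v by rewrite fT.
  move: v; apply: clspan_ind.
  - exact: (closed_pre V W (b (e i)) X (br _) (@closed_clspan _ _ _)).
  - by rewrite (lin0 (br _).1); exact: clspan0.
  - by move=> k u v hu hv; rewrite (br _).1; exact: clspanP.
  - by move=> _ [j _ <-]; apply: sub_clspan; exists (i, j).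
have s2 u v : X (b u v).
  have : clspan (range e) u by rewrite eT.
  move: u; apply: clspan_ind.
  - exact: (closed_pre U W (b^~ v) X (bl _) (@closed_clspan _ _ _)).
  - by rewrite (lin0 (bl _).1); exact: clspan0.
  - by move=> k u w hu hw; rewrite (bl v).1; exact: clspanP.
  - by move=> _ [i _ <-].
apply/seteqP; split=> // w _; have : clspan (range (fun x : U * V => b x.1 x.2)) w by rewrite bT.
move: w; apply: clspan_ind; first exact: closed_clspan.
- exact: clspan0.
- exact: clspanP.
- by move=> _ [[u v] _ <-].
Qed.

End BoundedLinear.

Section CStarBlin.
Variables (R : realType) (A : cstarType R).
Lemma blin_mull (a : A) : blin (fun x => a ** x).
Proof.
split; first by move=> k x y; rewrite amulDr amulZr.
by exists `|a| => x; exact: norm_amul.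
Qed.
Lemma blin_mulr (a : A) : blin (fun x => x ** a).
Proof.
split; first by move=> k x y; rewrite amulDl amulZl.
by exists `|a| => x; rewrite mulrC norm_amul.
Qed.
Lemma blin_lmul (m : 'M(A)) : blin (lmul m).
Proof. by split; [exact: lmul_linear|exact: lmul_bounded]. Qed.
Lemma blin_rmul (m : 'M(A)) : blin (rmul m).
Proof. by split; [exact: rmul_linear|exact: rmul_bounded]. Qed.
Lemma blin_memb : blin (@memb R A).
Proof. by split; [exact: memb_linear|exists 1 => a; rewrite memb_norm mul1r]. Qed.
Lemma blin_lmul_at (a : A) : blin (fun m : 'M(A) => lmul m a).
Proof. by split=> //; exists `|a| => m; rewrite mulrC; exact: le_mnorm. Qed.
Lemma blin_star_star (B : cstarType R) (f : A -> B) : blin f -> blin (fun x => star (f (star x))).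
Proof.
move=> [lf [m fm]]; split; last by exists m => x; rewrite norm_star -(norm_star x).
by move=> k x y; rewrite starD starZ lf starD starZ conjCK.
Qed.
Lemma star_lmul (m : 'M(A)) a : star (lmul m a) = rmul (star m) (star a).
Proof. by rewrite /= starK. Qed.
Lemma star_rmul (m : 'M(A)) a : star (rmul m a) = lmul (star m) (star a).
Proof. by rewrite /= starK. Qed.
Lemma star_lmul_mul (m : 'M(A)) a b : star (lmul m a) ** b = star a ** lmul (star m) b.
Proof. by rewrite star_lmul lrmul. Qed.
End CStarBlin.

Section Tens.
Variables (R : realType) (T : tensor_products R).
Local Notation C := R[i].
Local Notation "A ⊗ B" := (ctens T A B) (at level 40, left associativity).
Local Notation "a ⊠ b" := (etens T a b) (at level 40, left associativity).

Lemma blin_star_hom (A B : cstarType R) (f : A -> B) : is_star_hom f -> blin f.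
Proof. by move=> hf; split; [case: hf|exact: (star_hom_bounded T hf)]. Qed.

Section Two.
Variables (A B : cstarType R).
Implicit Types (a : A) (b : B).

Lemma tens_ext (W : normedModType C) (F G : A ⊗ B -> W) : blin F -> blin G ->
  (forall a b, F (a ⊠ b) = G (a ⊠ b)) -> F =1 G.
Proof.
move=> [lF bF] [lG bG] FG; apply: (clspan_eq (etens_total T A B)) => //.
by move=> _ [[a b] _ <-].
Qed.

Lemma spatial_rep (H K : hilbertType R) (p : A -> H -> H) (q : B -> K -> K) :
  is_rep p -> is_rep q ->
  exists (L : hilbertType R) (phi : H -> K -> L) (P : A -> L -> L) (Q : B -> L -> L),
  [/\ is_hilbert_tensor phi, is_rep P /\ (forall a h k, P a (phi h k) = phi (p a h) k),
     is_rep Q /\ (forall b h k, Q b (phi h k) = phi h (q b k)),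
     (forall a b xi, P a (Q b xi) = Q b (P a xi))
   & (forall s xi, `|\sum_(x <- s) P x.1 (Q x.2 xi)| <= `|\sum_(x <- s) x.1 ⊠ x.2| * `|xi|) /\
     (is_faithful_rep p -> is_faithful_rep q -> forall s M, 0 <= M ->
       (forall xi, `|\sum_(x <- s) P x.1 (Q x.2 xi)| <= M * `|xi|) ->
       `|\sum_(x <- s) x.1 ⊠ x.2| <= M)].
Proof.
move=> rp rq; have [L [phi hphi]] := hilbert_tensor T A H K.
have [P [rP PE]] := tensor_rep_l hphi rp; have [Q [rQ QE]] := tensor_rep_r hphi rq.
have bP a : blin (P a) by split; [exact: rep_lin|exists `|a|; exact: rep_le].
have bQ b : blin (Q b) by split; [exact: rep_lin|exists `|b|; exact: rep_le].
have bw (x : A * B) : blin (fun xi => P x.1 (Q x.2 xi)) := blin_comp (bP _) (bQ _).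
have wE (x : A * B) h k : P x.1 (Q x.2 (phi h k)) = phi (p x.1 h) (q x.2 k).
  by rewrite QE PE.
exists L, phi, P, Q; split=> //.
- move=> a b; apply: (blin_eq hphi.2 (blin_comp (bP a) (bQ b)) (blin_comp (bQ b) (bP a))).
  by move=> _ [[h k] _ <-] /=; rewrite PE !QE PE.
- split=> [s xi|fp fq s M M0 h].
    apply: (@norm_tens_op R T A B H K L phi hphi p q (fun x xi => P x.1 (Q x.2 xi))) => //.
    + by move=> x; case: (bw x).
    + by move=> x; case: (bw x).
  apply: (@norm_tens_le R T A B H K L phi hphi p q (fun x xi => P x.1 (Q x.2 xi))) => //.
  + by move=> x; case: (bw x).
  + by move=> x; case: (bw x).
Qed.

Lemma norm_etens_le a b : `|a ⊠ b| <= `|a| * `|b|.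
Proof.
have [H [p fp]] := faithful_rep T A; have [K [q fq]] := faithful_rep T B.
have [L [phi [P [Q [hphi [rP PE] [rQ QE] PQ [_ h]]]]]] := spatial_rep fp.1 fq.1.
have := h fp fq [:: (a, b)] (`|a| * `|b|); rewrite big_seq1 /=; apply.
  by rewrite mulr_ge0.
move=> xi; rewrite big_seq1 /= (le_trans (rep_le rP _ _)) // -mulrA ler_wpM2l //.
exact: rep_le.
Qed.

Lemma blin_etensl b : blin (fun a => a ⊠ b : A ⊗ B).
Proof.
split; first exact: etens_linl.
by exists `|b| => a; rewrite mulrC norm_etens_le.
Qed.

Lemma blin_etensr a : blin (fun b => a ⊠ b : A ⊗ B).
Proof. by split; [exact: etens_linr|exists `|a| => b; exact: norm_etens_le]. Qed.

(** For fixed [xi], the map sending [m] to the sum with first factors [lmul m x.1] satisfies the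
    hypotheses of [star_action_le] with base vector [\sum_x P x.1 (Q x.2 xi)]. This bounds left
    multiplication by [m] with no action of [m] on [L]. *)
Lemma etens_lmul_le (m : 'M(A)) (s : seq (A * B)) :
  `|\sum_(x <- s) lmul m x.1 ⊠ x.2| <= `|m| * `|\sum_(x <- s) x.1 ⊠ x.2|.
Proof.
have [H [p fp]] := faithful_rep T A; have [K [q fq]] := faithful_rep T B.
have [L [phi [P [Q [hphi [rP PE] [rQ QE] PQ [h1 h2]]]]]] := spatial_rep fp.1 fq.1.
have := h2 fp fq [seq (lmul m x.1, x.2) | x <- s]; rewrite big_map /=; apply.
  by rewrite mulr_ge0.
move=> xi; rewrite big_map /= -mulrA.
rewrite (le_trans _ (ler_wpM2l (normr_ge0 m) (h1 s xi))) //.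
move: m; case: (rP) => _ Pl PM Ps.
apply: (@star_action_le R _ L _ (fun m : 'M(A) => \sum_(x <- s) P (lmul m x.1) (Q x.2 xi))).
- move=> k m n; rewrite scaler_sumr -big_split; apply: eq_bigr => x _ /=; exact: Pl.
- move=> m n; rewrite !hip_suml; apply: eq_bigr => x _; rewrite !hip_sumr.
  by apply: eq_bigr => y _; rewrite !Ps -!PM star_lmul_mul.
- move=> m; rewrite !hip_suml; apply: eq_bigr => x _; rewrite !hip_sumr.
  by apply: eq_bigr => y _; rewrite !Ps -!PM star_lmul_mul.
Qed.

Lemma etens_rmul_le (m : 'M(B)) (s : seq (A * B)) :
  `|\sum_(x <- s) x.1 ⊠ lmul m x.2| <= `|m| * `|\sum_(x <- s) x.1 ⊠ x.2|.
Proof.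
have [H [p fp]] := faithful_rep T A; have [K [q fq]] := faithful_rep T B.
have [L [phi [P [Q [hphi [rP PE] [rQ QE] PQ [h1 h2]]]]]] := spatial_rep fp.1 fq.1.
have := h2 fp fq [seq (x.1, lmul m x.2) | x <- s]; rewrite big_map /=; apply.
  by rewrite mulr_ge0.
move=> xi; rewrite big_map /= -mulrA.
rewrite (le_trans _ (ler_wpM2l (normr_ge0 m) (h1 s xi))) //.
under eq_bigr do rewrite PQ.
under [X in _ <= _ * `|X|]eq_bigr do rewrite PQ.
move: m; case: (rQ) => _ Pl PM Ps.
apply: (@star_action_le R _ L _ (fun m : 'M(B) => \sum_(x <- s) Q (lmul m x.2) (P x.1 xi))).
- move=> k m n; rewrite scaler_sumr -big_split; apply: eq_bigr => x _ /=; exact: Pl.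
- move=> m n; rewrite !hip_suml; apply: eq_bigr => x _; rewrite !hip_sumr.
  by apply: eq_bigr => y _; rewrite !Ps -!PM star_lmul_mul.
- move=> m; rewrite !hip_suml; apply: eq_bigr => x _; rewrite !hip_sumr.
  by apply: eq_bigr => y _; rewrite !Ps -!PM star_lmul_mul.
Qed.

Lemma tens_extension (W : completeNormedModType C) (g : A -> B -> W) (M : C) :
  (forall b, linear (g^~ b)) ->
  (forall s : seq (A * B), `|\sum_(x <- s) g x.1 x.2| <= M * `|\sum_(x <- s) x.1 ⊠ x.2|) ->
  exists F : A ⊗ B -> W, blin F /\ forall a b, F (a ⊠ b) = g a b.
Proof.
move=> gl gM.
have [s|F [lF bF FE]] := @bounded_linear_extension C (A ⊗ B) W (A * B)%type
  (fun x => x.1 ⊠ x.2) (fun x => g x.1 x.2) M (etens_total T A B).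
  rewrite etens_scale (le_trans _ (gM _)) // big_map /=.
  by under [X in _ <= `|X|]eq_bigr do rewrite (linZ (gl _)).
exists F; split; first by split=> //; exists M.
by move=> a b; exact: (FE (a, b)).
Qed.

Lemma mtens_exists (x : 'M(A)) (y : 'M(B)) : exists z : 'M(A ⊗ B), forall a b,
  lmul z (a ⊠ b) = lmul x a ⊠ lmul y b /\ rmul z (a ⊠ b) = rmul x a ⊠ rmul y b.
Proof.
have exl (m : 'M(A)) (n : 'M(B)) : exists F : A ⊗ B -> A ⊗ B,
    blin F /\ forall a b, F (a ⊠ b) = lmul m a ⊠ lmul n b.
  apply: (tens_extension (g := fun a b => lmul m a ⊠ lmul n b) (M := `|m| * `|n|)).
    by move=> b k a a'; rewrite linearP etens_linl.
  move=> s; have := etens_lmul_le m [seq (x.1, lmul n x.2) | x <- s].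
  rewrite !big_map /= => /le_trans; apply; rewrite -mulrA ler_wpM2l //.
  exact: etens_rmul_le.
have [l [bl lE]] := exl x y; have [r [br rE]] := exl (star x) (star y).
pose r' z := star (r (star z)).
have br' : blin r' := blin_star_star br.
have r'E a b : r' (a ⊠ b) = rmul x a ⊠ rmul y b.
  by rewrite /r' etens_star rE etens_star -!star_rmul !starK.
suff h : is_multiplier l r'.
  by exists (Multiplier h) => a b /=; rewrite lE r'E.
split.
- by split; [case: bl|case: br'].
- by split; [case: bl|case: br'].
- move=> u v; move: u; apply: tens_ext; first exact: blin_comp bl (blin_mulr v).
    exact: blin_comp (blin_mulr v) bl.
  move=> a b; move: v; apply: tens_ext; first exact: blin_comp bl (blin_mull _).
    exact: blin_mull.
  by move=> a' b'; rewrite etensM !lE etensM !lmulM.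
- move=> u v; move: u; apply: tens_ext; first exact: blin_comp br' (blin_mulr v).
    exact: blin_mulr.
  move=> a b; move: v; apply: tens_ext; first exact: blin_comp br' (blin_mull _).
    exact: blin_comp (blin_mull _) br'.
  by move=> a' b'; rewrite etensM !r'E etensM !rmulM.
- move=> u v; move: u; apply: tens_ext; first exact: blin_mulr.
    exact: blin_comp (blin_mulr v) br'.
  move=> a b; move: v; apply: tens_ext; first exact: blin_comp (blin_mull _) bl.
    exact: blin_mull.
  by move=> a' b'; rewrite r'E lE !etensM !lrmul.
Qed.

Lemma mtensP (x : 'M(A)) (y : 'M(B)) a b :
  lmul (mtens T x y) (a ⊠ b) = lmul x a ⊠ lmul y b /\
  rmul (mtens T x y) (a ⊠ b) = rmul x a ⊠ rmul y b.
Proof.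
have [z hz] := mtens_exists x y.
have := @xgetPex _ (0 : 'M(A ⊗ B)) [set z | forall a b,
    lmul z (a ⊠ b) = lmul x a ⊠ lmul y b /\
    rmul z (a ⊠ b) = rmul x a ⊠ rmul y b].
by apply; exists z.
Qed.

Lemma mtensl (x : 'M(A)) (y : 'M(B)) a b :
  lmul (mtens T x y) (a ⊠ b) = lmul x a ⊠ lmul y b.
Proof. by case: (mtensP x y a b). Qed.

Lemma mtensr (x : 'M(A)) (y : 'M(B)) a b :
  rmul (mtens T x y) (a ⊠ b) = rmul x a ⊠ rmul y b.
Proof. by case: (mtensP x y a b). Qed.

Lemma tens_mult_ext (z z' : 'M(A ⊗ B)) :
  (forall a b, lmul z (a ⊠ b) = lmul z' (a ⊠ b)) -> z = z'.
Proof.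
by move=> h; apply: multiplier_lext; apply: tens_ext => //; exact: blin_lmul.
Qed.

Lemma mtensM (x x' : 'M(A)) (y y' : 'M(B)) :
  mtens T x y ** mtens T x' y' = mtens T (x ** x') (y ** y').
Proof.
apply: tens_mult_ext => a b.
by rewrite -[lmul (_ ** _) _]/(lmul _ (lmul _ _)) !mtensl.
Qed.

Lemma mtens_star (x : 'M(A)) (y : 'M(B)) :
  star (mtens T x y) = mtens T (star x) (star y).
Proof.
apply: tens_mult_ext => a b.
by rewrite -[a ⊠ b]starK -star_rmul etens_star mtensr etens_star !star_rmul !starK
  -etens_star starK mtensl.
Qed.

Lemma mtens_memb a b : mtens T (memb a) (memb b) = memb (a ⊠ b).
Proof. by apply: tens_mult_ext => a' b'; rewrite mtensl /= etensM. Qed.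

Lemma mtens_linl (y : 'M(B)) : linear (fun x : 'M(A) => mtens T x y).
Proof.
move=> k x x'; apply: tens_mult_ext => a b.
by rewrite mtensl /= !mtensl etens_linl.
Qed.

Lemma mtens_linr (x : 'M(A)) : linear (fun y : 'M(B) => mtens T x y).
Proof.
move=> k y y'; apply: tens_mult_ext => a b.
by rewrite mtensl /= !mtensl etens_linr.
Qed.

Lemma mtens_norm (x : 'M(A)) (y : 'M(B)) : `|mtens T x y| <= `|x| * `|y|.
Proof.
apply/mnormP => [|]; first by rewrite mulr_ge0.
apply: (bounded_total (etens_total T A B)).
- by case: (blin_lmul (mtens T x y)).
- by case: (blin_lmul (mtens T x y)).
- by rewrite mulr_ge0.
move=> s; rewrite etens_scale (lin_sum (lmul_linear _)).
under eq_bigr do rewrite mtensl.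
have := etens_lmul_le x [seq (z.1, lmul y z.2) | z <- [seq (p.1 *: p.2.1, p.2.2) | p <- s]].
rewrite !big_map /= => /le_trans; apply; rewrite -mulrA ler_wpM2l //.
by have := etens_rmul_le y [seq (p.1 *: p.2.1, p.2.2) | p <- s]; rewrite !big_map.
Qed.

Lemma blin_mtensr (x : 'M(A)) : blin (fun y : 'M(B) => mtens T x y).
Proof. by split; [exact: mtens_linr|exists `|x| => y; exact: mtens_norm]. Qed.

Lemma dual_bounded (w : dual B) : exists2 M : C, 0 <= M & forall b, `|w b| <= M * `|b|.
Proof.
apply: bounded_opP; apply: continuous_blin; first exact: linearP.
exact: dual_continuous.
Qed.

(** Put [h' = p y h] for the sliced sum [y]. Then [|h'|^2 = w b], where [b] is the slice of the
    tensor by the vector functional of [h] and [h']. Matrix coefficients of [q b] are matrix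
    coefficients of the tensor, so [|b| <= N |h| |h'|]; hence [|h'| <= M N |h|]. *)
Lemma slice_sum_le (w : dual B) (M : C) : 0 <= M -> (forall b, `|w b| <= M * `|b|) ->
  forall s : seq (A * B),
  `|\sum_(x <- s) (w x.2 : C) *: x.1| <= M * `|\sum_(x <- s) x.1 ⊠ x.2|.
Proof.
move=> M0 wM s; set N := `|\sum_(x <- s) x.1 ⊠ x.2|.
have [H [p fp]] := faithful_rep T A; have [K [q fq]] := faithful_rep T B.
have [L [phi [P [Q [hphi [rP PE] [rQ QE] PQ [h1 h2]]]]]] := spatial_rep fp.1 fq.1.
apply: (faithful_rep_isometric fp); first by rewrite mulr_ge0 /N.
move=> h; set y := \sum_(x <- s) _; set h' := p y h.
have [->|h'0] := eqVneq h' 0; first by rewrite normr0 !mulr_ge0 /N.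
have nh' : 0 < `|h'| by rewrite normr_gt0.
case: (fp.1) => _ pl pM ps; case: (fq.1) => _ ql qM qs.
pose b := \sum_(x <- s) hip (p x.1 h) h' *: x.2.
have wb : hip h' h' = w b.
  rewrite {1}/h' /y (lin_sum (pl h)) hip_suml /b.
  rewrite -[RHS]/(dual_fun w _) linear_sum; apply: eq_bigr => x _.
  by rewrite (linZ (pl h)) hipZl linearZ mulrC.
have qb : `|b| <= N * `|h| * `|h'|.
  apply: (faithful_rep_isometric fq); first by rewrite !mulr_ge0 /N.
  move=> k; set k' := q b k.
  have [->|k'0] := eqVneq k' 0; first by rewrite normr0 !mulr_ge0 /N.
  have nk' : 0 < `|k'| by rewrite normr_gt0.
  have e : hip k' k' = hip (\sum_(x <- s) P x.1 (Q x.2 (phi h k))) (phi h' k').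
    rewrite {1}/k' /b (lin_sum (ql k)) !hip_suml; apply: eq_bigr => x _.
    by rewrite (linZ (ql k)) hipZl QE PE hphi.1.
  rewrite -(ler_pM2r nk') -expr2 -hip_norm e (le_trans (real_ler_norm _)) //.
    by rewrite -e; apply: ger0_real; exact: hip_ge0.
  rewrite (le_trans (hip_le _ _)) // (le_trans (ler_wpM2r _ (h1 _ _))) //.
  by rewrite !(htensor_norm hphi) -/N le_eqVlt; apply/orP; left; apply/eqP; ring.
rewrite -(ler_pM2r nh') -expr2 -hip_norm (le_trans (real_ler_norm _)) //.
  by apply: ger0_real; exact: hip_ge0.
rewrite wb (le_trans (wM _)) // (le_trans (ler_wpM2l M0 qb)) //.
by rewrite !mulrA.
Qed.

Lemma slice0P (w : dual B) : [/\ linear (@slice0 R T A B w),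
  continuous (@slice0 R T A B w) & forall a b, @slice0 R T A B w (a ⊠ b) = (w b : C) *: a].
Proof.
have [M M0 wM] := dual_bounded w.
have [|F [bF FE]] := @tens_extension A (fun a b => (w b : C) *: a) M _ (slice_sum_le M0 wM).
  by move=> b k a a'; rewrite scalerDr !scalerA mulrC.
have := @xgetPex _ ((fun=> 0) : A ⊗ B -> A) [set F : A ⊗ B -> A | [/\ linear F, continuous F
                            & forall (x : A) (a : B), F (x ⊠ a) = (w a : C) *: x]].
apply; exists F; split=> //; first by case: bF.
by case: bF => lF bF; exact: blin_continuous.
Qed.

Lemma blin_slice0 (w : dual B) : blin (@slice0 R T A B w).
Proof. by case: (slice0P w) => l c _; split=> //; exact: continuous_blin. Qed.

Lemma slice0E (w : dual B) a b : @slice0 R T A B w (a ⊠ b) = (w b : C) *: a.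
Proof. by case: (slice0P w). Qed.

Lemma slice0_le (w : dual B) (M : C) : 0 <= M -> (forall b, `|w b| <= M * `|b|) ->
  forall y : A ⊗ B, `|@slice0 R T A B w y| <= M * `|y|.
Proof.
move=> M0 wM; have [l bd] := blin_slice0 w.
apply: (bounded_total (etens_total T A B)) => // s.
rewrite etens_scale (lin_sum l); under eq_bigr do rewrite slice0E.
exact: slice_sum_le.
Qed.

End Two.
End Tens.

Lemma strong_cvg (K : numFieldType) (V : normedModType K) (U I : Type)
    (F : set_system U) (u : U -> V -> V) (e : I -> V) (M : K) : Filter F ->
  clspan (range e) = setT -> (forall x, linear (u x)) -> 0 <= M ->
  (\forall x \near F, forall v, `|u x v| <= M * `|v|) ->
  (forall i, u^~ (e i) @ F --> e i) -> forall v, u^~ v @ F --> v.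
Proof.
move=> FF eT ul M0 uM ue v; have : clspan (range e) v by rewrite eT.
move: v; apply: clspan_ind.
- apply: closed_approx => v h; apply/cvgrPdist_le => d d0.
  have M2 : 0 < M + 2 by rewrite ltr_wpDl.
  have d1 := divr_gt0 d0 M2.
  have [v' /cvgrPdist_le/(_ _ d1) hv vv'] := h _ d1.
  apply: filterS2 uM hv => x uM' hx.
  have -> : v - u x v = (v - v') + ((v' - u x v') + (u x v' - u x v)).
    by rewrite addrA !subrKA.
  rewrite (le_trans (ler_normD _ _)) //.
  have -> : d = d / (M + 2) + (d / (M + 2) + M * (d / (M + 2))).
    by field; rewrite gt_eqF.
  apply: lerD; first exact: ltW.
  apply: (le_trans (ler_normD _ _)); apply: lerD; first exact: hx.
  rewrite -(linB (ul x)) (le_trans (uM' _)) // ler_wpM2l // distrC; exact: ltW.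
- rewrite /= (_ : (fun x => u x 0) = fun=> 0); first exact: cvg_cst.
  by apply/funext => x; rewrite (lin0 (ul x)).
- move=> k v w /= hv hw.
  rewrite (_ : (fun x => _) = (fun x => k *: u x v + u x w)); last first.
    by apply/funext => x; rewrite ul.
  by apply: cvgD => //; exact: cvgZl_tmp.
- by move=> _ [i _ <-].
Qed.

Lemma norm_le_cvg (R : realType) (V : normedModType R[i]) (U : Type) (F : set_system U)
    (u : U -> V) (v : V) (M : R[i]) : ProperFilter F -> u @ F --> v ->
  (\forall x \near F, `|u x| <= M) -> `|v| <= M.
Proof.
move=> FF uv uM.
apply: (@le_cvg R _ F _ (fun x => `|u x|) (fun=> M)) => //; first exact: cvg_norm.
exact: cvg_cst.
Qed.

(** * Tensor products of homomorphisms into multiplier algebras *)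

Section HTens.
Variables (R : realType) (T : tensor_products R).
Local Notation C := R[i].
Local Notation "A ⊗ B" := (ctens T A B) (at level 40, left associativity).
Local Notation "a ⊠ b" := (etens T a b) (at level 40, left associativity).

Lemma star_hom_comp (A B D : cstarType R) (f : B -> D) (g : A -> B) :
  is_star_hom f -> is_star_hom g -> is_star_hom (f \o g).
Proof.
move=> [fl fM fs] [gl gM gs]; split=> /=; first exact: lin_comp.
- by move=> a b; rewrite gM fM.
- by move=> a; rewrite gs fs.
Qed.

Lemma memb_star_hom (A : cstarType R) : is_star_hom (@memb R A).
Proof. by split; [exact: memb_linear|exact: membM|exact: memb_star]. Qed.

(** The space of [rep_multiplier] is spanned by the vectors [phi (a, h)], and [phi (e ** a, h)]
    tends to [phi (a, h)]. So [A] acts nondegenerately there. *)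
Lemma rep_multiplier_aunit (A : cstarType R) :
  exists (K : hilbertType R) (P : 'M(A) -> K -> K), is_faithful_rep P /\
    forall xi, (fun e => P (memb e) xi) @ @aunit R A --> xi.
Proof.
have FF := aunit_proper T A.
have [H [p fp]] := faithful_rep T A.
have [K [P [phi [rP phiT hphi PE]]]] := rep_multiplier fp.1.
exists K, P; split; first exact: (rep_multiplier_faithful fp rP hphi PE).
apply: (@strong_cvg C K _ _ (@aunit R A) (fun e => P (memb e)) phi 2) => //.
- by move=> e; exact: rep_lin.
- apply: filterS (aunit_near A) => e ue v; rewrite (le_trans (rep_le rP _ _)) //.
  by rewrite memb_norm ler_wpM2r // near_unit_norm.
- move=> [a h]; apply/cvgrPdist_le => d d0.
  have h1 : 0 < `|h| + 1 by rewrite ltr_wpDl.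
  have /cvgrPdist_le/(_ _ (divr_gt0 d0 h1)) := @aunit_cvgl R T A a.
  apply: filterS => e hea; rewrite PE /=.
  have -> : `|phi (a, h) - phi (e ** a, h)| = `|p (a - e ** a) h|.
    have pl : linear (p^~ h) by case: fp.1.
    apply/eqP; rewrite -(@eqrXn2 _ 2) // -!hip_norm (linB pl).
    by rewrite !(hipBl, hipBr) !hphi.
  rewrite (le_trans (rep_le fp.1 _ _)) // (le_trans (ler_wpM2r _ hea)) //.
  by rewrite mulrAC ler_pdivrMr // ler_wpM2l ?lerDl // ltW.
Qed.

(** One pair [P], [Q] serves all homomorphisms into [M(A')] and [M(B')], including the inclusions of
    [A'] and [B']. Norms in [A ⊗ B] and in [A' ⊗ B'] can thus be compared on the same Hilbert
    space. *)
Lemma spatial_multiplier (A' B' : cstarType R) :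
  exists (L : hilbertType R) (P : 'M(A') -> L -> L) (Q : 'M(B') -> L -> L),
  [/\ is_rep P /\ (forall xi, (fun e => P (memb e) xi) @ @aunit R A' --> xi),
     is_rep Q /\ (forall xi, (fun e => Q (memb e) xi) @ @aunit R B' --> xi),
     (forall m n xi, P m (Q n xi) = Q n (P m xi)),
     (forall (A B : cstarType R) (f : A -> 'M(A')) (g : B -> 'M(B')),
        is_star_hom f -> is_star_hom g -> forall s xi,
        `|\sum_(x <- s) P (f x.1) (Q (g x.2) xi)| <= `|\sum_(x <- s) x.1 ⊠ x.2| * `|xi|)
   & (forall (A B : cstarType R) (f : A -> 'M(A')) (g : B -> 'M(B')),
        is_star_hom f -> is_star_hom g -> injective f -> injective g ->
        forall s M, 0 <= M ->
        (forall xi, `|\sum_(x <- s) P (f x.1) (Q (g x.2) xi)| <= M * `|xi|) ->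
        `|\sum_(x <- s) x.1 ⊠ x.2| <= M)].
Proof.
have FA := aunit_proper T A'; have FB := aunit_proper T B'.
have [K1 [P1 [fP1 cP1]]] := rep_multiplier_aunit A'.
have [K2 [P2 [fP2 cP2]]] := rep_multiplier_aunit B'.
have [L [phi [P [Q [hphi [rP PE] [rQ QE] PQ _]]]]] := spatial_rep T fP1.1 fP2.1.
have bP a : blin (P a) by split; [exact: rep_lin|exists `|a|; exact: rep_le].
have bQ b : blin (Q b) by split; [exact: rep_lin|exists `|b|; exact: rep_le].
have bphil k : blin (phi^~ k).
  split; first exact: (htensor_linl hphi).
  by exists `|k| => h; rewrite (htensor_norm hphi) mulrC.
have bphir h : blin (phi h).
  split; first exact: (htensor_linr hphi).
  by exists `|h| => k; rewrite (htensor_norm hphi).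
have rep_hom (A D : cstarType R) (H : hilbertType R) (f : A -> D) (p : D -> H -> H) :
    is_star_hom f -> is_rep p -> is_rep (p \o f).
  by move=> hf rp; exact: rep_star_hom hf _ _ rp.
have frep_hom (A D : cstarType R) (H : hilbertType R) (f : A -> D) (p : D -> H -> H) :
    is_star_hom f -> injective f -> is_faithful_rep p -> is_faithful_rep (p \o f).
  move=> hf fi fp; split; first exact: rep_hom hf fp.1.
  move=> a h; apply: fi; rewrite (lin0 (_ : linear f)); last by case: hf.
  exact: fp.2.
exists L, P, Q; split=> //.
- split=> //; apply: (@strong_cvg C L _ _ (@aunit R A') (fun e => P (memb e)) _ 2 _ hphi.2) => //.
  + by move=> e; case: (bP (memb e)).
  + apply: filterS (aunit_near A') => e ue v; rewrite (le_trans (rep_le rP _ _)) //.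
    by rewrite memb_norm ler_wpM2r // near_unit_norm.
  + move=> [h k]; rewrite (_ : (fun _ => _) = (phi^~ k) \o (fun e => P1 (memb e) h)).
      exact: blin_cvg.
    by apply/funext => e /=; rewrite PE.
- split=> //; apply: (@strong_cvg C L _ _ (@aunit R B') (fun e => Q (memb e)) _ 2 _ hphi.2) => //.
  + by move=> e; case: (bQ (memb e)).
  + apply: filterS (aunit_near B') => e ue v; rewrite (le_trans (rep_le rQ _ _)) //.
    by rewrite memb_norm ler_wpM2r // near_unit_norm.
  + move=> [h k]; rewrite (_ : (fun _ => _) = (phi h) \o (fun e => P2 (memb e) k)).
      exact: blin_cvg.
    by apply/funext => e /=; rewrite QE.
- move=> A B f g hf hg s xi.
  apply: (@norm_tens_op R T A B _ _ L phi hphi (P1 \o f) (P2 \o g) (fun x xi => P (f x.1) (Q (g x.2) xi))).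
  + by move=> x; case: (blin_comp (bP (f x.1)) (bQ (g x.2))).
  + by move=> x; case: (blin_comp (bP (f x.1)) (bQ (g x.2))).
  + by move=> x h k /=; rewrite QE PE.
  + exact: rep_hom hf fP1.1.
  + exact: rep_hom hg fP2.1.
- move=> A B f g hf hg fi gi s M M0 h.
  apply: (@norm_tens_le R T A B _ _ L phi hphi (P1 \o f) (P2 \o g) (fun x xi => P (f x.1) (Q (g x.2) xi))) => //.
  + by move=> x; case: (blin_comp (bP (f x.1)) (bQ (g x.2))).
  + by move=> x; case: (blin_comp (bP (f x.1)) (bQ (g x.2))).
  + by move=> x h0 k /=; rewrite QE PE.
  + exact: frep_hom.
  + exact: frep_hom.
Qed.

Section Map.
Variables (A B A' B' : cstarType R) (f : A -> 'M(A')) (g : B -> 'M(B')).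
Hypotheses (hf : is_star_hom f) (hg : is_star_hom g).

Lemma lmul_sum (D : cstarType R) (I : Type) (s : seq I) (m : I -> 'M(D)) (d : D) :
  lmul (\sum_(i <- s) m i) d = \sum_(i <- s) lmul (m i) d.
Proof. exact: (lin_sum (blin_lmul_at d).1). Qed.

Lemma htens_sum_le (s : seq (A * B)) :
  `|\sum_(x <- s) mtens T (f x.1) (g x.2)| <= `|\sum_(x <- s) x.1 ⊠ x.2|.
Proof.
have [L [P [Q [[rP _] [rQ _] PQ h1 h2]]]] := spatial_multiplier A' B'.
have hA := memb_star_hom A'; have hB := memb_star_hom B'.
apply/mnormP => // u; move: u; set m := \sum_(x <- s) _.
apply: (bounded_total (etens_total T A' B')) => //.
- by case: (blin_lmul m).
- by case: (blin_lmul m).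
move=> t; rewrite etens_scale; set t' := [seq _ | _ <- t].
have -> : lmul m (\sum_(y <- t') y.1 ⊠ y.2) =
    \sum_(z <- [seq (lmul (f x.1) y.1, lmul (g x.2) y.2) | x <- s, y <- t']) z.1 ⊠ z.2.
  rewrite big_allpairs_dep /= lmul_sum; apply: eq_bigr => x _.
  rewrite (lin_sum (lmul_linear _)); apply: eq_bigr => y _; exact: mtensl.
apply: (h2 _ _ _ _ hA hB (@memb_inj _ _) (@memb_inj _ _)).
  by rewrite mulr_ge0.
case: rP => pb pl pM ps; case: (rQ) => qb ql qM qs.
move=> xi; rewrite big_allpairs_dep /=.
have -> : \sum_(x <- s) \sum_(y <- t') P (memb (lmul (f x.1) y.1)) (Q (memb (lmul (g x.2) y.2)) xi)
  = \sum_(x <- s) P (f x.1) (Q (g x.2) (\sum_(y <- t') P (memb y.1) (Q (memb y.2) xi))).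
  apply: eq_bigr => x _.
  rewrite (lin_sum (qb _).1) (lin_sum (pb _).1); apply: eq_bigr => y _.
  by rewrite -!mul_memb pM qM -PQ.
rewrite (le_trans (h1 _ _ _ _ hf hg _ _)) // -mulrA ler_wpM2l //.
exact: h1.
Qed.

(** The operator of the sum is tested on vectors [P e (Q e' xi)], which turns it into the operator
    of [lmul m (e ⊠ e')]; then [e] and [e'] run through approximate units. The constant is [2 * 2],
    the bound for [|e| |e'|]. *)
Lemma htens_sum_ge (s : seq (A * B)) : injective f -> injective g ->
  `|\sum_(x <- s) x.1 ⊠ x.2| <= 4 * `|\sum_(x <- s) mtens T (f x.1) (g x.2)|.
Proof.
move=> fi gi; set m := \sum_(x <- s) mtens _ _ _.
have FA := aunit_proper T A'; have FB := aunit_proper T B'.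
have [L [P [Q [[rP cP] [rQ cQ] PQ h1 h2]]]] := spatial_multiplier A' B'.
have hA := memb_star_hom A'; have hB := memb_star_hom B'.
have bP a : blin (P a) by split; [exact: rep_lin|exists `|a|; exact: rep_le].
have bQ b : blin (Q b) by split; [exact: rep_lin|exists `|b|; exact: rep_le].
case: (rP) => pb pl pM ps; case: (rQ) => qb ql qM qs.
apply: (h2 _ _ f g hf hg fi gi); first by rewrite mulr_ge0.
move=> xi; pose W eta := \sum_(x <- s) P (f x.1) (Q (g x.2) eta).
rewrite -/(W xi).
have bW : blin W by apply: blin_sum => x; exact: blin_comp (bP _) (bQ _).
have key e e' : near_unit e -> near_unit e' ->
    `|W (P (memb e) (Q (memb e') xi))| <= 4 * `|m| * `|xi|.
  move=> ue ue'.
  have -> : W (P (memb e) (Q (memb e') xi)) =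
      \sum_(y <- [seq (lmul (f x.1) e, lmul (g x.2) e') | x <- s])
        P (memb y.1) (Q (memb y.2) xi).
    rewrite big_map; apply: eq_bigr => x _ /=.
    by rewrite -!mul_memb pM qM -PQ.
  rewrite (le_trans (h1 _ _ _ _ hA hB _ _)) // ler_wpM2r // big_map /=.
  have -> : \sum_(x <- s) lmul (f x.1) e ⊠ lmul (g x.2) e' = lmul m (e ⊠ e').
    by rewrite /m lmul_sum; apply: eq_bigr => x _; rewrite mtensl.
  rewrite (le_trans (le_mnorm m _)) // mulrC ler_wpM2r ?mnorm_ge0 //.
  have -> : (4 : C) = 2 * 2 by rewrite -natrM.
  rewrite (le_trans (norm_etens_le _ _ _)) //.
  by apply: ler_pM => //; exact: near_unit_norm.
apply: (norm_le_cvg FA (blin_cvg _ bW (cP xi))).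
apply: filterS (aunit_near A') => e ue /=.
apply: (norm_le_cvg FB (blin_cvg _ (blin_comp bW (bP (memb e))) (cQ xi))).
by apply: filterS (aunit_near B') => e' ue' /=; exact: key.
Qed.

Lemma htensP : is_star_hom (htens (T := T) f g) /\
  forall a b, htens (T := T) f g (a ⊠ b) = mtens T (f a) (g b).
Proof.
have [fl fM fs] := hf; have [gl gM gs] := hg.
have [||F [bF FE]] := @tens_extension R T A B 'M(A' ⊗ B') (fun a b => mtens T (f a) (g b)) 1.
- by move=> b k a a'; rewrite fl mtens_linl.
- by move=> s; rewrite mul1r; exact: htens_sum_le.
suff Fhom : is_star_hom F.
  exact: (@xgetPex _ ((fun=> 0) : A ⊗ B -> 'M(A' ⊗ B')) [set F | is_star_hom F /\
    forall a b, F (a ⊠ b) = mtens T (f a) (g b)] (ex_intro _ F (conj Fhom FE))).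
split.
- by case: bF.
- move=> u v; move: u.
  apply: tens_ext; first exact: blin_comp bF (blin_mulr v).
    exact: blin_comp (blin_mulr _) bF.
  move=> a b; move: v; apply: tens_ext; first exact: blin_comp bF (blin_mull _).
    exact: blin_comp (blin_mull _) bF.
  by move=> a' b'; rewrite etensM !FE fM gM mtensM.
- have bs := blin_star_star bF.
  suff h : (fun u => star (F (star u))) =1 F by move=> u; rewrite -h starK.
  apply: tens_ext => // a b.
  by rewrite etens_star !FE mtens_star fs gs !starK.
Qed.

Lemma htens_star_hom : is_star_hom (htens (T := T) f g).
Proof. by case: htensP. Qed.

Lemma htensE a b : htens (T := T) f g (a ⊠ b) = mtens T (f a) (g b).
Proof. by case: htensP. Qed.

Lemma htens_inj : injective f -> injective g -> injective (htens (T := T) f g).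
Proof.
move=> fi gi u v uv; have [l _ _] := htens_star_hom.
apply/eqP; rewrite -subr_eq0; set x := u - v.
have Fx : htens (T := T) f g x = 0 by rewrite (linB l) uv subrr.
clearbody x; clear u v uv.
rewrite -normr_le0; apply/ler_addgt0Pr => d d0; rewrite add0r.
(* With [|x - y| < d / 5], the constant [4] of [htens_sum_ge] gives [|y| <= 4 (d / 5)], in total
   [d]. *)
have [|s xs] := @clspan_approx C (A ⊗ B) (A * B)%type (fun x => x.1 ⊠ x.2) x _ (d / 5) (divr_gt0 d0 (ltr0n _ 5)).
  by rewrite (etens_total T A B).
rewrite etens_scale in xs; set y := \sum_(p <- _) _ in xs.
have Fy : `|htens (T := T) f g y| <= d / 5.
  rewrite -normrN -(add0r (- _)) -Fx -(linB l).
  by rewrite (le_trans (star_hom_le T htens_star_hom _)) // ltW.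
have ny : `|y| <= 4 * (d / 5).
  rewrite (le_trans (htens_sum_ge _ fi gi)) // ler_wpM2l //.
  move: Fy; rewrite /y (lin_sum l).
  by under eq_bigr do rewrite htensE.
rewrite -(subrK y x) (le_trans (ler_normD _ _)) // (le_trans (lerD (ltW xs) ny)) //.
by rewrite le_eqVlt; apply/orP; left; apply/eqP; field.
Qed.

End Map.
End HTens.

(** * Associativity of the tensor product *)

Section TAssoc.
Variables (R : realType) (T : tensor_products R).
Local Notation C := R[i].
Local Notation "A ⊗ B" := (ctens T A B) (at level 40, left associativity).
Local Notation "a ⊠ b" := (etens T a b) (at level 40, left associativity).

(** Faithfulness survives completion: if [x] acts as zero and [y] is a finite sum close to [x], then
    the operator of [y] is that of [y - x], so [|y|] is small by the norm formula for finite
    sums. *)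
Lemma spatial_tensor_rep (A B : cstarType R) (H K : hilbertType R)
    (p : A -> H -> H) (q : B -> K -> K) : is_faithful_rep p -> is_faithful_rep q ->
  exists (L : hilbertType R) (phi : H -> K -> L) (rho : A ⊗ B -> L -> L),
  [/\ is_hilbert_tensor phi, is_faithful_rep rho
    & forall a b h k, rho (a ⊠ b) (phi h k) = phi (p a h) (q b k)].
Proof.
move=> fp fq.
have [L [phi [P [Q [hphi [rP PE] [rQ QE] PQ [h1 h2]]]]]] := spatial_rep T fp.1 fq.1.
have bP a : blin (P a) by split; [exact: rep_lin|exists `|a|; exact: rep_le].
have bQ b : blin (Q b) by split; [exact: rep_lin|exists `|b|; exact: rep_le].
case: (rP) => pb pl pM ps; case: (rQ) => qb ql qM qs.
have ex xi : exists F : A ⊗ B -> L, blin F /\ forall a b, F (a ⊠ b) = P a (Q b xi).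
  apply: (@tens_extension R T A B L (fun a b => P a (Q b xi)) `|xi|).
    by move=> b k a a'; exact: pl.
  by move=> s; rewrite mulrC; exact: h1.
have [F FP] := choice ex.
have bF xi : blin (F xi) by case: (FP xi).
have FE xi a b : F xi (a ⊠ b) = P a (Q b xi) by case: (FP xi).
have Fle xi x : `|F xi x| <= `|x| * `|xi|.
  rewrite mulrC; move: x; apply: (bounded_total (etens_total T A B)) => //.
  - by case: (bF xi).
  - by case: (bF xi).
  move=> s; rewrite etens_scale (lin_sum (bF xi).1) mulrC.
  by under eq_bigr do rewrite FE; exact: h1.
pose rho x xi := F xi x.
have rl x : linear (rho x).
  move=> k xi eta; rewrite /rho; move: x.
  apply: (@tens_ext R T A B L (F (k *: xi + eta)) (fun x => k *: F xi x + F eta x)) => //.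
    by apply: blinD => //; exact: blinZ.
  by move=> a b; rewrite !FE (bQ b).1 (bP a).1.
have rr : is_rep rho.
  split.
  - by move=> x; split=> //; exists `|x| => xi; exact: Fle.
  - by move=> xi; case: (bF xi).
  - move=> x y xi; rewrite /rho; move: x.
    apply: (@tens_ext R T A B L (fun x => F xi (x ** y)) (F (F xi y))) => //.
      exact: (blin_comp (bF xi) (blin_mulr y)).
    move=> a b; rewrite FE; move: y.
    apply: (@tens_ext R T A B L (fun y => F xi (a ⊠ b ** y)) (fun y => P a (Q b (F xi y)))).
    + exact: (blin_comp (bF xi) (blin_mull _)).
    + exact: (blin_comp (bP a) (blin_comp (bQ b) (bF xi))).
    + by move=> a' b'; rewrite etensM !FE pM qM -PQ.
  - move=> x xi eta; rewrite /rho [RHS]hip_herm; move: x.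
    have bh (f : A ⊗ B -> L) (zeta : L) : blin f -> blin (fun x => hip (f x) zeta : C^o).
      move=> [lf [m fm]]; split; first by move=> k x y; rewrite lf hip_linear.
      exists (m * `|zeta|) => x; rewrite (le_trans (hip_le _ _)) // mulrAC ler_wpM2r //.
    have bhs (f : A ⊗ B -> C^o) : blin f -> blin (fun x => (f (star x))^* : C^o).
      move=> [lf [m fm]]; split.
        by move=> k x y; rewrite starD starZ lf rmorphD rmorphM /= conjCK.
      by exists m => x; rewrite norm_conjC -(norm_star x); exact: fm.
    apply: (@tens_ext R T A B C^o (fun x => hip (F xi x) eta : C^o)
      (fun x => (hip (F eta (star x)) xi)^* : C^o)).
    + exact: (bh _ _ (bF xi)).
    + exact: (bhs _ (bh _ _ (bF eta))).
    + by move=> a b; rewrite etens_star !FE ps qs PQ -hip_herm.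
exists L, phi, rho; split=> //; last by move=> a b h k; rewrite /rho FE QE PE.
split=> // x hx; apply/eqP; rewrite -normr_le0; apply/ler_addgt0Pr => d d0; rewrite add0r.
have [|s xs] := @clspan_approx C (A ⊗ B) (A * B)%type (fun x => x.1 ⊠ x.2) x _ (d / 2)
  (divr_gt0 d0 (ltr0n _ 2)).
  by rewrite (etens_total T A B).
rewrite etens_scale in xs; set t := [seq _ | _ <- s] in xs; set y := \sum_(p <- _) _ in xs.
have ny : `|y| <= d / 2.
  apply: (h2 fp fq); first by rewrite divr_ge0 // ltW.
  move=> xi; have -> : \sum_(z <- t) P z.1 (Q z.2 xi) = rho (y - x) xi.
    rewrite /rho (linB (bF xi).1) -[F xi x]/(rho x xi) hx subr0 (lin_sum (bF xi).1).
    by apply: eq_bigr => z _; rewrite FE.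
  by rewrite (le_trans (Fle _ _)) // ler_wpM2r // distrC ltW.
rewrite -(subrK y x) (le_trans (ler_normD _ _)) // (le_trans (lerD (ltW xs) ny)) //.
by rewrite -splitr.
Qed.

Lemma clspan_id (V : normedModType C) : clspan (range (@id V)) = setT.
Proof. by apply/seteqP; split=> // v _; apply: sub_clspan; exists v. Qed.

Section Three.
Variables (A B D : cstarType R).

(** The two bracketings act on the two bracketings of [H], [K], [M]. The inner products of
    elementary tensors agree there ([normE]), so combinations have equal norms and the operator
    bound is transported. *)
Lemma assoc_sum_le (s : seq (A * (B * D))) :
  `|\sum_(x <- s) x.1 ⊠ x.2.1 ⊠ x.2.2| <= `|\sum_(x <- s) x.1 ⊠ (x.2.1 ⊠ x.2.2)|.
Proof.
have [H [p fp]] := faithful_rep T A; have [K [q fq]] := faithful_rep T B.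
have [M [r fr]] := faithful_rep T D.
have [L1 [phi1 [rho1 [hphi1 frho1 rho1E]]]] := spatial_tensor_rep fp fq.
have [L2 [phi2 [rho2 [hphi2 frho2 rho2E]]]] := spatial_tensor_rep fq fr.
have [W1 [psi1 [P1 [Q1 [hpsi1 [rP1 P1E] [rQ1 Q1E] _ [_ h1]]]]]] := spatial_rep T frho1.1 fr.1.
have [W2 [psi2 [P2 [Q2 [hpsi2 [rP2 P2E] [rQ2 Q2E] _ [h2 _]]]]]] := spatial_rep T fp.1 frho2.1.
have bP1 a : blin (P1 a) by split; [exact: rep_lin|exists `|a|; exact: rep_le].
have bQ1 b : blin (Q1 b) by split; [exact: rep_lin|exists `|b|; exact: rep_le].
have bP2 a : blin (P2 a) by split; [exact: rep_lin|exists `|a|; exact: rep_le].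
have bQ2 b : blin (Q2 b) by split; [exact: rep_lin|exists `|b|; exact: rep_le].
set N := `|\sum_(x <- s) x.1 ⊠ (x.2.1 ⊠ x.2.2)|.
have totalW1 : clspan (range (fun x : (H * K) * M => psi1 (phi1 x.1.1 x.1.2) x.2)) = setT.
  apply: (@total_bilinear C L1 M W1 (H * K)%type M (fun x => phi1 x.1 x.2) id psi1).
  - exact: hphi1.2.
  - exact: clspan_id.
  - move=> v; split; first exact: (htensor_linl hpsi1).
    by exists `|v| => h; rewrite (htensor_norm hpsi1) mulrC.
  - move=> v; split; first exact: (htensor_linr hpsi1).
    by exists `|v| => h; rewrite (htensor_norm hpsi1).
  - exact: hpsi1.2.
have normE (u : seq (C * ((H * K) * M))) :
    `|\sum_(y <- u) y.1 *: psi1 (phi1 y.2.1.1 y.2.1.2) y.2.2| =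
    `|\sum_(y <- u) y.1 *: psi2 y.2.1.1 (phi2 y.2.1.2 y.2.2)|.
  apply/eqP; rewrite -(@eqrXn2 _ 2) // -!hip_norm; apply/eqP.
  rewrite !hip_suml; apply: eq_bigr => y _; rewrite !hip_sumr; apply: eq_bigr => z _.
  rewrite !hipZl !hipZr; congr (_ * (_ * _)).
  by rewrite hpsi1.1 hpsi2.1 hphi1.1 hphi2.1 mulrA.
have := h1 frho1 fr [seq (x.1 ⊠ x.2.1, x.2.2) | x <- s] N.
rewrite big_map /=; apply; first by rewrite /N.
move=> xi; rewrite big_map /=; move: xi.
apply: (bounded_total totalW1).
- by case: (@blin_sum C W1 W1 _ s (fun x xi => P1 (x.1 ⊠ x.2.1) (Q1 x.2.2 xi))
    (fun x => blin_comp (bP1 _) (bQ1 _))).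
- by case: (@blin_sum C W1 W1 _ s (fun x xi => P1 (x.1 ⊠ x.2.1) (Q1 x.2.2 xi))
    (fun x => blin_comp (bP1 _) (bQ1 _))).
- by rewrite /N.
move=> t; rewrite normE.
pose u := [seq (y.1, ((p x.1 y.2.1.1, q x.2.1 y.2.1.2), r x.2.2 y.2.2)) | x <- s, y <- t].
have -> : \sum_(x <- s) P1 (x.1 ⊠ x.2.1) (Q1 x.2.2 (\sum_(y <- t) y.1 *: psi1 (phi1 y.2.1.1 y.2.1.2) y.2.2))
  = \sum_(y <- u) y.1 *: psi1 (phi1 y.2.1.1 y.2.1.2) y.2.2.
  rewrite /u big_allpairs_dep /=; apply: eq_bigr => x _.
  rewrite (lin_sum (bQ1 _).1) (lin_sum (bP1 _).1); apply: eq_bigr => y _.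
  by rewrite (linZ (bQ1 _).1) (linZ (bP1 _).1) Q1E P1E rho1E.
rewrite normE.
have -> : \sum_(y <- u) y.1 *: psi2 y.2.1.1 (phi2 y.2.1.2 y.2.2) =
  \sum_(z <- [seq (x.1, x.2.1 ⊠ x.2.2) | x <- s]) P2 z.1 (Q2 z.2 (\sum_(y <- t) y.1 *: psi2 y.2.1.1 (phi2 y.2.1.2 y.2.2))).
  rewrite /u big_allpairs_dep /= big_map; apply: eq_bigr => x _ /=.
  rewrite (lin_sum (bQ2 _).1) (lin_sum (bP2 _).1); apply: eq_bigr => y _.
  by rewrite (linZ (bQ2 _).1) (linZ (bP2 _).1) Q2E P2E rho2E.
by rewrite (le_trans (h2 _ _)) // big_map.
Qed.

Lemma tens3_ext (W : normedModType C) (F G : A ⊗ (B ⊗ D) -> W) : blin F -> blin G ->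
  (forall a b d, F (a ⊠ (b ⊠ d)) = G (a ⊠ (b ⊠ d))) -> F =1 G.
Proof.
move=> bF bG FG; apply: tens_ext => // a.
apply: (@tens_ext R T B D W (F \o etens T a) (G \o etens T a)).
- exact: (blin_comp bF (@blin_etensr R T _ _ a)).
- exact: (blin_comp bG (@blin_etensr R T _ _ a)).
- exact: FG.
Qed.

Lemma tassocP : is_star_hom (@tassoc R T A B D) /\
  forall a b d, @tassoc R T A B D (a ⊠ (b ⊠ d)) = a ⊠ b ⊠ d.
Proof.
have tot : clspan (range (fun x : A * (B * D) => x.1 ⊠ (x.2.1 ⊠ x.2.2))) = setT.
  apply: (@total_bilinear C A (B ⊗ D) (A ⊗ (B ⊗ D)) A (B * D)%type id (fun x => x.1 ⊠ x.2)
    (fun a z => a ⊠ z)).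
  - exact: clspan_id.
  - exact: etens_total.
  - exact: blin_etensl.
  - exact: blin_etensr.
  - exact: etens_total.
have [s|F [lF bF FE]] := @bounded_linear_extension C (A ⊗ (B ⊗ D)) (A ⊗ B ⊗ D) _
  (fun x : A * (B * D) => x.1 ⊠ (x.2.1 ⊠ x.2.2)) (fun x => x.1 ⊠ x.2.1 ⊠ x.2.2) 1 tot.
  have := assoc_sum_le [seq (y.1 *: y.2.1, y.2.2) | y <- s]; rewrite !big_map /= mul1r.
  under eq_bigr do rewrite (linZ (@etens_linl R T _ _ _)) (linZ (@etens_linl R T _ _ _)).
  by under [X in _ <= `|X|]eq_bigr do rewrite (linZ (@etens_linl R T _ _ _)).
have {}FE a b d : F (a ⊠ (b ⊠ d)) = a ⊠ b ⊠ d := FE (a, (b, d)).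
have {}bF : blin F by split=> //; exists 1.
suff Fhom : is_star_hom F.
  exact: (@xgetPex _ ((fun=> 0) : A ⊗ (B ⊗ D) -> A ⊗ B ⊗ D) [set F | is_star_hom F /\
    forall a b c, F (a ⊠ (b ⊠ c)) = a ⊠ b ⊠ c] (ex_intro _ F (conj Fhom FE))).
split=> //.
- move=> u v; move: u; apply: tens3_ext; first exact: blin_comp bF (blin_mulr v).
    exact: blin_comp (blin_mulr _) bF.
  move=> a b d; move: v; apply: tens3_ext; first exact: blin_comp bF (blin_mull _).
    exact: blin_comp (blin_mull _) bF.
  by move=> a' b' d'; rewrite !etensM !FE !etensM.
- have bs := blin_star_star bF.
  suff h : (fun u => star (F (star u))) =1 F by move=> u; rewrite -h starK.
  apply: tens3_ext => // a b d.
  by rewrite !etens_star !FE !etens_star !starK.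
Qed.

Lemma tassoc_star_hom : is_star_hom (@tassoc R T A B D).
Proof. by case: tassocP. Qed.

Lemma tassocE a b d : @tassoc R T A B D (a ⊠ (b ⊠ d)) = a ⊠ b ⊠ d.
Proof. by case: tassocP. Qed.

End Three.
End TAssoc.

(** * Strict homomorphisms and their extensions *)

Section Strict.
Variables (R : realType) (T : tensor_products R).
Local Notation C := R[i].

Section Strict0.
Variables (A B : cstarType R) (V : normedModType C) (j : V -> 'M(A)).

(* For a linear [*]-preserving map, strict continuity on the unit ball reduces to
   this one-sided condition at [0]. *)
Definition strict0_at (F : V -> 'M(B)) (b : B) := forall e : C, 0 < e ->
  exists (s : seq A) (d : C), 0 < d /\ forall v : V, `|v| <= 1 ->
    (forall a, a \in s -> `|lmul (j v) a| < d /\ `|rmul (j v) a| < d) ->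
    `|lmul (F v) b| < e.

Lemma min_pos (c d : C) : 0 < c -> 0 < d ->
  exists2 r : C, 0 < r & r <= c /\ r <= d.
Proof.
move=> c0 d0; exists (d * c / (d + c)); first by rewrite divr_gt0 ?mulr_gt0 ?addr_gt0.
split; rewrite ler_pdivrMr ?addr_gt0 // mulrDr ?[d * c]mulrC ?lerDr ?lerDl mulr_ge0 //; exact: ltW.
Qed.

Lemma strict0_total (I : Type) (e : I -> B) (F : V -> 'M(B)) (M : C) :
  clspan (range e) = setT -> 0 <= M -> (forall v, `|F v| <= M * `|v|) ->
  (forall i, strict0_at F (e i)) -> forall b, strict0_at F b.
Proof.
move=> eT M0 FM he b; have : clspan (range e) b by rewrite eT.
move: b; apply: clspan_ind.
- apply: closed_approx => b h r r0; have r2 := divr_gt0 r0 (ltr0n _ 2).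
  have M1 : 0 < M + 1 by rewrite ltr_wpDl.
  have [b' hb' bb'] := h _ (divr_gt0 r2 M1).
  have [s [d [d0 hs]]] := hb' _ r2; exists s, d; split=> // v v1 hv.
  rewrite -[b](subrK b') linearD (le_lt_trans (ler_normD _ _)) // (splitr r) ler_ltD //.
    rewrite (le_trans (le_mnorm _ _)) // (@le_trans _ _ ((M + 1) * `|b - b'|)) //.
      rewrite ler_wpM2r // (le_trans (FM v)) // (le_trans (ler_wpM2l M0 v1)) // mulr1.
      by rewrite lerDl.
    by rewrite mulrC -ler_pdivlMr // ltW.
  exact: hs.
- move=> r r0; exists [::], 1; split=> // v _ _.
  by rewrite linear0 normr0.
- move=> k b b' hb hb' r r0; have r2 := divr_gt0 r0 (ltr0n _ 2).
  have k1 : 0 < `|k| + 1 by rewrite ltr_wpDl.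
  have [s [d [d0 hs]]] := hb _ (divr_gt0 r2 k1).
  have [t [c [c0 ht]]] := hb' _ r2.
  have [x x0 [xd xc]] := min_pos d0 c0.
  exists (s ++ t), x; split=> // v v1 hv.
  rewrite linearP (le_lt_trans (ler_normD _ _)) // (splitr r) ltrD //.
    rewrite normrZ.
    apply: (@le_lt_trans _ _ ((`|k| + 1) * `|lmul (F v) b|)).
      by rewrite ler_wpM2r // lerDl.
    rewrite mulrC -ltr_pdivlMr //; apply: hs => // a sa.
    have [|h1 h2] := hv a; first by rewrite mem_cat sa.
    by split; exact: lt_le_trans xd.
  apply: ht => // a sa.
  have [|h1 h2] := hv a; first by rewrite mem_cat sa orbT.
  by split; exact: lt_le_trans xc.
- by move=> _ [i _ <-].
Qed.

(** The right seminorms of [F] are left seminorms of its adjoint map [F']. The two may differ: the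
    adjoint of the slice by [w] is the slice by the adjoint functional. *)
Lemma strict0_strict (F F' : V -> 'M(B)) (st : V -> V) : linear j -> linear F ->
  (forall v, j (st v) = star (j v)) -> (forall v, F' (st v) = star (F v)) ->
  (forall v, `|st v| = `|v|) -> 
  (forall b, strict0_at F b) -> (forall b, strict0_at F' b) -> strict_on_ball j F.
Proof.
move=> lj lF js Fs nst hF hF' x0 x01 b e e0; have e2 := divr_gt0 e0 (ltr0n _ 2).
have [s [d [d0 hs]]] := hF b _ e2; have [t [c [c0 ht]]] := hF' (star b) _ e2.
have [r r0 [rd rc]] := min_pos d0 c0.
exists (s ++ [seq star a | a <- t]), r; split=> // x x1 hx.
(* [x - x0] may have norm up to [2]; halving it returns to the unit ball, where the condition at [0]
   applies. *)
pose v := 2^-1 *: (x - x0).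
have v1 : `|v| <= 1.
  rewrite normrZ ger0_norm ?invr_ge0 // ler_pdivrMl // mulr1.
  by rewrite (le_trans (ler_normB _ _)) // -[leRHS]/(1 + 1) lerD.
have jv : j x - j x0 = 2 *: j v.
  by rewrite (linZ lj) (linB lj) scalerA mulfV ?pnatr_eq0 // scale1r.
have Fv : F x - F x0 = 2 *: F v.
  by rewrite (linZ lF) (linB lF) scalerA mulfV ?pnatr_eq0 // scale1r.
have half (y : A) (q : C) : `|2 *: y| < q -> `|y| < q.
  rewrite normrZ ger0_norm //; apply: le_lt_trans.
  by rewrite ler_peMl // ler1n.
have dbl (y : B) : `|y| < e / 2 -> `|2 *: y| < e.
  by rewrite normrZ ger0_norm // ltr_pdivlMr // mulrC.
have hl a : a \in s ++ [seq star a | a <- t] -> `|lmul (j v) a| < r /\ `|rmul (j v) a| < r.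
  move=> /hx; rewrite jv => -[h1 h2]; split; exact: half.
rewrite Fv; split.
  apply: dbl; apply: hs => // a sa; have [|h1 h2] := hl a; first by rewrite mem_cat sa.
  by split; exact: lt_le_trans rd.
rewrite -norm_star /= starZ conj_Creal ?ger0_real //.
rewrite star_rmul -Fs; apply: dbl; apply: ht; first by rewrite nst.
move=> a ta; have [|h1 h2] := hl (star a); first by rewrite mem_cat map_f ?orbT.
rewrite js -{1}[a]starK -star_rmul norm_star -{2}[a]starK -star_lmul norm_star.
by split; exact: lt_le_trans rc.
Qed.

Lemma strict_strict0 (F : V -> 'M(B)) b : linear j -> linear F ->
  strict_on_ball j F -> strict0_at F b.
Proof.
move=> lj lF h e e0; have [|s [d [d0 hs]]] := h 0 _ b e e0; first by rewrite normr0.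
exists s, d; split=> // v v1 hv.
have := hs v v1; rewrite (lin0 lj) (lin0 lF) !subr0 => /(_ hv)[]; done.
Qed.

End Strict0.

Section Limits.
Variables (A : cstarType R).

(** [lmul m e] is [m e], an element of [A]. It approximates [m] strictly because [m (e a)] tends to
    [m a] and [(a m) e] to [a m]. *)
Lemma aunit_small (m : 'M(A)) (s : seq A) (d : C) : 0 < d ->
  \forall e \near @aunit R A, near_unit e /\ forall a, a \in s ->
    `|lmul m a - lmul m e ** a| < d /\ `|rmul m a - a ** lmul m e| < d.
Proof.
move=> d0; have FA := aunit_proper T A.
apply: filterI; first exact: aunit_near.
elim: s => [|x s IH]; first by exists [::], 1; split=> // e _ _ a; rewrite in_nil.
have bm := blin_lmul m.
have c1 := blin_cvg FA bm (@aunit_cvgl R T A x).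
have /cvgrPdist_lt/(_ _ d0) c2 := c1.
have /cvgrPdist_lt/(_ _ d0) c3 := @aunit_cvgr R T A (rmul m x).
apply: filterS3 IH c2 c3 => e h h1 h2 a; rewrite inE => /predU1P[->|/h//].
by rewrite -lmulM lrmul.
Qed.

Lemma strict_cvg (B : cstarType R) (F : 'M(A) -> 'M(B)) : linear F ->
  strict_on_ball id F -> forall m b,
  (fun e => lmul (F (memb (lmul m e))) b) @ @aunit R A --> lmul (F m) b.
Proof.
move=> lF sF m b; have FA := aunit_proper T A.
apply/cvgrPdist_lt => d d0.
(* [|m - m e| <= |m| + 2 |m|]; dividing by [K] places the difference in the unit ball, and the [1]
   keeps [K] positive. *)
pose K := 3 * `|m| + 1.
have K0 : 0 < K by rewrite ltr_wpDl // mulr_ge0.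
have lid : linear (id : 'M(A) -> 'M(A)) by [].
have [s [c [c0 hs]]] := @strict_strict0 A B 'M(A) id F b lid lF sF _ (divr_gt0 d0 K0).
apply: filterS (aunit_small m s (mulr_gt0 c0 K0)) => e [ue he].
pose v := K^-1 *: (m - memb (lmul m e)).
have KV : 0 <= K^-1 by rewrite invr_ge0 ltW.
have Fv : F m - F (memb (lmul m e)) = K *: F v.
  by rewrite (linZ lF) (linB lF) scalerA mulfV ?gt_eqF // scale1r.
rewrite -lmulB Fv [lmul _ _]/= normrZ (gtr0_norm K0) mulrC -ltr_pdivlMr //.
apply: hs.
  rewrite normrZ ger0_norm // ler_pdivrMl // mulr1 (le_trans (ler_normB _ _)) //.
  rewrite memb_norm (le_trans (lerD (lexx _) (le_mnorm m e))) //.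
  rewrite (le_trans (lerD (lexx _) (ler_wpM2l (mnorm_ge0 _) (near_unit_norm ue)))) //.
  have -> : K = `|m| + `|m| * 2 + 1 by rewrite /K; ring.
  by rewrite lerDl.
move=> a /he[h1 h2]; rewrite /v.
have e1 : lmul (K^-1 *: (m - memb (lmul m e))) a = K^-1 *: (lmul m a - lmul m e ** a).
  by rewrite /= scaleN1r.
have e2 : rmul (K^-1 *: (m - memb (lmul m e))) a = K^-1 *: (rmul m a - a ** lmul m e).
  by rewrite /= scaleN1r.
by rewrite e1 e2 !normrZ ger0_norm // !ltr_pdivrMl // mulrC.
Qed.

Lemma strict_ext (B : cstarType R) (F G : 'M(A) -> 'M(B)) : linear F -> linear G ->
  strict_on_ball id F -> strict_on_ball id G ->
  (forall a, F (memb a) = G (memb a)) -> F =1 G.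
Proof.
move=> lF lG sF sG FG m; apply: multiplier_lext => b.
have FA := aunit_proper T A.
have h1 := @strict_cvg B F lF sF m b; have h2 := @strict_cvg B G lG sG m b.
rewrite (_ : (fun _ => _) = (fun e => lmul (F (memb (lmul m e))) b)) in h2; last first.
  by apply/funext => e; rewrite FG.
exact: (@cvg_unique _ (@norm_hausdorff _ B) _ _ _ _ h1 h2).
Qed.

End Limits.

(** * Extension of a strict homomorphism to multipliers *)

Section Mext.
Variables (A B : cstarType R) (f : A -> 'M(B)).
Hypotheses (hf : is_star_hom f) (f0 : forall b, strict0_at (@memb R A) f b).

Let FA : ProperFilter (@aunit R A) := aunit_proper T A.
#[local] Existing Instance FA.
Let fl : linear f. Proof. by case: hf. Qed.
Let fM a b : f (a ** b) = f a ** f b. Proof. by case: hf. Qed.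
Let fs a : f (star a) = star (f a). Proof. by case: hf. Qed.
Let bf : blin f := blin_star_hom T hf.

Let f_le a b : `|lmul (f a) b| <= `|a| * `|b|.
Proof.
rewrite (le_trans (le_mnorm _ _)) // ler_wpM2r //; exact: (star_hom_le T hf).
Qed.

(** The extension at [m] is the strict limit of [f (m e)], and strict continuity makes this family
    Cauchy after scaling by [4 |m| + 1], a bound for the differences. The rule sending [f(a) b] to
    [f(m a) b] would not suffice, since [f] may be degenerate. *)
Let Lcvg (m : 'M(A)) (b : B) : cvg ((fun e => lmul (f (lmul m e)) b) @ @aunit R A).
Proof.
apply: cauchy_cvg; apply: cauchy_exP => d d0.
pose K := 4 * `|m| + 1.
have K0 : 0 < K by rewrite ltr_wpDl // mulr_ge0.
have [s [c [c0 hs]]] := f0 b (divr_gt0 d0 K0).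
have c2 : 0 < c * K / 2 by rewrite divr_gt0 ?mulr_gt0.
have N := aunit_small m s c2.
have [e0 [ue0 he0]] := filter_ex N.
exists (lmul (f (lmul m e0)) b); apply: (@filterS _ (@aunit R A) _ _ _ _ N) => e [ue he].
rewrite -ball_normE /ball_ /=.
pose v := K^-1 *: (lmul m e0 - lmul m e).
have KV : 0 <= K^-1 by rewrite invr_ge0 ltW.
have Fv : f (lmul m e0) - f (lmul m e) = K *: f v.
  by rewrite (linZ fl) (linB fl) scalerA mulfV ?gt_eqF // scale1r.
rewrite -lmulB Fv [lmul _ _]/= normrZ (gtr0_norm K0) mulrC -ltr_pdivlMr //.
have dist (x y z : A) : `|x - y| < c * K / 2 -> `|x - z| < c * K / 2 -> `|y - z| < c * K.
  move=> h1 h2; rewrite -(subrKA x) (splitr (c * K)) (le_lt_trans (ler_normD _ _)) //.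
  by rewrite ltrD // distrC.
apply: hs.
  rewrite normrZ ger0_norm // ler_pdivrMl // mulr1 (le_trans (ler_normB _ _)) //.
  have h e' : near_unit e' -> `|lmul m e'| <= `|m| * 2.
    move=> ue'; rewrite (le_trans (le_mnorm m e')) // ler_wpM2l ?mnorm_ge0 //.
    exact: near_unit_norm.
  rewrite (le_trans (lerD (h _ ue0) (h _ ue))) //.
  have -> : K = `|m| * 2 + `|m| * 2 + 1 by rewrite /K; ring.
  by rewrite lerDl.
move=> a sa; have [h1 h2] := he0 a sa; have [h3 h4] := he a sa.
rewrite /= /v amulZl amulZr amulBl amulBr !normrZ ger0_norm // !ltr_pdivrMl //.
by rewrite [K * c]mulrC; split; [exact: dist h1 h3|exact: dist h2 h4].
Qed.

Let L (m : 'M(A)) (b : B) : B := lim ((fun e => lmul (f (lmul m e)) b) @ @aunit R A).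

Let LP m b : (fun e => lmul (f (lmul m e)) b) @ @aunit R A --> L m b.
Proof. exact: Lcvg. Qed.

Let Lle m b : `|L m b| <= 2 * `|m| * `|b|.
Proof.
apply: (norm_le_cvg FA (@LP m b)); apply: filterS (aunit_near A) => e ue.
rewrite (le_trans (f_le _ _)) // ler_wpM2r // mulrC (le_trans (le_mnorm m e)) //.
by rewrite ler_wpM2l ?mnorm_ge0 // near_unit_norm.
Qed.

Let lim_eq (u : A -> B) (x y : B) : u @ @aunit R A --> x -> u @ @aunit R A --> y -> x = y.
Proof. move=> h1 h2; exact: (@cvg_unique _ (@norm_hausdorff _ B) _ _ _ _ h1 h2). Qed.

Let Llinb m : linear (L m).
Proof.
move=> k x y; apply: (lim_eq (@LP m (k *: x + y))).
rewrite (_ : (fun _ => _) = (fun e => k *: lmul (f (lmul m e)) x + lmul (f (lmul m e)) y)).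
  by apply: cvgD; [apply: cvgZl_tmp; exact: LP|exact: LP].
by apply/funext => e; rewrite linearP.
Qed.

Let Llinm b : linear (L^~ b).
Proof.
move=> k m n; apply: (lim_eq (@LP (k *: m + n) b)).
rewrite (_ : (fun _ => _) = (fun e => k *: lmul (f (lmul m e)) b + lmul (f (lmul n e)) b)).
  by apply: cvgD; [apply: cvgZl_tmp; exact: LP|exact: LP].
by apply/funext => e; rewrite -[lmul (_ + _) e]/(k *: lmul m e + lmul n e) fl.
Qed.

Let Lmemb a b : L (memb a) b = lmul (f a) b.
Proof.
apply: (lim_eq (@LP (memb a) b)).
exact: (blin_cvg FA (blin_comp (blin_lmul_at b) bf) (@aunit_cvgr R T A a)).
Qed.

Let fL x m b : lmul (f x) (L m b) = lmul (f (rmul m x)) b.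
Proof.
apply: (lim_eq (blin_cvg FA (blin_lmul (f x)) (@LP m b))).
rewrite (_ : _ \o _ = (fun e => lmul (f (rmul m x ** e)) b)); last first.
  by apply/funext => e /=; rewrite -lrmul fM.
exact: (blin_cvg FA (blin_comp (blin_lmul_at b) bf) (@aunit_cvgr R T A (rmul m x))).
Qed.

(** [L m b] is a limit of vectors [lmul (f a) b], on which the approximate unit acts as the identity
    in the limit. With [fL] this yields multiplicativity; [star e] is used because its adjoint is
    the [e] in the limit defining [L (star m)]. *)
Let Lunit m b : (fun e => lmul (f (star e)) (L m b)) @ @aunit R A --> L m b.
Proof.
apply/cvgrPdist_lt => d d0; have d6 : 0 < d / 6 by rewrite divr_gt0.
have /cvgrPdist_lt/(_ _ d6) h := @LP m b.
have [e0 he0] := filter_ex h.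
have /cvgrPdist_lt/(_ _ d6) h2 : (fun e => lmul (f (star e)) (lmul (f (lmul m e0)) b))
    @ @aunit R A --> lmul (f (lmul m e0)) b.
  rewrite (_ : (fun _ => _) = (fun x => lmul (f x) b) \o (fun e => star e ** lmul m e0)).
    apply: (blin_cvg FA (blin_comp (blin_lmul_at b) bf)).
    rewrite -[X in _ --> X]starK (_ : (fun _ => _) = (@star R A) \o (fun e => star (lmul m e0) ** e)).
      apply: (@cvg_comp _ _ _ _ (@star R A)); first exact: (@aunit_cvgr R T A).
      exact: star_continuous.
    by apply/funext => e /=; rewrite starM starK.
  by apply/funext => e /=; rewrite fM.
apply: filterS2 h2 (aunit_near A) => e he ue.
set y := lmul (f (lmul m e0)) b in he0 he.
have -> : L m b - lmul (f (star e)) (L m b) =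
   (L m b - y) + ((y - lmul (f (star e)) y) + lmul (f (star e)) (y - L m b)).
  by rewrite linearB addrA !subrKA.
have -> : d = d / 6 + (d / 6 + 4 * (d / 6)) by field.
rewrite (le_lt_trans (ler_normD _ _)) // ltrD // (le_lt_trans (ler_normD _ _)) // ltrD //.
rewrite (le_lt_trans (f_le _ _)) // norm_star distrC.
apply: (@le_lt_trans _ _ (2 * `|L m b - y|)); first by rewrite ler_wpM2r // near_unit_norm.
apply: (@le_lt_trans _ _ (4 * `|L m b - y|)); first by rewrite ler_wpM2r // ler_nat.
by rewrite ltr_pM2l.
Qed.

Let LM m n b : L (m ** n) b = L m (L n b).
Proof.
apply: (lim_eq (@Lunit (m ** n) b)).
rewrite (_ : (fun _ => _) = (fun e => lmul (f (star e)) (L m (L n b)))); first exact: Lunit.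
by apply/funext => e; rewrite !fL.
Qed.

Let Ladj m (c b : B) : star c ** L m b = star (L (star m) c) ** b.
Proof.
have h1 : (fun e => star c ** lmul (f (rmul m (star e))) b) @ @aunit R A --> star c ** L m b.
  rewrite (_ : (fun _ => _) = (fun y => star c ** y) \o (fun e => lmul (f (star e)) (L m b))).
    by apply: (blin_cvg FA (blin_mull _)); exact: Lunit.
  by apply/funext => e /=; rewrite fL.
apply: (lim_eq h1).
rewrite (_ : (fun _ => _) = (fun y => y ** b) \o (@star R B \o (fun e => lmul (f (lmul (star m) e)) c))).
  apply: (blin_cvg FA (blin_mulr _)).
  apply: (@cvg_comp _ _ _ _ (@star R B)); first exact: LP.
  exact: star_continuous.
apply/funext => e /=.
by rewrite star_lmul -fs starK -lrmul.
Qed.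

Fact mext_multiplier m : is_multiplier (L m) (fun b => star (L (star m) (star b))).
Proof.
have bL n : blin (L n) by split=> //; exists (2 * `|n|) => b; exact: Lle.
split.
- by split=> //; case: (blin_star_star (bL (star m))).
- by split; [case: (bL m)|case: (blin_star_star (bL (star m)))].
- move=> a b; apply: (lim_eq (@LP m (a ** b))).
  rewrite (_ : (fun _ => _) = (fun y => y ** b) \o (fun e => lmul (f (lmul m e)) a)).
    by apply: (blin_cvg FA (blin_mulr _)); exact: LP.
  by apply/funext => e /=; rewrite lmulM.
- move=> a b; apply: (can_inj (@starK _ B)); rewrite !starM !starK.
  apply: (lim_eq (@LP (star m) _)).
  rewrite (_ : (fun _ => _) = (fun y => y ** star a) \o (fun e => lmul (f (lmul (star m) e)) (star b))).
    by apply: (blin_cvg FA (blin_mulr _)); exact: LP.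
  by apply/funext => e /=; rewrite lmulM.
- by move=> a b; rewrite -{1}[a]starK Ladj.
Qed.

Lemma mext_exists : exists F : 'M(A) -> 'M(B),
  [/\ is_star_hom F, forall a, F (memb a) = f a & strict_on_ball id F].
Proof.
pose F m := Multiplier (mext_multiplier m).
have lF : linear F by move=> k m n; apply: multiplier_lext => b; exact: Llinm.
have sF m : F (star m) = star (F m) by apply: multiplier_lext => b; rewrite /= !starK.
have F0 b : strict0_at id F b.
  move=> d d0; have d4 : 0 < d / 4 by rewrite divr_gt0.
  have [s [c [c0 hs]]] := f0 b d4.
  exists s, c; split=> // m m1 hm.
  apply: (@le_lt_trans _ _ (d / 2)); last by rewrite ltr_pdivrMr // ltr_pMr // ltr1n.
  apply: (norm_le_cvg FA (@LP m b)).
  apply: filterS (aunit_small m s c0) => e [ue he].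
  have -> : lmul m e = 2 *: (2^-1 *: lmul m e) by rewrite scalerA mulfV ?pnatr_eq0 // scale1r.
  rewrite (linZ fl) [lmul _ _]/= normrZ ger0_norm // mulrC -ler_pdivlMr //.
  have -> : d / 2 / 2 = d / 4 by field.
  apply: ltW; apply: hs.
    rewrite normrZ ger0_norm ?invr_ge0 // ler_pdivrMl // mulr1 (le_trans (le_mnorm m e)) //.
    by rewrite -[leRHS]mul1r ler_pM ?mnorm_ge0 // near_unit_norm.
  move=> a sa; have [h1 h2] := he a sa; have [h3 h4] := hm a sa.
  rewrite /= amulZl amulZr !normrZ !ger0_norm ?invr_ge0 // !ltr_pdivrMl //.
  rewrite mulr_natl mulr2n; split.
    rewrite -[X in `|X|](subrK (lmul m a)) (le_lt_trans (ler_normD _ _)) //.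
    by rewrite ltrD // distrC.
  rewrite -[X in `|X|](subrK (rmul m a)) (le_lt_trans (ler_normD _ _)) //.
  by rewrite ltrD // distrC.
exists F; split.
- split=> //; by move=> m n; apply: multiplier_lext => b; exact: LM.
- by move=> a; apply: multiplier_lext => b; exact: Lmemb.
- apply: (@strict0_strict A B 'M(A) id F F (@star R _)) => //.
  exact: norm_star.
Qed.

End Mext.

Section StrictHom.
Variables (A B : cstarType R) (f : A -> 'M(B)).

Lemma strict_hom0 : is_strict_hom f -> forall b, strict0_at (@memb R A) f b.
Proof.
move=> [hf sf] b; apply: (strict_strict0 b (@memb_linear _ _) _ sf).
by case: hf.
Qed.

Lemma strict0_hom : is_star_hom f -> (forall b, strict0_at (@memb R A) f b) ->
  is_strict_hom f.
Proof.
move=> hf f0; split=> //; have [fl _ fs] := hf.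
by apply: (@strict0_strict A B A (@memb R A) f f (@star R _)) => //;
  [exact: memb_linear|exact: memb_star|exact: norm_star].
Qed.

Lemma mextP : is_strict_hom f ->
  [/\ is_star_hom (mext f), forall a, mext f (memb a) = f a & strict_on_ball id (mext f)].
Proof.
move=> sf; have [hf _] := sf; have [F FP] := mext_exists hf (strict_hom0 sf).
exact: (@xgetPex _ ((fun=> 0) : 'M(A) -> 'M(B)) [set F | [/\ is_star_hom F,
  forall a, F (memb a) = f a & strict_on_ball id F]] (ex_intro _ F FP)).
Qed.

(** On the total vectors [lmul (f a) b] one has [f v f a b = f (v a) b], which is small as soon as
    [|v ** a|] is. *)
Lemma nondegenerate_strict : is_star_hom f -> nondegenerate f -> is_strict_hom f.
Proof.
move=> hf nf; apply: strict0_hom => //.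
have [fl fM fs] := hf.
have nT : clspan (range (fun x : A * B => lmul (f x.1) x.2)) = setT.
  rewrite -nf; congr clspan; apply/seteqP; split=> y /=.
    by move=> [[a b] _ <-]; exists a, b.
  by move=> [a [b ->]]; exists (a, b).
apply: (strict0_total nT (M := 1)) => // [v|[a b] e e0] /=.
  by rewrite mul1r; exact: (star_hom_le T hf).
have b1 : 0 < `|b| + 1 by rewrite ltr_wpDl.
exists [:: a], (e / (`|b| + 1)); split; first by rewrite divr_gt0.
move=> v v1 /(_ a); rewrite inE eqxx => /(_ isT)[h _].
rewrite -[lmul _ _]/(lmul (f v ** f a) b) -fM.
rewrite (le_lt_trans (le_mnorm _ _)) //.
apply: (@le_lt_trans _ _ (`|v ** a| * (`|b| + 1))); last by rewrite -ltr_pdivlMr.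
apply: ler_pM => //; [exact: mnorm_ge0|exact: (star_hom_le T hf)|by rewrite lerDl].
Qed.

Lemma mext_mul : is_strict_hom f -> forall m a, mext f m ** f a = f (lmul m a).
Proof.
move=> sf m a; have [[_ FM _] Fm _] := mextP sf.
by rewrite -Fm -FM mul_memb Fm.
Qed.

Lemma mext_lmul : is_strict_hom f -> forall m a b,
  lmul (mext f m) (lmul (f a) b) = lmul (f (lmul m a)) b.
Proof. by move=> sf m a b; rewrite -(mext_mul sf). Qed.

Lemma mext_eq (m : 'M(A)) (n : 'M(B)) : is_star_hom f -> nondegenerate f ->
  (forall a b, lmul n (lmul (f a) b) = lmul (f (lmul m a)) b) -> mext f m = n.
Proof.
move=> hf nf h; have sf := nondegenerate_strict hf nf.
apply: multiplier_lext; apply: (blin_eq nf (blin_lmul _) (blin_lmul _)).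
by move=> _ [a [b ->]]; rewrite h mext_lmul.
Qed.

End StrictHom.
End Strict.

(** * Slice maps *)

Section Duals.
Variables (R : realType) (T : tensor_products R) (A : cstarType R).
Local Notation C := R[i].

Lemma dual_of (f : A -> C^o) : blin f -> exists w : dual A, forall a, w a = f a.
Proof.
move=> [lf bf].
pose g : {linear A -> C^o} := HB.pack f (GRing.isLinear.Build C A C^o *:%R f lf).
have cg : continuous g by exact: blin_continuous.
by exists (Dual cg).
Qed.

Lemma dual_blin (w : dual A) : blin (fun a => w a : C^o).
Proof. by split; [exact: linearP|have [M _ h] := dual_bounded w; exists M]. Qed.

Lemma phase (z : C) : exists2 u : C, `|u| = 1 & u * z = `|z|.
Proof.
have [->|z0] := eqVneq z 0; first by exists 1; rewrite ?normr1 // mul1r normr0.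
exists (z^* / `|z|); first by rewrite normrM norm_conjC normfV normr_id mulfV // normr_eq0.
by rewrite mulrAC [z^* * _]mulrC -normCK expr2 mulfK // normr_eq0.
Qed.

(* If [w] almost attains its norm at [x] and [x e] is close to [x], then [w]
   is small on [y - y e], because [|x + t (y - y e)|^2 <= 1 + 3 t^2]. *)
Lemma dual_approx (w : dual A) (e : C) : 0 < e ->
  exists a, near_unit a /\ forall y, `|w y - w (y ** a)| <= e * `|y|.
Proof.
move=> e0; have [M M0 wM] := dual_bounded w.
have [wl _] := dual_blin w.
pose S := [set complex.Re (w x : C) | x in [set x : A | `|x| <= 1]].
have Sub : has_ubound S.
  exists (complex.Re M) => _ [x /= x1 <-].
  rewrite -lecR [X in _ <= X]ReK // (@le_trans _ _ `|w x : C|) //.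
    rewrite (le_trans _ (normc_ge_Re _)) // lecR; exact: ler_norm.
  by rewrite (le_trans (wM x)) // -[leRHS]mulr1 ler_wpM2l.
have S0 : S !=set0 by exists (complex.Re (w 0 : C)), 0; rewrite //= normr0.
pose W := sup S.
have W0 : 0 <= W.
  by apply: (ub_le_sup Sub); exists 0; rewrite /= ?normr0 // (lin0 wl).
have hW x : complex.Re (w x : C) <= W * complex.Re `|x|.
  have [->|x0] := eqVneq x 0; first by rewrite (lin0 wl) normr0 /= mulr0.
  have nx : 0 < `|x| by rewrite normr_gt0.
  have nR : `|x| = (complex.Re `|x|)%:C%C by rewrite ReK.
  have nxR : 0 < complex.Re `|x| by rewrite -ltcR -nR.
  have : complex.Re (w (`|x|^-1 *: x) : C) <= W.
    by apply: (ub_le_sup Sub); exists (`|x|^-1 *: x); rewrite //= normfZV.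
  rewrite (linZ wl) -[_ *: _]/(_ * _).
  have -> : `|x|^-1 = ((complex.Re `|x|)^-1)%:C%C.
    apply: (mulfI (_ : `|x| != 0)); first by rewrite gt_eqF.
    by rewrite mulfV ?gt_eqF // {1}nR -rcM mulfV ?gt_eqF.
  have -> : forall (r : R) (z : C), complex.Re (r%:C%C * z) = r * complex.Re z.
    by move=> r [z1 z2] /=; rewrite mul0r subr0.
  by rewrite mulrC ler_pdivrMr.
have eR : e = (complex.Re e)%:C%C by rewrite ReK // ltW.
have eR0 : 0 < complex.Re e by rewrite -ltcR -eR.
have W1 : 0 < 2 * W + 1 by rewrite ltr_wpDl // mulr_ge0.
(* From [W - t^2 < Re w(x)] and [Re w(x) + t Re w(v) <= W (1 + 2 t^2)] follows
   [Re w(v) <= t (2 W + 1)]; this choice of [t] makes the bound equal to [e]. *)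
pose t : R := complex.Re e / (2 * W + 1).
have t0 : 0 < t by rewrite divr_gt0.
have [_ [x /= x1 <-] wx] := sup_adherent (exprn_gt0 2 t0) (conj S0 Sub).
have tc0 : 0 < t%:C%C by rewrite ltcR.
have [a [ua sa xa]] := single_near_unit T x tc0.
exists a; split=> //.
have key y : `|y| <= 1 -> complex.Re (w (y - y ** a) : C) <= complex.Re e.
  move=> y1; set v := y - y ** a.
  have v1 : `|v| <= 1 by rewrite (le_trans (ua y).1).
  have xv : `|x ** star v| <= t%:C%C.
    rewrite /v starB starM sa amulBr amulA -amulBl (le_trans (norm_amul _ _)) //.
    by rewrite norm_star -[leRHS]mulr1 ler_pM.
  have nz : `|x + t%:C%C *: v| <= (1 + 2 * t ^+ 2)%:C%C.
    have u0 : 0 <= (1 + 2 * t ^+ 2)%:C%C.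
      by rewrite lecR addr_ge0 // mulr_ge0 // exprn_ge0 // ltW.
    rewrite -(@ler_pXn2r _ 2) ?nnegrE // -cstar_norm_r starD starZ.
    have -> : (t%:C%C : C)^* = t%:C%C := conj_Creal (ger0_real (ltW tc0)).
    rewrite amulDr !amulDl !amulZr !amulZl.
    have h1 : `|x ** star x| <= 1 by rewrite cstar_norm_r expr_le1.
    have h2 : `|t%:C%C *: (v ** star x)| <= (t ^+ 2)%:C%C.
      rewrite normrZ (gtr0_norm tc0) expr2 rcM ler_pM2l //.
      by rewrite -norm_star starM starK.
    have h3 : `|t%:C%C *: (x ** star v)| <= (t ^+ 2)%:C%C.
      by rewrite normrZ (gtr0_norm tc0) expr2 rcM ler_pM2l.
    have h4 : `|t%:C%C *: (t%:C%C *: (v ** star v))| <= (t ^+ 2)%:C%C.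
      rewrite scalerA -rcM -expr2 normrZ ger0_norm; last by rewrite lecR exprn_ge0 // ltW.
      rewrite ler_piMr //; first by rewrite lecR exprn_ge0 // ltW.
      by rewrite cstar_norm_r expr_le1.
    apply: (@le_trans _ _ (1 + 3 * t ^+ 2)%:C%C).
      rewrite (le_trans (ler_normD _ _)) // (le_trans (lerD (ler_normD _ _) (ler_normD _ _))) //.
      rewrite (le_trans (lerD (lerD h1 h2) (lerD h3 h4))) //.
      by rewrite -[1]/(1%:C%C) -!rcD lecR le_eqVlt; apply/orP; left; apply/eqP; ring.
    rewrite [X in _ <= X]expr2 -rcM lecR -subr_ge0.
    have -> : (1 + 2 * t ^+ 2) * (1 + 2 * t ^+ 2) - (1 + 3 * t ^+ 2) = t ^+ 2 + 4 * (t ^+ 2) ^+ 2 by ring.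
    have t2 : 0 <= t ^+ 2 by rewrite exprn_ge0 // ltW.
    by rewrite addr_ge0 // mulr_ge0 // exprn_ge0.
  have nzR : complex.Re `|x + t%:C%C *: v| <= 1 + 2 * t ^+ 2.
    by rewrite -lecR ReK.
  have := le_trans (hW (x + t%:C%C *: v)) (ler_wpM2l W0 nzR).
  rewrite (linD wl) (linZ wl) -[_ *: _]/(_ * _).
  have -> : complex.Re ((w x : C) + t%:C%C * (w v : C)) =
      complex.Re (w x : C) + t * complex.Re (w v : C).
    by case: (w x : C) => a1 a2; case: (w v : C) => b1 b2 /=; rewrite mul0r subr0.
  move=> h; have {}h : t * complex.Re (w v : C) <= t * complex.Re e.
    have te : complex.Re e = t * (2 * W + 1) by rewrite /t mulfVK // gt_eqF.
    have := lerD (ltW wx) h; rewrite {1}/W -/W te; rewrite -subr_ge0 => h'.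
    rewrite -subr_ge0 (le_trans h') // le_eqVlt; apply/orP; left; apply/eqP.
    rewrite /W; ring.
  by rewrite ler_pM2l in h.
move=> y; have [->|y0] := eqVneq y 0; first by rewrite amul0l subrr normr0 mulr_ge0 // ltW.
have ny : 0 < `|y| by rewrite normr_gt0.
rewrite -ler_pdivrMr // mulrC.
have [u u1 uz] := phase (w (y - y ** a)).
pose y' := (u / `|y|) *: y.
have y'1 : `|y'| <= 1.
  by rewrite normrZ normrM u1 mul1r normfV normr_id mulVf // gt_eqF.
have := key y' y'1.
have -> : y' - y' ** a = (u / `|y|) *: (y - y ** a) by rewrite amulZl scalerBr.
rewrite (linZ wl) -[_ *: _]/(_ * _) mulrAC uz (linB wl) [X in complex.Re X]mulrC.
have h : 0 <= `|y|^-1 * `|w y - w (y ** a)| by rewrite mulr_ge0 ?invr_ge0.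
by move=> h'; rewrite -(ReK h) eR lecR.
Qed.

End Duals.

Section Slices.
Variables (R : realType) (T : tensor_products R).
Local Notation C := R[i].
Local Notation "A ⊗ B" := (ctens T A B) (at level 40, left associativity).
Local Notation "a ⊠ b" := (etens T a b) (at level 40, left associativity).

Lemma rmul_lmul (A : cstarType R) (m n : 'M(A)) a : rmul n (lmul m a) = lmul m (rmul n a).
Proof. by apply: memb_inj; rewrite -memb_mul -mul_memb -[RHS]mul_memb -memb_mul amulA. Qed.

Section Two.
Variables (A B : cstarType R).
Local Notation S w := (@slice0 R T A B w).

Lemma slice0_rmul (w : dual B) (n : 'M(A)) z :
  S w (rmul (mtens T n (mone B)) z) = rmul n (S w z).
Proof.
move: z; apply: tens_ext.
- exact: (blin_comp (blin_slice0 T A w) (blin_rmul _)).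
- exact: (blin_comp (blin_rmul _) (blin_slice0 T A w)).
- by move=> a b; rewrite mtensr !slice0E linearZ.
Qed.

Lemma slice0_lmul (w : dual B) (n : 'M(A)) z :
  S w (lmul (mtens T n (mone B)) z) = lmul n (S w z).
Proof.
move: z; apply: tens_ext.
- exact: (blin_comp (blin_slice0 T A w) (blin_lmul _)).
- exact: (blin_comp (blin_lmul _) (blin_slice0 T A w)).
- by move=> a b; rewrite mtensl !slice0E linearZ.
Qed.

(** The difference is the slice by the functional [w - w(. a)], which has norm at most [e]; slicing
    is bounded by the norm of the functional. *)
Lemma slice0_approx (w : dual B) (e : C) : 0 < e -> exists a, near_unit a /\
  forall z, `|S w z - S w (rmul (leg T A a) z)| <= e * `|z|.
Proof.
move=> e0; have [a [ua ha]] := dual_approx T w e0; exists a; split=> //.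
have [v hv] : exists v : dual B, forall b, v b = (w b : C) - w (b ** a).
  have bw := dual_blin w.
  have b2 := blin_comp bw (blin_mulr a).
  have := @dual_of R B (fun b => (w b : C^o) + (-1) *: (w (b ** a) : C^o)) (blinD bw (blinZ (-1) b2)).
  by move=> [v hv]; exists v => b; rewrite hv scaleN1r.
move=> z; have -> : S w z - S w (rmul (leg T A a) z) = S v z.
  move: z; apply: tens_ext.
  - rewrite (_ : (fun _ => _) = (fun z => S w z + (-1) *: S w (rmul (leg T A a) z))).
      apply: blinD; first exact: blin_slice0.
      apply: blinZ; exact: (blin_comp (blin_slice0 T A w) (blin_rmul _)).
    by apply/funext => z; rewrite scaleN1r.
  - exact: blin_slice0.
  - by move=> x b; rewrite mtensr !slice0E hv scalerBl.
apply: slice0_le; first exact: ltW.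
by move=> b; rewrite hv.
Qed.

Let FB : ProperFilter (@aunit R B) := aunit_proper T B.
#[local] Existing Instance FB.

Lemma leg_cvg_star z : (fun e => lmul (leg T A (star e)) z) @ @aunit R B --> z.
Proof.
move: z; apply: (@strong_cvg C (A ⊗ B) _ _ (@aunit R B) (fun e => lmul (leg T A (star e))) _ 2 _ (etens_total T A B)) => //.
- by move=> e; exact: (blin_lmul _).1.
- apply: filterS (aunit_near B) => e ue z; rewrite (le_trans (le_mnorm _ _)) //.
  rewrite ler_wpM2r // (le_trans (mtens_norm _ _ _)) // memb_norm norm_star.
  by rewrite -[leRHS]mul1r ler_pM ?mone_norm // near_unit_norm.
- move=> [a b] /=; rewrite (_ : (fun _ => _) = (fun b' => a ⊠ b') \o (@star R B \o (fun e => star b ** e))).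
    apply: (blin_cvg FB (@blin_etensr R T A B a)).
    rewrite -[X in _ --> X]starK; apply: (@cvg_comp _ _ _ _ (@star R B)).
      exact: (@aunit_cvgr R T B).
    exact: star_continuous.
  by apply/funext => e; rewrite mtensl /= starM starK.
Qed.

Lemma leg_cvgr z : (fun e => rmul (leg T A e) z) @ @aunit R B --> z.
Proof.
rewrite -[X in _ --> X]starK (_ : (fun _ => _) = @star R _ \o (fun e => lmul (leg T A (star e)) (star z))).
  by apply: (@cvg_comp _ _ _ _ (@star R _)); [exact: leg_cvg_star|exact: star_continuous].
apply/funext => e /=; rewrite star_lmul starK; congr (rmul _ z).
by rewrite /leg mtens_star star1 -memb_star starK.
Qed.

Section Functional.
Variable w : dual B.

Let slice0_aunit_mul (m : 'M(A ⊗ B)) x a :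
  (fun e => S w (lmul m (x ⊠ (e ** a)))) @ @aunit R B --> S w (lmul m (x ⊠ a)).
Proof.
have b1 : blin (fun b : B => S w (lmul m (x ⊠ b))) :=
  blin_comp (blin_slice0 T A w) (blin_comp (blin_lmul m) (@blin_etensr R T A B x)).
exact: (@blin_cvg C B A _ B (@aunit R B) (fun e => e ** a) a FB b1 (@aunit_cvgl R T B a)).
Qed.

(** Up to a small error, uniform in [e], [w] may be replaced by [w(. a)]. This turns [x ⊠ e] into
    [x ⊠ (e ** a)], which converges to [x ⊠ a]. *)
Let Lcvg (m : 'M(A ⊗ B)) (x : A) : cvg ((fun e => S w (lmul m (x ⊠ e))) @ @aunit R B).
Proof.
apply: cauchy_cvg; apply: cauchy_exP => d d0.
have K0 : 0 < 2 * `|m| * `|x| + 1 by rewrite ltr_wpDl // !mulr_ge0.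
have d2 := divr_gt0 d0 (ltr0n _ 2).
have [a [ua ha]] := slice0_approx w (divr_gt0 d2 K0).
exists (S w (lmul m (x ⊠ a))).
have c1 : (fun e => S w (lmul m (x ⊠ (e ** a)))) @ @aunit R B --> S w (lmul m (x ⊠ a)).
  exact: slice0_aunit_mul.
have /cvgrPdist_lt/(_ _ d2) c2 := c1.
apply: (@filterS2 _ (@aunit R B) _ _ _ _ _ (aunit_near B) c2) => e ue he.
rewrite -ball_normE /ball_ /= (splitr d) -(subrKA (S w (lmul m (x ⊠ (e ** a))))).
rewrite (le_lt_trans (ler_normD _ _)) // ltr_leD // distrC.
have -> : lmul m (x ⊠ (e ** a)) = rmul (leg T A a) (lmul m (x ⊠ e)).
  by rewrite rmul_lmul mtensr.
rewrite (le_trans (ha _)) // mulrAC ler_pdivrMr // ler_wpM2l ?(ltW d2) //.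
rewrite (le_trans (le_mnorm _ _)) // (le_trans (ler_wpM2l (mnorm_ge0 m) (norm_etens_le _ _ _))) //.
rewrite (le_trans (ler_wpM2l (mnorm_ge0 m) (ler_wpM2l (normr_ge0 x) (near_unit_norm ue)))) //.
rewrite -[mnorm m]/(`|m|) (_ : `|m| * (`|x| * 2) = 2 * `|m| * `|x|) ?lerDl //.
by ring.
Qed.

(** The left action of the slice of [m]: the slice of [m (x ⊗ 1)], with the second leg of [x ⊗ 1]
    replaced by the approximate unit. *)
Definition slice_lim (m : 'M(A ⊗ B)) (x : A) : A :=
  lim ((fun e => S w (lmul m (x ⊠ e))) @ @aunit R B).

Lemma slice_lim_cvg m x : (fun e => S w (lmul m (x ⊠ e))) @ @aunit R B --> slice_lim m x.
Proof. exact: Lcvg. Qed.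

Let lim_eq (u : B -> A) (x y : A) : u @ @aunit R B --> x -> u @ @aunit R B --> y -> x = y.
Proof. move=> h1 h2; exact: (@cvg_unique _ (@norm_hausdorff _ A) _ _ _ _ h1 h2). Qed.

Let bS m e : blin (fun x => S w (lmul m (x ⊠ e))).
Proof. exact: (blin_comp (blin_slice0 T A w) (blin_comp (blin_lmul m) (@blin_etensl R T A B e))). Qed.

Lemma slice_lim_linx m : linear (slice_lim m).
Proof.
move=> k x y; apply: (lim_eq (@slice_lim_cvg m (k *: x + y))).
rewrite (_ : (fun _ => _) = (fun e => k *: S w (lmul m (x ⊠ e)) + S w (lmul m (y ⊠ e)))).
  by apply: cvgD; [apply: cvgZl_tmp; exact: slice_lim_cvg|exact: slice_lim_cvg].
by apply/funext => e; rewrite (bS m e).1.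
Qed.

Lemma slice_lim_linm x : linear (slice_lim^~ x).
Proof.
move=> k m n; apply: (lim_eq (@slice_lim_cvg (k *: m + n) x)).
rewrite (_ : (fun _ => _) = (fun e => k *: S w (lmul m (x ⊠ e)) + S w (lmul n (x ⊠ e)))).
  by apply: cvgD; [apply: cvgZl_tmp; exact: slice_lim_cvg|exact: slice_lim_cvg].
apply/funext => e.
by rewrite -[lmul (_ + _) _]/(k *: lmul m (x ⊠ e) + lmul n (x ⊠ e)) (blin_slice0 T A w).1.
Qed.

Lemma slice_lim_mul m x y : slice_lim m (x ** y) = slice_lim m x ** y.
Proof.
apply: (lim_eq (@slice_lim_cvg m (x ** y))).
rewrite (_ : (fun _ => _) = (fun z => z ** y) \o (fun e => S w (lmul m (x ⊠ e)))).
  by apply: (blin_cvg FB (blin_mulr _)); exact: slice_lim_cvg.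
apply/funext => e /=.
rewrite -[RHS]/(rmul (memb y) _) -slice0_rmul rmul_lmul mtensr //.
Qed.

Lemma slice_lim_le (M : C) m x : 0 <= M -> (forall b, `|w b| <= M * `|b|) ->
  `|slice_lim m x| <= M * (`|m| * (`|x| * 2)).
Proof.
move=> M0 wM; apply: (norm_le_cvg FB (@slice_lim_cvg m x)); apply: filterS (aunit_near B) => e ue.
rewrite (le_trans (slice0_le M0 wM _)) // ler_wpM2l // (le_trans (le_mnorm _ _)) //.
rewrite ler_wpM2l ?mnorm_ge0 // (le_trans (norm_etens_le _ _ _)) // ler_wpM2l //.
exact: near_unit_norm.
Qed.

Lemma slice_lim_approx m x a (e : C) : 0 <= e ->
  (forall z, `|S w z - S w (rmul (leg T A a) z)| <= e * `|z|) ->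
  `|slice_lim m x - S w (lmul m (x ⊠ a))| <= e * (`|m| * (`|x| * 2)).
Proof.
move=> e0 ha.
have c1 : (fun e => S w (lmul m (x ⊠ (e ** a)))) @ @aunit R B --> S w (lmul m (x ⊠ a)).
  exact: slice0_aunit_mul.
have c2 : (fun f => S w (lmul m (x ⊠ f)) - S w (lmul m (x ⊠ (f ** a)))) @ @aunit R B -->
  slice_lim m x - S w (lmul m (x ⊠ a)) := cvgB (@slice_lim_cvg m x) c1.
apply: (norm_le_cvg FB (c2 _)); apply: filterS (aunit_near B) => f uf.
have -> : lmul m (x ⊠ (f ** a)) = rmul (leg T A a) (lmul m (x ⊠ f)).
  by rewrite rmul_lmul mtensr.
rewrite (le_trans (ha _)) // ler_wpM2l // (le_trans (le_mnorm _ _)) //.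
rewrite ler_wpM2l ?mnorm_ge0 // (le_trans (norm_etens_le _ _ _)) // ler_wpM2l //.
exact: near_unit_norm.
Qed.

Lemma slice_lim_memb z x : slice_lim (memb z) x = S w z ** x.
Proof.
apply: (lim_eq (@slice_lim_cvg (memb z) x)).
rewrite (_ : (fun _ => _) = S w \o (fun e => rmul (leg T A e) (rmul (mtens T (memb x) (mone B)) z))).
  rewrite -[X in _ --> X]/(rmul (memb x) _) -slice0_rmul.
  by apply: (blin_cvg FB (blin_slice0 T A w)); exact: leg_cvgr.
apply/funext => e; congr (S w _).
rewrite -[RHS]/(rmul (mtens T (memb x) (mone B) ** leg T A e) z) /leg mtensM mulm1.
by rewrite mul1m mtens_memb.
Qed.

End Functional.

Lemma dual_star (w : dual B) : exists w' : dual B, forall b, w' b = (w (star b) : C)^*.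
Proof.
apply: (@dual_of R B (fun b => (w (star b) : C)^*)).
have [lw [M wM]] := dual_blin w; split.
  by move=> k x y; rewrite starD starZ lw rmorphD rmorphM /= conjCK.
by exists M => b; rewrite norm_conjC -(norm_star b); exact: wM.
Qed.

Section Star.
Variables (w w' : dual B).
Hypothesis ww' : forall b, w' b = (w (star b) : C)^*.

Lemma slice0_star z : S w' (star z) = star (S w z).
Proof.
apply: (can_inj (@starK _ A)); rewrite starK; move: z.
apply: (@tens_ext R T A B A (fun z => star (S w' (star z))) (S w)).
- exact: (blin_star_star (blin_slice0 T A w')).
- exact: blin_slice0.
- by move=> a b; rewrite etens_star !slice0E starZ ww' conjCK !starK.
Qed.

(** Both sides are within a small error of [g = y ** S w (lmul m (x ⊠ a))], where [w(. a)]
    approximates [w]. For the right side, [S w'] is the adjoint of [S w], and [y ⊠ star e] and [x]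
    are multiplied into the tensor. The errors add up to [d / K] times [4 |m| |x| |y|]. *)
Lemma slice_lim_adj m (x y : A) :
  y ** slice_lim w m x = star (slice_lim w' (star m) (star y)) ** x.
Proof.
apply/eqP; rewrite -subr_eq0 -normr_le0; apply/ler_addgt0Pr => d d0; rewrite add0r.
pose K := `|m| * `|x| * `|y| * 4 + 1.
have K0 : 0 < K by rewrite ltr_wpDl // !mulr_ge0.
have dK := divr_gt0 d0 K0.
have [a [ua ha]] := slice0_approx w dK.
pose g := y ** S w (lmul m (x ⊠ a)).
have h1 : `|y ** slice_lim w m x - g| <= `|y| * (d / K * (`|m| * (`|x| * 2))).
  rewrite /g -amulBr (le_trans (norm_amul _ _)) // ler_wpM2l //.
  by apply: slice_lim_approx => //; exact: ltW.
have h2 : `|star (slice_lim w' (star m) (star y)) ** x - g| <= d / K * (`|m| * (`|y| * 2) * `|x|).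
  have c1 : (fun e => star (S w' (lmul (star m) (star y ⊠ e))) ** x) @ @aunit R B -->
      star (slice_lim w' (star m) (star y)) ** x.
    rewrite (_ : (fun _ => _) = (fun z => z ** x) \o (@star R A \o (fun e => S w' (lmul (star m) (star y ⊠ e))))) //.
    apply: (blin_cvg FB (blin_mulr _)).
    by apply: (@cvg_comp _ _ _ _ (@star R A)); [exact: slice_lim_cvg|exact: star_continuous].
  have c2 : (fun e => S w ((y ⊠ star e) ** lmul m (x ⊠ a))) @ @aunit R B --> g.
    rewrite /g -[y ** _]/(lmul (memb y) _) -slice0_lmul.
    rewrite (_ : (fun _ => _) = (S w \o lmul (mtens T (memb y) (mone B))) \o (fun e => lmul (leg T A (star e)) (lmul m (x ⊠ a)))).
      apply: (blin_cvg FB (blin_comp (blin_slice0 T A w) (blin_lmul _))).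
      exact: leg_cvg_star.
    apply/funext => e /=; congr (S w _).
    rewrite -[RHS]/(lmul (mtens T (memb y) (mone B) ** leg T A (star e)) _).
    by rewrite /leg mtensM mulm1 mul1m mtens_memb.
  have c3 : (fun e => star (S w' (lmul (star m) (star y ⊠ e))) ** x -
      S w ((y ⊠ star e) ** lmul m (x ⊠ a))) @ @aunit R B -->
    star (slice_lim w' (star m) (star y)) ** x - g := cvgB c1 c2.
  apply: (norm_le_cvg FB (c3 _)); apply: filterS (aunit_near B) => e ue.
  have -> : star (S w' (lmul (star m) (star y ⊠ e))) = S w (rmul m (y ⊠ star e)).
    have -> : star y ⊠ e = star (y ⊠ star e) by rewrite etens_star starK.
    by rewrite -star_rmul slice0_star starK.
  set z := rmul m (y ⊠ star e).
  have -> : S w z ** x = S w (rmul (mtens T (memb x) (mone B)) z) by rewrite slice0_rmul.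
  have -> : (y ⊠ star e) ** lmul m (x ⊠ a) = rmul (leg T A a) (rmul (mtens T (memb x) (mone B)) z).
    rewrite lrmul -/z -[RHS]/(rmul (mtens T (memb x) (mone B) ** leg T A a) z).
    by rewrite /leg mtensM mulm1 mul1m mtens_memb.
  rewrite (le_trans (ha _)) // ler_wpM2l ?(ltW dK) //.
  rewrite (le_trans (le_mnorm_r _ _)) // mulrC ler_pM ?mnorm_ge0 //.
    rewrite (le_trans (le_mnorm_r _ _)) // ler_wpM2l ?mnorm_ge0 //.
    rewrite (le_trans (norm_etens_le _ _ _)) // ler_wpM2l // norm_star.
    exact: near_unit_norm.
  rewrite (le_trans (mtens_norm _ _ _)) // memb_norm -[leRHS]mulr1.
  by rewrite ler_wpM2l // mone_norm.
rewrite -(subrKA g) (le_trans (ler_normD _ _)) // [`|g - _|]distrC.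
rewrite (le_trans (lerD h1 h2)) //.
have -> : `|y| * (d / K * (`|m| * (`|x| * 2))) + d / K * (`|m| * (`|y| * 2) * `|x|) =
  d / K * (`|m| * `|x| * `|y| * 4) by ring.
by rewrite mulrAC ler_pdivrMr // ler_wpM2l ?(ltW d0) // lerDl.
Qed.

Lemma star_slice_lim (n : 'M(A)) (m : 'M(A ⊗ B)) :
  (forall x, lmul n x = slice_lim w m x) ->
  forall y, lmul (star n) y = slice_lim w' (star m) y.
Proof.
move=> h y; apply: (can_inj (@starK _ A)).
apply/eqP; rewrite -subr_eq0; apply/eqP; apply: amul_eq0r => x; rewrite amulBl.
by rewrite star_lmul starK -lrmul h slice_lim_adj starK subrr.
Qed.
End Star.

Lemma slice_multiplier (w : dual B) : exists F : 'M(A ⊗ B) -> 'M(A),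
  forall m x, lmul (F m) x = slice_lim w m x.
Proof.
have [w' ww'] := dual_star w.
have [M M0 wM] := dual_bounded w; have [M' M0' wM'] := dual_bounded w'.
have bl m : blin (slice_lim w m).
  split; first exact: slice_lim_linx.
  exists (M * (`|m| * 2)) => x; rewrite (le_trans (slice_lim_le _ _ M0 wM)) //.
  by rewrite le_eqVlt; apply/orP; left; apply/eqP; ring.
have bl' m : blin (slice_lim w' m).
  split; first exact: slice_lim_linx.
  exists (M' * (`|m| * 2)) => x; rewrite (le_trans (slice_lim_le _ _ M0' wM')) //.
  by rewrite le_eqVlt; apply/orP; left; apply/eqP; ring.
have P m : is_multiplier (slice_lim w m) (fun x => star (slice_lim w' (star m) (star x))).
  have bs := blin_star_star (bl' (star m)).
  split.
  - by split; [case: (bl m)|case: bs].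
  - by split; [case: (bl m)|case: bs].
  - exact: slice_lim_mul.
  - by move=> a b; apply: (can_inj (@starK _ A)); rewrite !starM !starK slice_lim_mul.
  - by move=> a b; exact: slice_lim_adj.
by exists (fun m => Multiplier (P m)).
Qed.

Lemma slice_strict0 (w : dual B) (F : 'M(A ⊗ B) -> 'M(A)) :
  (forall m x, lmul (F m) x = slice_lim w m x) -> forall x, strict0_at id F x.
Proof.
move=> FE x d d0; have [M M0 wM] := dual_bounded w.
have x1 : 0 < 4 * (`|x| + 1) by rewrite mulr_gt0 // ltr_wpDl.
have [a [ua ha]] := slice0_approx w (divr_gt0 d0 x1).
have M1 : 0 < 2 * (M + 1) by rewrite mulr_gt0 // ltr_wpDl.
exists [:: x ⊠ a], (d / (2 * (M + 1))); split; first by rewrite divr_gt0.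
move=> m m1 /(_ (x ⊠ a)); rewrite inE eqxx => /(_ isT)[hm _].
rewrite FE -[slice_lim w m x](subrK (S w (lmul m (x ⊠ a)))).
rewrite (le_lt_trans (ler_normD _ _)) // (splitr d) ler_ltD //.
  have d1 := ltW (divr_gt0 d0 x1).
  rewrite (le_trans (slice_lim_approx m x d1 ha)) //.
  rewrite mulrAC ler_pdivrMr // (_ : d / 2 * (4 * (`|x| + 1)) = d * ((`|x| + 1) * 2)); last by field.
  rewrite ler_wpM2l ?(ltW d0) // mulrA -[leRHS]mul1r -mulrA.
  by rewrite ler_pM ?mulr_ge0 // ler_wpM2r // lerDl.
rewrite (le_lt_trans (slice0_le M0 wM _)) //.
have Mp : 0 < M + 1 by rewrite ltr_wpDl.
apply: (@le_lt_trans _ _ ((M + 1) * `|lmul m (x ⊠ a)|)); first by rewrite ler_wpM2r // lerDl.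
rewrite mulrC -ltr_pdivlMr //; apply: lt_le_trans hm _.
by rewrite le_eqVlt; apply/orP; left; apply/eqP; field; rewrite gt_eqF.
Qed.

Lemma sliceP (w : dual B) : [/\ linear (@slice R T A B w),
  forall y, @slice R T A B w (memb y) = memb (S w y), strict_on_ball id (@slice R T A B w)
  & forall m x, lmul (@slice R T A B w m) x = slice_lim w m x].
Proof.
have [w' ww'] := dual_star w.
have [F FE] := slice_multiplier w; have [F' FE'] := slice_multiplier w'.
have lF : linear F.
  by move=> k m n; apply: multiplier_lext => x; rewrite FE slice_lim_linm /= !FE.
have sF : strict_on_ball id F.
  apply: (@strict0_strict R _ A 'M(A ⊗ B) id F F' (@star R _)) => //.
  - move=> m; apply: multiplier_lext => x; rewrite FE'.
    by rewrite (star_slice_lim ww' (FE m)).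
  - exact: norm_star.
  - exact: slice_strict0.
  - exact: slice_strict0.
have Fm y : F (memb y) = memb (S w y).
  by apply: multiplier_lext => x; rewrite FE slice_lim_memb.
have [l m s] := @xgetPex _ ((fun=> 0) : 'M(A ⊗ B) -> 'M(A)) [set F | [/\ linear F,
   forall y, F (memb y) = memb (slice0 w y) & strict_on_ball id F]]
   (ex_intro _ F (And3 lF Fm sF)).
rewrite -/(slice w) in l m s.
split=> // n x; rewrite -FE; congr (lmul _ _).
by apply: (strict_ext T) => // z; rewrite m Fm.
Qed.

Lemma slice_linear (w : dual B) : linear (@slice R T A B w).
Proof. by case: (sliceP w). Qed.

Lemma slice_cvg (w : dual B) m x :
  (fun e => S w (lmul m (x ⊠ e))) @ @aunit R B --> lmul (@slice R T A B w m) x.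
Proof. by case: (sliceP w) => _ _ _ ->; exact: slice_lim_cvg. Qed.

Lemma blin_slice (w : dual B) : blin (@slice R T A B w).
Proof.
split; first exact: slice_linear.
have [M M0 wM] := dual_bounded w; exists (M * 2) => m.
apply/mnormP; first by rewrite !mulr_ge0.
move=> x; case: (sliceP w) => _ _ _ ->; rewrite (le_trans (slice_lim_le _ _ M0 wM)) //.
by rewrite le_eqVlt; apply/orP; left; apply/eqP; ring.
Qed.

Lemma slice_star (w w' : dual B) m : (forall b, w' b = (w (star b) : C)^*) ->
  star (@slice R T A B w m) = @slice R T A B w' (star m).
Proof.
move=> ww'; apply: multiplier_lext => x.
have [_ _ _ E] := sliceP w; have [_ _ _ E'] := sliceP w'.
by rewrite E'; apply: (star_slice_lim ww') => y.
Qed.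

End Two.
End Slices.

(** * Nondegenerate homomorphisms *)

Section Nondegenerate.
Variables (R : realType) (T : tensor_products R).
Local Notation C := R[i].
Local Notation "A ⊗ B" := (ctens T A B) (at level 40, left associativity).
Local Notation "a ⊠ b" := (etens T a b) (at level 40, left associativity).

Lemma clspan_total (V : normedModType C) (X Y : set V) :
  clspan X = setT -> X `<=` clspan Y -> clspan Y = setT.
Proof.
move=> XT XY; apply/seteqP; split=> // v _; have : clspan X v by rewrite XT.
move: v; apply: clspan_ind => //; [exact: closed_clspan|exact: clspan0|exact: clspanP].
Qed.

Lemma blin_clspan (V W : normedModType C) (f : V -> W) (X : set V) (Y : set W) :
  blin f -> (forall x, X x -> clspan Y (f x)) -> forall v, clspan X v -> clspan Y (f v).
Proof.
move=> [lf bf] XY; apply: clspan_ind => //.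
- apply: preimage_closed; last exact: closed_clspan.
  by move=> y _; exact: blin_continuous.
- by rewrite /= (lin0 lf); exact: clspan0.
- by move=> k u v hu hv; rewrite /= lf; exact: clspanP.
Qed.

Lemma mul_total (A : cstarType R) : clspan (range (fun x : A * A => x.1 ** x.2)) = setT.
Proof.
have FA := aunit_proper T A.
apply/seteqP; split=> // a _.
apply: (@closed_cvg _ _ (@aunit R A) _ (fun e => e ** a) _ (@closed_clspan _ _ _)).
  by apply: filterS (aunit_near A) => e _; apply: sub_clspan; exists (e, a).
exact: aunit_cvgl.
Qed.

Lemma nondegenerateP (A B : cstarType R) (f : A -> 'M(B)) :
  nondegenerate f <-> clspan (range (fun x : A * B => lmul (f x.1) x.2)) = setT.
Proof.
rewrite /nondegenerate.
have -> : [set b | exists a b', b = lmul (f a) b'] = range (fun x : A * B => lmul (f x.1) x.2).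
  apply/seteqP; split=> y /=; first by move=> [a [b ->]]; exists (a, b).
  by move=> [[a b] _ <-]; exists a, b.
by [].
Qed.

Lemma memb_nondegenerate (A : cstarType R) : nondegenerate (@memb R A).
Proof. by apply/nondegenerateP; exact: mul_total. Qed.

Lemma htens_nondegenerate (A B A' B' : cstarType R) (f : A -> 'M(A')) (g : B -> 'M(B')) :
  is_star_hom f -> is_star_hom g -> nondegenerate f -> nondegenerate g ->
  nondegenerate (@htens R T A B A' B' f g).
Proof.
move=> hf hg /nondegenerateP nf /nondegenerateP ng; apply/nondegenerateP.
have := @total_bilinear C A' B' (A' ⊗ B') _ _ _ _ (fun a b => a ⊠ b) nf ng
  (@blin_etensl R T _ _) (@blin_etensr R T _ _) (etens_total T A' B').
move=> h; apply: (clspan_total h) => _ [[[a a'] [b b']] _ <-] /=.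
apply: sub_clspan; exists (a ⊠ b, a' ⊠ b') => //=.
by rewrite htensE // mtensl.
Qed.

Lemma tassoc_nondegenerate (A B D : cstarType R) :
  nondegenerate (@memb R _ \o @tassoc R T A B D).
Proof.
apply/nondegenerateP.
have h1 := @total_bilinear C A B (A ⊗ B) _ _ _ _ (fun a b => a ⊠ b) (mul_total A) (mul_total B)
  (@blin_etensl R T _ _) (@blin_etensr R T _ _) (etens_total T A B).
have h2 := @total_bilinear C (A ⊗ B) D (A ⊗ B ⊗ D) _ _ _ _ (fun a b => a ⊠ b) h1 (mul_total D)
  (@blin_etensl R T _ _) (@blin_etensr R T _ _) (etens_total T _ D).
apply: (clspan_total h2) => _ [[[[a a'] [b b']] [d d']] _ <-] /=.
apply: sub_clspan; exists (a ⊠ (b ⊠ d), a' ⊠ b' ⊠ d') => //=.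
by rewrite tassocE !etensM.
Qed.

Lemma tassoc_memb_star_hom (A B D : cstarType R) :
  is_star_hom (@memb R _ \o @tassoc R T A B D).
Proof. by apply: star_hom_comp; [exact: memb_star_hom|exact: tassoc_star_hom]. Qed.

Lemma comp_nondegenerate (A B D : cstarType R) (f : A -> 'M(B)) (F : 'M(B) -> 'M(D)) :
  is_star_hom f -> is_star_hom F -> nondegenerate f -> nondegenerate (F \o @memb R B) ->
  nondegenerate (F \o f).
Proof.
move=> hf hF nf nF; have [Fl FM _] := hF.
apply: (clspan_total nF) => _ [b [d ->]].
have bd : blin (fun b => lmul (F (memb b)) d).
  exact: (blin_comp (blin_lmul_at d) (blin_comp (blin_star_hom T hF) (@blin_memb R B))).
apply: (blin_clspan (X := [set b | exists a b', b = lmul (f a) b']) bd); last by rewrite nf.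
move=> _ [a [b' ->]]; rewrite -mul_memb FM.
by apply: sub_clspan; exists a, (lmul (F (memb b')) d).
Qed.

(** Nondegeneracy replaces strict continuity: [F m] is determined on the total vectors [F(a) b] by
    [F(m) F(a) b = F(m a) b]. *)
Lemma multiplier_hom_ext (A B : cstarType R) (F G : 'M(A) -> 'M(B)) :
  is_star_hom F -> is_star_hom G -> nondegenerate (F \o @memb R A) ->
  (forall a, F (memb a) = G (memb a)) -> F =1 G.
Proof.
move=> [_ FM _] [_ GM _] nF FG m; apply: multiplier_lext.
apply: (blin_eq nF (blin_lmul _) (blin_lmul _)).
move=> _ [a [b ->]] /=.
rewrite -[LHS]/(lmul (F m ** F (memb a)) b) -FM mul_memb.
rewrite FG -[RHS]/(lmul (G m) (lmul (F (memb a)) b)) FG.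
by rewrite -[RHS]/(lmul (G m ** G (memb a)) b) -GM mul_memb.
Qed.

Lemma id_star_hom (A : cstarType R) : is_star_hom (@id A).
Proof. by split. Qed.

Section TensId.
Variables (A B B' : cstarType R) (f : B -> 'M(B')).
Hypothesis hf : is_star_hom f.

Lemma tens_id_star_hom : is_star_hom (@tens_id R T A B B' f).
Proof. exact: htens_star_hom hf (memb_star_hom A). Qed.

Lemma tens_idE b a : @tens_id R T A B B' f (b ⊠ a) = mtens T (f b) (memb a).
Proof. exact: htensE hf (memb_star_hom A) _ _. Qed.

Lemma blin_tens_id : blin (@tens_id R T A B B' f).
Proof. exact: (blin_star_hom T tens_id_star_hom). Qed.

Lemma tens_id_inj : injective f -> injective (@tens_id R T A B B' f).
Proof. by move=> fi; apply: (htens_inj hf (memb_star_hom A) fi); exact: memb_inj. Qed.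

Lemma tens_id_nondegenerate : nondegenerate f -> nondegenerate (@tens_id R T A B B' f).
Proof.
by move=> nf; apply: htens_nondegenerate => //; [exact: memb_star_hom|exact: memb_nondegenerate].
Qed.

(** Since [f] may be degenerate, [y] is first replaced by [P y], with [P] the value of the extension
    at [1]; this does not change the action. Now [P y ⊠ a] is close to [f(e) y ⊠ e' a], the image of
    [y ⊠ a] under [e ⊠ e'], so the main term is controlled by the single seminorm of
    [v ** (e ⊠ e')]. *)
Lemma tens_id_strict : is_strict_hom f -> is_strict_hom (@tens_id R T A B B' f).
Proof.
move=> sf; have FB := aunit_proper T B; have FA := aunit_proper T A.
have [hF Ff sF] := mextP T sf; have [Fl FM _] := hF.
have ht := tens_id_star_hom.
apply: (strict0_hom ht).
apply: (strict0_total (etens_total T B' A) (M := 1)) => //.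
  by move=> v; rewrite mul1r; exact: (star_hom_le T ht).
move=> [y a] d d0 /=.
pose P := mext f (mone B).
have hP x : lmul (@tens_id R T A B B' f x) (y ⊠ a) = lmul (@tens_id R T A B B' f x) (lmul P y ⊠ a).
  move: x; apply: tens_ext.
  - exact: (blin_comp (blin_lmul_at _) blin_tens_id).
  - exact: (blin_comp (blin_lmul_at _) blin_tens_id).
  - move=> b a'; rewrite tens_idE !mtensl; congr (_ ⊠ _).
    by rewrite -[RHS]/(lmul (f b ** P) y) /P -Ff -FM mulm1.
have c1 : (fun e => lmul (f e) y) @ @aunit R B --> lmul P y.
  have := @strict_cvg R T B B' (mext f) Fl sF (mone B) y.
  by rewrite (_ : (fun _ => _) = (fun e => lmul (f e) y)) //; apply/funext => e; rewrite Ff.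
have d2 := divr_gt0 d0 (ltr0n _ 2).
have a1 : 0 < `|a| + 1 by rewrite ltr_wpDl.
have d4 : 0 < d / 4 by rewrite divr_gt0.
have /cvgrPdist_lt/(_ _ (divr_gt0 d4 a1)) c2 := c1.
have [e he] := filter_ex c2.
set ye := lmul (f e) y in he.
have y1 : 0 < `|ye| + 1 by rewrite ltr_wpDl.
have /cvgrPdist_lt/(_ _ (divr_gt0 d4 y1)) c3 := @aunit_cvgl R T A a.
have [e' he'] := filter_ex c3.
have n1 : 0 < `|y ⊠ a| + 1 by rewrite ltr_wpDl.
exists [:: e ⊠ e'], (d / 2 / (`|y ⊠ a| + 1)); split; first by rewrite divr_gt0.
move=> v v1 /(_ (e ⊠ e')); rewrite inE eqxx => /(_ isT)[hv _].
have tv : `|@tens_id R T A B B' f v| <= 1 by rewrite (le_trans (star_hom_le T ht _)).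
have -> : lmul (@tens_id R T A B B' f v) (y ⊠ a) =
    lmul (@tens_id R T A B B' f v) (lmul P y ⊠ a - ye ⊠ (e' ** a)) +
    lmul (@tens_id R T A B B' f (v ** (e ⊠ e'))) (y ⊠ a).
  have [_ tM _] := ht.
  rewrite linearB hP tM -[lmul (_ ** _) _]/(lmul _ (lmul _ _)) tens_idE mtensl subrK //.
rewrite (le_lt_trans (ler_normD _ _)) // (splitr d) ltrD //.
  rewrite (le_lt_trans (le_mnorm _ _)) //.
  apply: (@le_lt_trans _ _ (1 * `|lmul P y ⊠ a - ye ⊠ (e' ** a)|)); first by rewrite ler_wpM2r.
  rewrite mul1r.
  have -> : lmul P y ⊠ a - ye ⊠ (e' ** a) = (lmul P y - ye) ⊠ a + ye ⊠ (a - e' ** a).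
    by rewrite (linB (@etens_linl R T _ _ _)) (linB (@etens_linr R T _ _ _)) subrKA.
  have -> : d / 2 = d / 4 + d / 4 by field.
  rewrite (le_lt_trans (ler_normD _ _)) // ltrD // (le_lt_trans (norm_etens_le _ _ _)) //.
    apply: (@le_lt_trans _ _ (`|lmul P y - ye| * (`|a| + 1))); first by rewrite ler_wpM2l // lerDl.
    by rewrite -ltr_pdivlMr.
  apply: (@le_lt_trans _ _ ((`|ye| + 1) * `|a - e' ** a|)); first by rewrite ler_wpM2r // lerDl.
  by rewrite mulrC -ltr_pdivlMr.
rewrite (le_lt_trans (le_mnorm _ _)) //.
apply: (@le_lt_trans _ _ (`|v ** (e ⊠ e')| * (`|y ⊠ a| + 1))).
  apply: ler_pM => //; [exact: mnorm_ge0|exact: (star_hom_le T ht)|by rewrite lerDl].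
by rewrite -ltr_pdivlMr.
Qed.

End TensId.

Section SliceRules.
Variables (A B : cstarType R) (w : dual B).
Local Notation S := (@slice0 R T A B w).
Local Notation SM := (@slice R T A B w).

Lemma slice_mul_mtens (k : 'M(A ⊗ B)) (n : 'M(A)) b x :
  lmul (SM (k ** mtens T n (memb b))) x = S (lmul k (lmul n x ⊠ b)).
Proof.
have FB := aunit_proper T B.
have h1 := @slice_cvg R T A B w (k ** mtens T n (memb b)) x.
have b1 : blin (fun b : B => S (lmul k (lmul n x ⊠ b))) :=
  blin_comp (blin_slice0 T A w) (blin_comp (blin_lmul k) (@blin_etensr R T A B (lmul n x))).
have h2 := @blin_cvg C B A _ B (@aunit R B) (fun e => b ** e) b FB b1 (@aunit_cvgr R T B b).
apply: (@cvg_unique _ (@norm_hausdorff _ A) _ _ _ _ h1).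
move: h2; rewrite (_ : _ \o _ = (fun e => S (lmul (k ** mtens T n (memb b)) (x ⊠ e)))) //.
apply/funext => e.
by rewrite -[RHS]/(S (lmul k (lmul (mtens T n (memb b)) (x ⊠ e)))) mtensl.
Qed.

Lemma slice_mtens (n : 'M(A)) b : SM (mtens T n (memb b)) = (w b : C) *: n.
Proof.
apply: multiplier_lext => x; rewrite -[mtens T n (memb b)]mul1m slice_mul_mtens.
by rewrite /= slice0E.
Qed.

Lemma slice_mulr (k : 'M(A ⊗ B)) (n : 'M(A)) :
  SM k ** n = SM (k ** mtens T n (mone B)).
Proof.
have FB := aunit_proper T B.
apply: multiplier_lext => x.
have h1 := @slice_cvg R T A B w (k ** mtens T n (mone B)) x.
have h2 := @slice_cvg R T A B w k (lmul n x).
apply: (@cvg_unique _ (@norm_hausdorff _ A) _ _ _ _ h2).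
move: h1; rewrite (_ : (fun _ => _) = (fun e => S (lmul k (lmul n x ⊠ e)))) //.
by apply/funext => e; rewrite -[lmul (_ ** _) _]/(lmul _ (lmul _ _)) mtensl.
Qed.

Lemma slice_leg_approx (e : C) : 0 < e -> exists b, forall k : 'M(A ⊗ B),
  `|SM k - SM (k ** leg T A b)| <= e * `|k|.
Proof.
move=> e0; have e2 := divr_gt0 e0 (ltr0n _ 2).
have [b [ub hb]] := @slice0_approx R T A B w _ e2; exists b => k.
apply/mnormP; first by rewrite mulr_ge0 // ltW.
move=> x; rewrite lmulB slice_mul_mtens.
case: (@sliceP R T A B w) => _ _ _ ->.
rewrite (le_trans (slice_lim_approx k x (ltW e2) hb)) //.
by rewrite le_eqVlt; apply/orP; left; apply/eqP; field.
Qed.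

Lemma slice_leg (w' : dual B) b (k : 'M(A ⊗ B)) : (forall c, w' c = w (c ** b)) ->
  SM (k ** leg T A b) = @slice R T A B w' k.
Proof.
move=> ww'; have FB := aunit_proper T B; apply: multiplier_lext => x.
rewrite slice_mul_mtens.
have h1 := @slice_cvg R T A B w' k x.
have b1 : blin (fun b : B => S (lmul k (x ⊠ b))) :=
  blin_comp (blin_slice0 T A w) (blin_comp (blin_lmul k) (@blin_etensr R T A B x)).
have h2 := @blin_cvg C B A _ B (@aunit R B) (fun e => e ** b) b FB b1 (@aunit_cvgl R T B b).
apply: (@cvg_unique _ (@norm_hausdorff _ A) _ _ _ _ h2).
move: h1; rewrite (_ : (fun _ => _) = (fun b : B => S (lmul k (x ⊠ b))) \o (fun e => e ** b)) //.
apply/funext => e /=.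
have -> : lmul k (x ⊠ (e ** b)) = rmul (leg T A b) (lmul k (x ⊠ e)).
  by rewrite rmul_lmul mtensr.
move: (lmul k (x ⊠ e)); apply: tens_ext; first exact: blin_slice0.
  exact: (blin_comp (blin_slice0 T A w) (blin_rmul _)).
by move=> a c; rewrite mtensr !slice0E ww'.
Qed.
End SliceRules.

Lemma slice0_hom (A B D : cstarType R) (f : B -> 'M(D)) (w : dual A) u :
  is_star_hom f -> f (@slice0 R T B A w u) = @slice R T D A w (@tens_id R T A B D f u).
Proof.
move=> hf; move: u; apply: tens_ext.
- exact: (blin_comp (blin_star_hom T hf) (blin_slice0 T B w)).
- exact: (blin_comp (blin_slice T D w) (blin_tens_id A hf)).
- move=> b a; rewrite slice0E tens_idE // slice_mtens.
  by case: hf => fl _ _; rewrite (linZ fl).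
Qed.

(** On the total vectors [F(b) d] both sides are limits of slices of elements of the tensor product,
    for which [slice0_hom] applies. *)
Lemma slice_hom (A B D : cstarType R) (F : 'M(B) -> 'M(D)) (w : dual A) m :
  is_star_hom F -> nondegenerate (F \o @memb R B) ->
  F (@slice R T B A w m) =
    @slice R T D A w (mext (@tens_id R T A B D (F \o @memb R B)) m).
Proof.
move=> hF nF; have FA := aunit_proper T A.
set f := F \o @memb R B.
have hf : is_star_hom f by exact: star_hom_comp hF (memb_star_hom B).
have [Fl FM _] := hF.
have st := nondegenerate_strict T (tens_id_star_hom A hf) (tens_id_nondegenerate A hf nF).
apply: multiplier_lext.
apply: (blin_eq nF (blin_lmul _) (blin_lmul _)).
move=> _ [b [d ->]].
have h1 := @slice_cvg R T D A w (mext (@tens_id R T A B D f) m) (lmul (f b) d).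
have h2 := @blin_cvg C _ _ _ _ _ _ _ FA
  (blin_comp (blin_lmul_at d) (blin_star_hom T hf)) (@slice_cvg R T B A w m b).
have -> : lmul (F (@slice R T B A w m)) (lmul ((F \o @memb R B) b) d) =
    lmul (f (lmul (@slice R T B A w m) b)) d.
  by rewrite -[LHS]/(lmul (F _ ** F (memb b)) d) -FM mul_memb.
apply: (@cvg_unique _ (@norm_hausdorff _ D) _ _ _ _ h2).
move: h1; rewrite (_ : (fun _ => _) = ((fun m0 : 'M(D) => lmul m0 d) \o f) \o
  (fun e : A => @slice0 R T B A w (lmul m (b ⊠ e)))) //.
apply/funext => e /=.
rewrite (slice0_hom w _ hf) -(mext_mul T st) tens_idE //.
by rewrite slice_mul_mtens.
Qed.

End Nondegenerate.

(** * Comultiplications on multipliers *)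

Section Tri.
Variables (R : realType) (T : tensor_products R).
Local Notation "A ⊗ B" := (ctens T A B) (at level 40, left associativity).
Local Notation "a ⊠ b" := (etens T a b) (at level 40, left associativity).
Local Notation am A B D := (@memb R _ \o @tassoc R T A B D).

Lemma tens3_extl (A B D : cstarType R) (W : normedModType R[i]) (F G : A ⊗ B ⊗ D -> W) :
  blin F -> blin G -> (forall a b d, F (a ⊠ b ⊠ d) = G (a ⊠ b ⊠ d)) -> F =1 G.
Proof.
move=> bF bG FG; apply: tens_ext => // y d; move: y.
have bd := @blin_etensl R T (A ⊗ B) D d.
by apply: (tens_ext (blin_comp bF bd) (blin_comp bG bd)) => a b /=.
Qed.

Lemma mext_memb_comp (A B : cstarType R) (f : A -> 'M(B)) :
  is_strict_hom f -> mext f \o @memb R A = f.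
Proof. by move=> /(mextP T)[_ h _]; apply/funext => a /=. Qed.

Lemma mext_tens_id_mtens (A B B' : cstarType R) (f : B -> 'M(B')) (m : 'M(B)) (n : 'M(A)) :
  is_star_hom f -> nondegenerate f ->
  mext (@tens_id R T A B B' f) (mtens T m n) = mtens T (mext f m) n.
Proof.
move=> hf nf; have sf := nondegenerate_strict T hf nf.
have hF := tens_id_star_hom T A hf.
apply: (mext_eq T hF (tens_id_nondegenerate T A hf nf)) => u b.
rewrite -[LHS]/(lmul (_ ** _) b); congr (lmul _ b); move: u; apply: tens_ext.
- exact: (blin_comp (blin_mull _) (blin_tens_id T A hf)).
- exact: (blin_comp (blin_tens_id T A hf) (blin_lmul _)).
- by move=> x a; rewrite mtensl !tens_idE // mtensM (mext_mul T sf) mul_memb.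
Qed.

Section Fixed.
Variables (A B D : cstarType R).

Lemma tassoc_blin : blin (@tassoc R T A B D).
Proof. exact: (blin_star_hom T (tassoc_star_hom T A B D)). Qed.

Lemma tassoc_strict : is_strict_hom (am A B D).
Proof.
exact: (nondegenerate_strict T (tassoc_memb_star_hom T A B D) (tassoc_nondegenerate T A B D)).
Qed.

(* [m ⊗ n], rebracketed *)
Definition tri (m : 'M(A)) (n : 'M(B ⊗ D)) : 'M(A ⊗ B ⊗ D) :=
  mext (am A B D) (mtens T m n).

Lemma tri_lmul m n u : lmul (tri m n) (@tassoc R T A B D u) = tassoc (lmul (mtens T m n) u).
Proof.
by apply: memb_inj; rewrite -mul_memb [LHS](mext_mul T tassoc_strict).
Qed.

Lemma tri_star_hom : is_star_hom (mext (am A B D)).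
Proof. by case: (mextP T tassoc_strict). Qed.

Lemma triM m n m' n' : tri m n ** tri m' n' = tri (m ** m') (n ** n').
Proof. by rewrite /tri; have [_ <- _] := tri_star_hom; rewrite mtensM. Qed.

Lemma tri_memb a u : tri (memb a) (memb u) = memb (@tassoc R T A B D (a ⊠ u)).
Proof. by rewrite /tri mtens_memb; have [_ -> _] := mextP T tassoc_strict. Qed.

Lemma blin_tri m : blin (tri m).
Proof. exact: (blin_comp (blin_star_hom T tri_star_hom) (@blin_mtensr R T A (B ⊗ D) m)). Qed.

Lemma tassoc_ext (z z' : 'M(A ⊗ B ⊗ D)) :
  (forall a u, lmul z (@tassoc R T A B D (a ⊠ u)) = lmul z' (tassoc (a ⊠ u))) -> z = z'.
Proof.
move=> h; apply: multiplier_lext; apply: tens3_extl; [exact: blin_lmul|exact: blin_lmul|].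
by move=> a b d; have := h a (b ⊠ d); rewrite tassocE.
Qed.

Lemma tri_mtens m n p : tri m (mtens T n p) = mtens T (mtens T m n) p.
Proof.
apply: multiplier_lext; apply: tens3_extl; [exact: blin_lmul|exact: blin_lmul|].
by move=> a b d; rewrite -{1}tassocE tri_lmul !mtensl tassocE.
Qed.

End Fixed.

Section Quad.
Variables (X A B D : cstarType R).
Local Notation JX := (mext (@tens_id R T D _ _ (am X A B))).
(* [m ⊗ n], rebracketed *)
Definition quad (m : 'M(X)) (n : 'M(A ⊗ B ⊗ D)) : 'M(X ⊗ A ⊗ B ⊗ D) :=
  JX (@tri X (A ⊗ B) D m n).

Let hJ : is_star_hom JX.
Proof.
have hm := tassoc_memb_star_hom T X A B.
by case: (mextP T (nondegenerate_strict T (tens_id_star_hom T D hm)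
  (tens_id_nondegenerate T D hm (tassoc_nondegenerate T X A B)))).
Qed.

Lemma quadM m n m' n' : quad m n ** quad m' n' = quad (m ** m') (n ** n').
Proof. by rewrite /quad; have [_ <- _] := hJ; rewrite triM. Qed.

Lemma blin_quad m : blin (quad m).
Proof. exact: (blin_comp (blin_star_hom T hJ) (@blin_tri X (A ⊗ B) D m)). Qed.

Lemma quad_mtens m n p : quad m (mtens T n p) = mtens T (tri m n) p.
Proof.
rewrite /quad tri_mtens mext_tens_id_mtens //; first exact: tassoc_memb_star_hom.
exact: tassoc_nondegenerate.
Qed.

Lemma quad_memb x a v :
  quad (memb x) (memb (@tassoc R T A B D (a ⊠ v))) = memb (tassoc ((x ⊠ a) ⊠ v)).
Proof.
move: v; apply: tens_ext.
- have h1 := blin_comp (@tassoc_blin A B D) (@blin_etensr R T A (B ⊗ D) a).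
  exact: (blin_comp (blin_quad _) (blin_comp (@blin_memb R _) h1)).
- have h1 := blin_comp (@tassoc_blin (X ⊗ A) B D) (@blin_etensr R T (X ⊗ A) (B ⊗ D) (x ⊠ a)).
  exact: (blin_comp (@blin_memb R _) h1).
by move=> b d; rewrite !tassocE -mtens_memb quad_mtens tri_memb mtens_memb tassocE.
Qed.

Lemma quad_tri m n p : quad m (tri n p) = tri (mtens T m n) p.
Proof.
apply: tassoc_ext => y u; move: y.
pose bt := blin_comp (@tassoc_blin (X ⊗ A) B D) (@blin_etensl R T _ _ u).
apply: (tens_ext (blin_comp (blin_lmul _) bt) (blin_comp (blin_lmul _) bt)) => x a /=.
rewrite tri_lmul !mtensl.
by apply: memb_inj; rewrite -[LHS]mul_memb -!quad_memb quadM !mul_memb tri_lmul mtensl.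
Qed.

(* Recognises both [id ⊗ D] on [M(X ⊗ A ⊗ A)] and the extension of
   [(id ⊗ D) ⊗ id]; their agreement is thereby reduced to the case of [D]. *)
Lemma quad_ext (A' B' : cstarType R) (F : 'M(X ⊗ A' ⊗ B') -> 'M(X ⊗ A ⊗ B ⊗ D))
    (E : 'M(A' ⊗ B') -> 'M(A ⊗ B ⊗ D)) :
  is_star_hom F -> nondegenerate (F \o @memb R _) -> is_star_hom E ->
  (forall x a b, F (memb (x ⊠ a ⊠ b)) = quad (memb x) (E (memb (a ⊠ b)))) ->
  forall m n, F (tri m n) = quad m (E n).
Proof.
move=> hF nF hE FE m n; have [_ FM _] := hF; have [_ EM _] := hE.
have FEz x z : F (memb (tassoc (x ⊠ z))) = quad (memb x) (E (memb z)).
  move: z; apply: tens_ext.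
  - have h1 := blin_comp (@tassoc_blin X A' B') (@blin_etensr R T X (A' ⊗ B') x).
    exact: (blin_comp (blin_star_hom T hF) (blin_comp (@blin_memb R _) h1)).
  - exact: (blin_comp (blin_quad _) (blin_comp (blin_star_hom T hE) (@blin_memb R _))).
  - by move=> a b; rewrite tassocE.
have key u : F (tri m n) ** F (memb u) = quad m (E n) ** F (memb u).
  have bFm := blin_comp (blin_star_hom T hF) (@blin_memb R _).
  move: u; apply: tens3_extl.
  - exact: (blin_comp (blin_mull _) bFm).
  - exact: (blin_comp (blin_mull _) bFm).
  - move=> a b d; rewrite -tassocE -FM mul_memb tri_lmul mtensl !FEz quadM.
    by rewrite -EM !mul_memb.
apply: multiplier_lext; apply: (blin_eq nF (blin_lmul _) (blin_lmul _)).
by move=> _ [u [b ->]] /=; rewrite -[LHS]/(lmul (F (tri m n) ** F (memb u)) b) key.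
Qed.

End Quad.
End Tri.

(** * The homomorphism id ⊗ Delta: naturality and coassociativity *)

Section IdTens.
Variables (R : realType) (T : tensor_products R).
Local Notation "A ⊗ B" := (ctens T A B) (at level 40, left associativity).
Local Notation "a ⊠ b" := (etens T a b) (at level 40, left associativity).
Variables (A : cstarType R) (D : A -> 'M(A ⊗ A)).
Hypothesis hD : is_star_hom D.
Hypothesis nD : nondegenerate D.
Local Notation idD X := (@id_tens R T A D X).

Section Fixed.
Variable X : cstarType R.
Local Notation Delta2 := (@htens R T X A X (A ⊗ A) (@memb R X) D).

Let h2 : is_star_hom Delta2.
Proof. exact: htens_star_hom (memb_star_hom X) hD. Qed.

Let n2 : nondegenerate Delta2.
Proof. by apply: htens_nondegenerate => //; [exact: memb_star_hom|exact: memb_nondegenerate]. Qed.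

Let s2 : is_strict_hom Delta2.
Proof. exact: (nondegenerate_strict T h2 n2). Qed.

Lemma id_tens_star_hom : is_star_hom (idD X).
Proof. by apply: star_hom_comp; [exact: tri_star_hom|case: (mextP T s2)]. Qed.

Lemma blin_id_tens : blin (idD X).
Proof. exact: (blin_star_hom T id_tens_star_hom). Qed.

Lemma id_tensM m n : idD X (m ** n) = idD X m ** idD X n.
Proof. by case: id_tens_star_hom. Qed.

Lemma id_tens_mtens m a : idD X (mtens T m (memb a)) = tri m (D a).
Proof.
rewrite /id_tens /= /tri; congr (mext _ _); apply: (mext_eq T h2 n2) => u b.
rewrite -[LHS]/(lmul (_ ** _) b); congr (lmul _ b); move: u; apply: tens_ext.
- exact: (blin_comp (blin_mull _) (blin_star_hom T h2)).
- exact: (blin_comp (blin_star_hom T h2) (blin_lmul _)).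
- move=> x a'; rewrite mtensl !htensE //; try exact: memb_star_hom.
  by have [_ DM _] := hD; rewrite mtensM mul_memb -DM.
Qed.

Lemma id_tens_memb x a : idD X (memb (x ⊠ a)) = tri (memb x) (D a).
Proof. by rewrite -mtens_memb id_tens_mtens. Qed.

Lemma id_tens_nondegenerate : nondegenerate (idD X \o @memb R _).
Proof.
have -> : idD X \o @memb R _ = mext (@memb R _ \o @tassoc R T X A A) \o Delta2.
  apply/funext => u; rewrite /id_tens /=.
  by have [_ -> _] := mextP T s2.
apply: (comp_nondegenerate T h2 (tri_star_hom _ _ _ _) n2).
rewrite mext_memb_comp //; [exact: tassoc_nondegenerate|exact: tassoc_strict].
Qed.

Lemma id_tens_memb_star_hom : is_star_hom (idD X \o @memb R _).
Proof. by apply: star_hom_comp; [exact: id_tens_star_hom|exact: memb_star_hom]. Qed.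

End Fixed.

Section Naturality.
Variables (B B' : cstarType R) (f : B -> 'M(B')).
Hypothesis hf : is_star_hom f.
Local Notation f1 := (@tens_id R T A B B' f).
Local Notation f2 := (@tens_id R T A (B ⊗ A) (B' ⊗ A) f1).

Let h1 := tens_id_star_hom T A hf.
Let h2 := tens_id_star_hom T A h1.
Let b2 : blin f2 := blin_star_hom T h2.

Let f2_tassoc b u : f2 (tassoc (b ⊠ u)) = tri (f b) (memb u).
Proof.
move: u; apply: tens_ext.
- exact: (blin_comp b2 (blin_comp (@tassoc_blin R T B A A) (@blin_etensr R T B (A ⊗ A) b))).
- exact: (blin_comp (blin_tri T A A (f b)) (@blin_memb R (A ⊗ A))).
- by move=> a a'; rewrite tassocE !tens_idE // -mtens_memb tri_mtens.
Qed.

Let natural_memb u z : f2 (lmul (idD B (memb u)) z) = idD B' (f1 u) ** f2 z.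
Proof.
have bB := @blin_comp _ _ _ _ (idD B) (@memb R (B ⊗ A)) (blin_id_tens B) (@blin_memb R _).
have bB' := @blin_comp _ _ _ _ (idD B') f1 (blin_id_tens B') (blin_tens_id T A hf).
move: u; apply: tens_ext.
- exact: (blin_comp b2 (blin_comp (blin_lmul_at z) bB)).
- exact: (blin_comp (blin_mulr (f2 z)) bB').
move=> b a; move: z; apply: tens3_extl.
- exact: (blin_comp b2 (blin_lmul _)).
- exact: (blin_comp (blin_mull _) b2).
move=> b1 a1 a2; rewrite -tassocE id_tens_memb tri_lmul mtensl.
rewrite !f2_tassoc tens_idE // id_tens_mtens triM mul_memb.
by have [_ fM _] := hf; rewrite -fM.
Qed.

(** The hypothesis says that [n] extends the image of [m] under [f ⊗ id]. This form covers
    homomorphisms [f] that need not be nondegenerate, as [delta] and the inclusion [csub_val]. By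
    nondegeneracy of [id ⊗ D] it suffices to treat vectors [(id ⊗ D)(u) z], that is, elements of
    [B ⊗ A]. *)
Lemma id_tens_natural m n : (forall x, f1 (lmul m x) = n ** f1 x) ->
  forall z, f2 (lmul (idD B m) z) = idD B' n ** f2 z.
Proof.
move=> mn; apply: (blin_eq (id_tens_nondegenerate B) (blin_comp b2 (blin_lmul _))
  (blin_comp (blin_mull _) b2)).
move=> _ [u [z ->]] /=.
rewrite -[lmul (idD B m) _]/(lmul (idD B m ** idD B (memb u)) z) -id_tensM mul_memb.
by rewrite !natural_memb mn id_tensM amulA.
Qed.

End Naturality.

Section Coassociativity.
Hypothesis coD : forall a, mext (@tens_id R T A _ _ D) (D a) = idD A (D a).
Variable X : cstarType R.
Local Notation Y := (X ⊗ A).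
Local Notation Omega := (mext (@tens_id R T A _ _ (idD X \o @memb R Y))).

Let hO : is_star_hom Omega.
Proof.
have h := id_tens_memb_star_hom X; have n := id_tens_nondegenerate X.
by case: (mextP T (nondegenerate_strict T (tens_id_star_hom T A h)
  (tens_id_nondegenerate T A h n))).
Qed.

Let sO : is_strict_hom (@tens_id R T A _ _ (idD X \o @memb R Y)).
Proof.
have h := id_tens_memb_star_hom X; have n := id_tens_nondegenerate X.
exact: (nondegenerate_strict T (tens_id_star_hom T A h) (tens_id_nondegenerate T A h n)).
Qed.

Let hE : is_star_hom (mext (@tens_id R T A _ _ D)).
Proof.
by case: (mextP T (nondegenerate_strict T (tens_id_star_hom T A hD)
  (tens_id_nondegenerate T A hD nD))).
Qed.

(** It suffices to compare on [x ⊠ a]. There [quad_ext] expresses the two sides through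
    [quad (memb x)] applied to the two sides of the coassociativity [coD] of [D] at [a]. *)
Lemma id_tens_coassoc m : idD Y (idD X m) = Omega (idD X m).
Proof.
have hX := id_tens_star_hom X; have hY := id_tens_star_hom Y.
have nX := id_tens_nondegenerate X; have nY := id_tens_nondegenerate Y.
apply: (@multiplier_hom_ext R _ _ (idD Y \o idD X) (Omega \o idD X)).
- exact: star_hom_comp.
- exact: star_hom_comp.
- exact: (comp_nondegenerate T (id_tens_memb_star_hom X) hY nX nY).
have bX := blin_comp (blin_star_hom T hX) (@blin_memb R Y).
apply: tens_ext; [exact: (blin_comp (blin_star_hom T hY) bX)
  |exact: (blin_comp (blin_star_hom T hO) bX)|move=> x a /=].
rewrite id_tens_memb.
rewrite (quad_ext hY nY (id_tens_star_hom A)); last first.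
  by move=> x' a' b'; rewrite !id_tens_memb quad_tri mtens_memb.
rewrite (quad_ext hO _ hE) ?coD //.
  rewrite mext_memb_comp //; apply: tens_id_nondegenerate => //.
  exact: id_tens_memb_star_hom.
move=> x' a' b'; have [_ -> _] := mextP T sO.
rewrite tens_idE /=; last exact: id_tens_memb_star_hom.
have sD := nondegenerate_strict T (tens_id_star_hom T A hD) (tens_id_nondegenerate T A hD nD).
have [_ -> _] := mextP T sD.
by rewrite tens_idE // quad_mtens id_tens_memb.
Qed.

End Coassociativity.
End IdTens.

(** The approximants of a limit point pull back to a Cauchy filter on [S], which converges since [V]
    is complete. *)
Lemma closed_isometric_image (R : realType) (V : completeNormedModType R[i])
    (W : normedModType R[i]) (f : V -> W) (S : set V) :
  linear f -> (forall v, `|f v| = `|v|) -> closed S -> closed (f @` S).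
Proof.
move=> lf fi Sc; apply: closed_approx => w wS.
pose F := filter_from [set e : R[i] | 0 < e] (fun e => [set v | S v /\ `|w - f v| < e]).
have FF : ProperFilter F.
  apply: filter_from_proper; last first.
    by move=> e /= /wS[_ [v Sv <-] wv]; exists v.
  apply: filter_from_filter; first by exists 1 => /=.
  move=> c d /= c0 d0; have [r r0 [rc rd]] := min_pos c0 d0.
  exists r => // v [Sv wv]; split; split=> //; exact: lt_le_trans wv _.
have dist u v : `|u - v| <= `|w - f u| + `|w - f v|.
  rewrite -fi (linB lf) -(subrKA w) (le_trans (ler_normD _ _)) //.
  by rewrite [`|f u - w|]distrC.
have /cvg_ex[l Fl] : cvg F.
  apply: cauchy_cvg; apply: cauchy_exP => e e0; have e2 := divr_gt0 e0 (ltr0n _ 2).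
  have [_ [u Su <-] wu] := wS _ e2; exists u; rewrite -ball_normE.
  exists (e / 2) => //= v [Sv wv].
  by rewrite /ball_ /= (le_lt_trans (dist _ _)) // (splitr e) ltrD.
have Sl : S l.
  apply: (@closed_cvg _ _ F _ id S Sc _ l Fl).
  by exists 1 => //= v [].
exists l => //; apply/eqP; rewrite -subr_eq0 -normr_le0; apply/ler_addgt0Pr => e e0.
rewrite add0r; have e2 := divr_gt0 e0 (ltr0n _ 2).
have /cvgrPdist_lt/(_ _ e2) h1 : id @ F --> l by [].
have h2 : F [set v | S v /\ `|w - f v| < e / 2] by exists (e / 2).
have [v [/= lv [_ wv]]] := filter_ex (filterI h1 h2).
rewrite -(subrKA (f v)) -(linB lf) (le_trans (ler_normD _ _)) // fi (splitr e).
by rewrite lerD //; [exact: ltW|rewrite distrC; exact: ltW].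
Qed.

Lemma clspan_sub_id (K : numFieldType) (V : normedModType K) (S : set V) :
  closed S -> S 0 -> (forall (k : K) u v, S u -> S v -> S (k *: u + v)) ->
  clspan S = S.
Proof.
move=> Sc S0 Sl; apply/seteqP; split; last exact: sub_clspan.
by apply: smallest_sub.
Qed.

Section Generic.
Variables (R : realType) (T : tensor_products R).
Local Notation "A ⊗ B" := (ctens T A B) (at level 40, left associativity).
Local Notation "a ⊠ b" := (etens T a b) (at level 40, left associativity).

Lemma star_sym_cstar_sub (A : cstarType R) (Q : set A) :
  closed Q -> Q 0 -> (forall (k : R[i]) a b, Q a -> Q b -> Q (k *: a + b)) ->
  (forall a b, Q a -> Q b -> Q (a ** b)) ->
  is_cstar_sub [set a | Q a /\ Q (star a)].
Proof.
move=> Qc Q0 Ql QM; split.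
- apply: closedI => //; apply: preimage_closed => //.
  by move=> a _; exact: star_continuous.
- split; first by rewrite /= star0.
  move=> k a b [Qa Qa'] [Qb Qb']; split; first exact: Ql.
  by rewrite starD starZ; exact: Ql.
- move=> a b [Qa Qa'] [Qb Qb']; split; first exact: QM.
  by rewrite starM; exact: QM.
- by move=> a [Qa Qa']; rewrite /= starK.
Qed.

Lemma cgen_sub (A : cstarType R) (X S : set A) :
  is_cstar_sub S -> X `<=` S -> csub_set (cgen X) `<=` S.
Proof. by move=> hS XS; apply: smallest_sub. Qed.

Lemma sub_cgen (A : cstarType R) (X : set A) : X `<=` csub_set (cgen X).
Proof. exact: sub_smallest. Qed.

Lemma csub_val_star_hom (A : cstarType R) (S : cstar_sub A) : is_star_hom (@csub_val R A S).
Proof. by split. Qed.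

Lemma range_star_hom_cstar_sub (A B : cstarType R) (f : A -> B) (S : set A) :
  is_star_hom f -> injective f -> is_cstar_sub S -> is_cstar_sub (f @` S).
Proof.
move=> hf fi [Sc [S0 Sl] SM Ss]; have [fl fM fs] := hf; split.
- apply: closed_isometric_image => //; exact: star_hom_isometric.
- split; first by exists 0 => //; rewrite (lin0 fl).
  by move=> k _ _ [a Sa <-] [b Sb <-]; exists (k *: a + b); [exact: Sl|rewrite fl].
- by move=> _ _ [a Sa <-] [b Sb <-]; exists (a ** b); [exact: SM|rewrite fM].
- by move=> _ [a Sa <-]; exists (star a); [exact: Ss|rewrite fs].
Qed.

Lemma setT_cstar_sub (A : cstarType R) : is_cstar_sub [set: A].
Proof. by split=> //; exact: closedT. Qed.

Section Restriction.
Variables (A B : cstarType R) (V : A -> B) (m : B).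
Hypotheses (hV : is_star_hom V) (iV : injective V).
Hypotheses (ml : forall u, range V (m ** V u)) (mr : forall u, range V (V u ** m)).

(** Multiplication by [m] is pulled back along [V]: the multiplier identities are checked after
    applying [V], and [V] being isometric, [|m|] bounds both actions. *)
Lemma multiplier_of_range : exists n : 'M(A),
  forall u, V (lmul n u) = m ** V u /\ V (rmul n u) = V u ** m.
Proof.
have [Vl VM _] := hV; have Vi := star_hom_isometric T hV iV.
have /choice[l lE] : forall u, exists v, V v = m ** V u.
  by move=> u; have [v _ <-] := ml u; exists v.
have /choice[r rE] : forall u, exists v, V v = V u ** m.
  by move=> u; have [v _ <-] := mr u; exists v.
have P : is_multiplier l r.
  split.
  - by split=> k u v; apply: iV; rewrite Vl ?lE ?rE Vl ?amulDr ?amulDl ?amulZr ?amulZl.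
  - split; exists `|m| => u; first by rewrite -Vi lE -(Vi u) norm_amul.
    by rewrite -Vi rE -(Vi u) mulrC norm_amul.
  - by move=> u v; apply: iV; rewrite VM !lE VM amulA.
  - by move=> u v; apply: iV; rewrite VM !rE VM amulA.
  - by move=> u v; apply: iV; rewrite !VM lE rE amulA.
by exists (Multiplier P) => u; split; [exact: lE|exact: rE].
Qed.
End Restriction.

Lemma mext_memb (A B : cstarType R) (F : 'M(A) -> 'M(B)) m :
  is_star_hom F -> nondegenerate (F \o @memb R A) -> mext (F \o @memb R A) m = F m.
Proof.
move=> hF nF; have [_ FM _] := hF.
apply: (mext_eq T _ nF); first by apply: star_hom_comp => //; exact: memb_star_hom.
by move=> a b /=; rewrite -mul_memb FM.
Qed.

Lemma mext1 (A B : cstarType R) (f : A -> 'M(B)) :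
  is_star_hom f -> nondegenerate f -> mext f (mone A) = mone B.
Proof. by move=> hf nf; apply: (mext_eq T hf nf). Qed.

Lemma tens_id_leg (A B B' : cstarType R) (f : B -> 'M(B')) (a : A) u :
  is_star_hom f ->
  @tens_id R T A B B' f (lmul (leg T B a) u) = leg T B' a ** @tens_id R T A B B' f u.
Proof.
move=> hf; move: u; apply: tens_ext.
- exact: (blin_comp (blin_tens_id T A hf) (blin_lmul _)).
- exact: (blin_comp (blin_mull _) (blin_tens_id T A hf)).
- by move=> b c; rewrite mtensl !tens_idE // mtensM mul1m mul_memb.
Qed.

Lemma leg_eq0 (X A : cstarType R) (m : 'M(X ⊗ A)) :
  (forall a, m ** leg T X a = 0) -> m = 0.
Proof.
move=> m0; apply: tens_mult_ext => x; have bx := @blin_etensr R T X A x.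
apply: (blin_eq (mul_total T A) (blin_comp (blin_lmul m) bx)
  (blin_comp (blin_lmul (0 : 'M(X ⊗ A))) bx)).
move=> _ [[a b] _ <-] /=.
have -> : x ⊠ (a ** b) = lmul (leg T X a) (x ⊠ b) by rewrite mtensl.
by rewrite -[lmul m _]/(lmul (m ** leg T X a) (x ⊠ b)) m0 /= !amul0l.
Qed.

End Generic.

(** * The dilation *)

Section Dilation.
Variables (R : realType) (T : tensor_products R).
Local Notation "A ⊗ B" := (ctens T A B) (at level 40, left associativity).
Local Notation "a ⊠ b" := (etens T a b) (at level 40, left associativity).
Variables (A : cstarType R) (D : A -> 'M(A ⊗ A)).
Hypothesis bialgA : is_bialgebra D.
Hypothesis sliceA : slice_map_property T A.
Variables (C : cstarType R) (delta : C -> 'M(C ⊗ A)).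
Hypothesis delta_pc : is_partial_coaction D delta.
Hypothesis delta_inj : injective delta.
Hypothesis delta_reg : is_regular D delta.

Local Notation Y := (C ⊗ A).
Local Notation idD X := (@id_tens R T A D X).
Local Notation tau := (@tens_id R T A C Y delta).
Local Notation G := (dilation_alg D delta).
Local Notation GT := (cstar_sub_type G).
Local Notation val := (@csub_val R 'M(Y) G).
Local Notation V := (@tens_id R T A GT Y val).

Let hD : is_star_hom D. Proof. by case: bialgA. Qed.
Let nD : nondegenerate D. Proof. by case: bialgA. Qed.
Let coD a : mext (@tens_id R T A _ _ D) (D a) = idD A (D a).
Proof. by case: bialgA. Qed.
Let sdelta : is_strict_hom delta. Proof. by case: delta_pc. Qed.
Let hdelta : is_star_hom delta. Proof. by case: sdelta. Qed.
Let htau : is_star_hom tau := tens_id_star_hom T A hdelta.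
Let hid X : is_star_hom (idD X) := id_tens_star_hom hD nD X.
Let hval : is_star_hom val := csub_val_star_hom G.
Let hV : is_star_hom V := tens_id_star_hom T A hval.
Let iV : injective V := tens_id_inj hval (@csub_val_inj R _ G).

(** Applying [id ⊗ D] to a slice over the last leg gives the slice of [((id ⊗ D) ⊗ id)] of the
    element, which coassociativity rewrites as [idD Y]. *)
Let slice_id_tens w m : idD C (@slice R T Y A w (idD C m)) =
  @slice R T _ A w (idD Y (idD C m)).
Proof.
by rewrite id_tens_coassoc // (slice_hom w _ (hid C) (id_tens_nondegenerate hD nD C)).
Qed.

Section Generators.
Variable Q : set 'M(Y).
Hypotheses (Qc : closed Q) (Q0 : Q 0).
Hypothesis Ql : forall (k : R[i]) a b, Q a -> Q b -> Q (k *: a + b).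
Hypothesis QM : forall a b, Q a -> Q b -> Q (a ** b).
Hypothesis Qdelta : forall c, Q (delta c).
Hypothesis Qslice : forall w c, Q (@slice R T Y A w (idD C (delta c))).

(* [Q] need not be self-adjoint, because the family of generators is. *)
Lemma dilation_alg_ind g : csub_set G g -> Q g.
Proof.
have [_ _ ds] := hdelta; have [_ _ is_] := hid C.
move=> Gg; suff [] : [set a | Q a /\ Q (star a)] g by [].
move: Gg; apply: cgen_sub; first exact: star_sym_cstar_sub.
move=> _ [[w [c ->]]|[c _ <-]] /=; last by rewrite -ds.
split => //; have [w' ww'] := dual_star w.
by rewrite (slice_star _ ww') -is_ -ds.
Qed.
End Generators.

Lemma dilation_alg_delta c : csub_set G (delta c).
Proof. by apply: sub_cgen; right; exists c. Qed.

Lemma dilation_alg_slice w c : csub_set G (@slice R T Y A w (idD C (delta c))).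
Proof. by apply: sub_cgen; left; exists w, c. Qed.

(* The projection [delta(1) ⊗ 1] in the partial coaction identity can be moved to
   the right by taking adjoints, and there it acts trivially on [tau y]. *)
Let tau_delta c y : tau (lmul (delta c) y) = idD C (delta c) ** tau y.
Proof.
have [hP Pd _] := mextP T sdelta; have [_ PM Ps] := hP.
have stau := tens_id_strict T A hdelta sdelta.
have [[_ _ Ts] _ _] := mextP T stau.
have [_ _ ds] := hdelta; have [_ _ is_] := hid C.
pose P := mtens T (mext delta (mone C)) (mone A).
have Pstar : star P = P by rewrite mtens_star star1 -Ps star1.
have Ptau z : P ** tau z = tau z.
  move: z; apply: tens_ext; [exact: (blin_comp (blin_mull _) (blin_tens_id T A hdelta))
    |exact: blin_tens_id|move=> x a].
  by rewrite tens_idE // mtensM mul1m -Pd -PM mul1m.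
have [_ _ pc] := delta_pc.
have -> : idD C (delta c) ** tau y = mext tau (delta c) ** tau y.
  rewrite -{2}(starK c) ds Ts -/P pc -/P ds is_ starM starK Pstar -amulA Ptau //.
by rewrite (mext_mul T stau).
Qed.

Lemma tau_lmul g y : csub_set G g -> tau (lmul g y) = idD C g ** tau y.
Proof.
have btau := blin_star_hom T htau; have bid := blin_id_tens hD nD C.
move=> Gg; suff : [set g | forall y, tau (lmul g y) = idD C g ** tau y] g by apply.
move: g Gg; apply: dilation_alg_ind.
- rewrite (_ : mkset _ = \bigcap_y [set g | tau (lmul g y) = idD C g ** tau y]); last first.
    by apply/seteqP; split=> g h y'; [move=> _; exact: h|exact: (h y' I)].
  apply: closed_bigI => y' _.
  have [l1 b1] := blin_comp btau (blin_lmul_at y').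
  have [l2 b2] := blin_comp (blin_mulr (tau y')) bid.
  apply: continuous_eq_closed; [exact: blin_continuous l1 b1|exact: blin_continuous l2 b2].
- by move=> y' /=; rewrite amul0l (lin0 btau.1) (lin0 bid.1) amul0l.
- move=> k a b ha hb y'.
  by rewrite -[lmul _ _]/(k *: lmul a y' + lmul b y') btau.1 ha hb bid.1 amulDl amulZl.
- by move=> a b ha hb y' /=; rewrite ha hb id_tensM // amulA.
- exact: tau_delta.
(* The slice is the limit of slices of [lmul k (y' ⊠ e)]. Slicing commutes with [tau], and
   naturality of [id ⊗ D] for [delta] lifts [tau_delta] to the tensor product with one more leg
   [A]. *)
- move=> w c y'; have FA := aunit_proper T A.
  set k := idD C (delta c); apply: multiplier_lext => x.
  have h1 := @blin_cvg _ _ _ _ _ _ _ _ FA (blin_comp (blin_lmul_at x) btau)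
    (@slice_cvg R T Y A w k y').
  have h2 := @slice_cvg R T _ A w (idD Y k) (lmul (tau y') x).
  rewrite -slice_id_tens in h2.
  apply: (@cvg_unique _ (@norm_hausdorff _ _) _ _ _ _ h1).
  move: h2; rewrite (_ : (fun _ => _) = ((fun m => lmul m x) \o tau) \o
    (fun e => @slice0 R T Y A w (lmul k (y' ⊠ e)))) //.
  apply/funext => e /=.
  rewrite (slice0_hom w _ htau) (id_tens_natural hD nD hdelta (tau_delta c)).
  by rewrite tens_idE // slice_mul_mtens.
Qed.

Lemma id_tens_inj_dilation_alg g : csub_set G g -> idD C g = 0 -> g = 0.
Proof.
move=> Gg g0; apply: multiplier_lext => y /=; rewrite amul0l.
apply: (tens_id_inj hdelta delta_inj); rewrite tau_lmul // g0 amul0l.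
by rewrite (lin0 (blin_star_hom T htau).1).
Qed.

Let bV : blin V := blin_star_hom T hV.

Let rVc : closed (range V).
Proof.
apply: (closed_isometric_image bV.1); last exact: closedT.
exact: star_hom_isometric.
Qed.

Let rV_id : clspan (range V) = range V.
Proof.
apply: clspan_sub_id => //; first by exists 0 => //; rewrite (lin0 bV.1).
by move=> k _ _ [u _ <-] [v _ <-]; exists (k *: u + v); rewrite // bV.1.
Qed.

Let rV_ind (W : normedModType R[i]) (X : set W) (F : W -> 'M(Y ⊗ A)) :
  clspan X = setT -> blin F -> (forall x, X x -> range V (F x)) -> forall x, range V (F x).
Proof.
move=> XT bF XF x; rewrite -rV_id; apply: (blin_clspan (X := X) bF); last by rewrite XT.
by move=> z /XF; rewrite rV_id.
Qed.

Let rV_tens (F : GT ⊗ A -> 'M(Y ⊗ A)) : blin F ->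
  (forall g a, range V (F (g ⊠ a))) -> forall u, range V (F u).
Proof.
move=> bF h; apply: (rV_ind (etens_total T GT A) bF).
by move=> _ [[g a] _ <-]; exact: h.
Qed.

(* By regularity the element is [S u] with [u] in [M(Y) ⊗ A] and [S] the inclusion
   into [M(Y ⊗ A)]. The slices of [u] are generators of [G], whence [u] lies in
   [G ⊗ A] by the slice map property. *)
Let rV_delta c a : range V (idD C (delta c) ** leg T Y a).
Proof.
set k := idD C (delta c).
have hS := tens_id_star_hom T A (id_star_hom 'M(Y)).
have iS : injective (@tens_id R T A 'M(Y) Y id).
  by apply: (tens_id_inj (id_star_hom _)).
have bS := blin_star_hom T hS.
have [u _ uk] : range (@tens_id R T A 'M(Y) Y id) (k ** leg T Y a).
  have [rc [r0 rl] _ _] := range_star_hom_cstar_sub T hS iS (setT_cstar_sub _).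
  rewrite -(clspan_sub_id rc r0 rl).
  have := delta_reg c a; rewrite /is_regular; apply: smallest_sub.
    by split; [exact: closed_clspan|split; [exact: clspan0|exact: clspanP]].
  move=> _ [m [a' ->]]; apply: sub_clspan; exists (m ⊠ a') => //.
  by rewrite tens_idE //; exact: id_star_hom.
have Gu : clspan [set y | exists g a, csub_set G g /\ y = g ⊠ a] u.
  apply: sliceA => w.
  (* Slicing [k (1 ⊗ a)] by [w] amounts to slicing [k] by [w(. a)], which gives a generator. *)
  have [w' ww'] := @dual_of R A (fun c => w (c ** a)) (blin_comp (dual_blin w) (blin_mulr a)).
  rewrite -[slice0 _ _]/(id (slice0 w u)) (slice0_hom w _ (id_star_hom _)) uk.
  by rewrite (slice_leg _ ww'); exact: dilation_alg_slice.
rewrite -rV_id -uk; move: u Gu {uk}; apply: (blin_clspan bS).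
move=> _ [g [a' [Gg ->]]]; apply: sub_clspan; exists (CStarSubElt Gg ⊠ a') => //.
by rewrite !tens_idE //; exact: id_star_hom.
Qed.

Let rV_slice_tri w (g : GT) v : range V (@slice R T _ A w (tri (val g) (memb v))).
Proof.
move: v; apply: (rV_ind (etens_total T A A)).
  exact: (blin_comp (blin_slice T _ w) (blin_comp (blin_tri T A A (val g)) (@blin_memb R _))).
move=> _ [[a b] _ <-] /=.
rewrite -mtens_memb tri_mtens slice_mtens; exists ((w b : R[i]) *: (g ⊠ a)) => //.
by rewrite (linZ bV.1) tens_idE.
Qed.

(* By coassociativity the element is a slice of [K (1 ⊗ a ⊗ 1)], hence a limit of
   slices of [K (1 ⊗ a ⊗ b)]. Writing [a ⊗ b] as a limit of sums of [D(a') z]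
   turns [K (1 ⊗ D(a') z)] into [(id ⊗ D)(V u) (1 ⊗ z)] by [rV_delta]. *)
Let rV_slice w c a : range V (idD C (@slice R T Y A w (idD C (delta c))) ** leg T Y a).
Proof.
set k := idD C (delta c); rewrite slice_id_tens -/k slice_mulr.
set K := idD Y k.
have key u : range V (@slice R T _ A w (K ** tri (mone Y) (memb u))).
  have b1 := blin_comp (blin_mull K) (blin_comp (blin_tri T A A (mone Y)) (@blin_memb R (A ⊗ A))).
  move: u; apply: (rV_ind nD); first exact: (blin_comp (blin_slice T _ w) b1).
  move=> _ [a' [z ->]].
  have -> : K ** tri (mone Y) (memb (lmul (D a') z)) =
      idD Y (k ** leg T Y a') ** tri (mone Y) (memb z).
    by rewrite id_tensM // id_tens_mtens // -amulA triM mul1m mul_memb.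
  have [u _ <-] := rV_delta c a'; move: u; apply: rV_tens.
    exact: (blin_comp (blin_slice T _ w) (blin_comp (blin_mulr _)
      (blin_comp (blin_id_tens hD nD Y) bV))).
  move=> g a1; rewrite tens_idE // id_tens_mtens // triM mulm1 mul_memb.
  exact: rV_slice_tri.
apply: approx_closed => // e e0; set k' := K ** _.
have k1 : 0 < `|k'| + 1 by rewrite ltr_wpDl.
have [b hb] := @slice_leg_approx R T (Y ⊗ A) A w _ (divr_gt0 e0 k1).
exists (@slice R T _ A w (k' ** leg T _ b)).
  rewrite /k' -amulA mtensM mulm1 mul1m -[leg T Y a]/(mtens T (mone Y) (memb a)).
  by rewrite -tri_mtens mtens_memb.
rewrite (le_lt_trans (hb _)) // -mulrA gtr_pMr // mulrC ltr_pdivrMr // mul1r.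
by rewrite ltrDl.
Qed.

Lemma dilation_alg_range g a : csub_set G g -> range V (idD C g ** leg T Y a).
Proof.
have bid := blin_id_tens hD nD C.
move=> Gg; suff : [set g | forall a, range V (idD C g ** leg T Y a)] g by apply.
move: g Gg; apply: dilation_alg_ind.
- rewrite (_ : mkset _ = \bigcap_a ((fun g => idD C g ** leg T Y a) @^-1` range V)); last first.
    by apply/seteqP; split=> g h a'; [move=> _; exact: h|exact: (h a' I)].
  apply: closed_bigI => a' _; apply: preimage_closed => //.
  have [l b] := blin_comp (blin_mulr (leg T Y a')) bid.
  by move=> g _; exact: (blin_continuous l b).
- by move=> a'; exists 0 => //; rewrite (lin0 bid.1) amul0l (lin0 bV.1).
- move=> k g h hg hh a'; rewrite bid.1 amulDl amulZl.
  have [u _ <-] := hg a'; have [v _ <-] := hh a'; exists (k *: u + v) => //.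
  by rewrite bV.1.
- move=> g h hg hh a'; rewrite id_tensM // -amulA.
  have [u _ <-] := hh a'; move: u; apply: rV_tens; first exact: (blin_comp (blin_mull _) bV).
  move=> g1 a1.
  (* With [1 ⊗ a1] on the left, the hypothesis on [g] at [a1] applies; the remaining right factor
     [g1 ⊗ 1] preserves the range of [V]. *)
  have -> : V (g1 ⊠ a1) = leg T Y a1 ** mtens T (val g1) (mone A).
    by rewrite tens_idE // mtensM mul1m mulm1.
  rewrite amulA; have [v _ <-] := hg a1; move: v; apply: rV_tens.
    exact: (blin_comp (blin_mulr _) bV).
  move=> g2 a2; exists ((g2 ** g1) ⊠ a2) => //.
  by rewrite !tens_idE // mtensM mulm1.
- exact: rV_delta.
- exact: rV_slice.
Qed.

Let rV_mull (g : GT) u : range V (idD C (val g) ** V u).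
Proof.
move: u; apply: rV_tens; first exact: (blin_comp (blin_mull _) bV).
move=> g1 a1.
have -> : V (g1 ⊠ a1) = leg T Y a1 ** mtens T (val g1) (mone A).
  by rewrite tens_idE // mtensM mul1m mulm1.
rewrite amulA; have [v _ <-] := dilation_alg_range a1 (csub_valP g); move: v; apply: rV_tens.
  exact: (blin_comp (blin_mulr _) bV).
move=> g2 a2; exists ((g2 ** g1) ⊠ a2) => //.
by rewrite !tens_idE // mtensM mulm1.
Qed.

Let rV_mulr (g : GT) u : range V (V u ** idD C (val g)).
Proof.
have [_ _ Vs] := hV; have [_ _ is_] := hid C.
have [v _ hv] := rV_mull (star g) (star u); exists (star v) => //.
by rewrite Vs hv starM -Vs starK -is_ -[val (star g)]/(star (val g)) starK.
Qed.

(** * The coaction on the dilation algebra *)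

Section Coaction.
Variable dG : GT -> 'M(GT ⊗ A).
Hypothesis dGP : forall g u, V (lmul (dG g) u) = idD C (val g) ** V u /\
  V (rmul (dG g) u) = V u ** idD C (val g).

Let dGl g u : V (lmul (dG g) u) = idD C (val g) ** V u. Proof. by case: (dGP g u). Qed.
Let dGr g u : V (rmul (dG g) u) = V u ** idD C (val g). Proof. by case: (dGP g u). Qed.

Lemma dilation_restricts : restricts_to D dG.
Proof.
move=> g a; have [y _ hy] := dilation_alg_range a (csub_valP g); exists y => //.
have [_ VM _] := hV.
apply: multiplier_lext => u; apply: iV; rewrite /= VM hy.
by rewrite -[RHS]/(V (lmul (dG g) (lmul (leg T GT a) u))) dGl tens_id_leg // amulA.
Qed.

Lemma dilation_star_hom : is_star_hom dG.
Proof.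
have [_ idM ids] := hid C; have [_ _ Vs] := hV; have bid := blin_id_tens hD nD C.
split.
- move=> k g h; apply: multiplier_lext => u; apply: iV.
  rewrite dGl -[lmul (k *: dG g + dG h) u]/(k *: lmul (dG g) u + lmul (dG h) u).
  by rewrite bV.1 !dGl bid.1 amulDl amulZl.
- move=> g h; apply: multiplier_lext => u; apply: iV.
  by rewrite /= !dGl idM amulA.
- move=> g; apply: multiplier_lext => u; apply: iV.
  by rewrite /= dGl Vs dGr starM -Vs starK -ids.
Qed.

Lemma dilation_inj : injective dG.
Proof.
have [dGlin _ _] := dilation_star_hom.
move=> g h gh; apply/eqP; rewrite -subr_eq0; apply/eqP; apply: csub_val_inj.
apply: id_tens_inj_dilation_alg; first exact: csub_valP.
apply: leg_eq0 => a; have [y hy <-] := dilation_restricts (g - h) a.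
have : memb y = 0 by rewrite hy (linB dGlin) gh subrr amul0l.
by move=> /(@memb_inj R _ y 0) ->; rewrite (lin0 bV.1).
Qed.

Let V2 := @tens_id R T A (GT ⊗ A) (Y ⊗ A) V.
Let hV2 : is_star_hom V2 := tens_id_star_hom T A hV.

(** Apply the injective [V2], that is [V ⊗ id]. The left side becomes [Omega], the extension of
    [(id ⊗ D) ⊗ id], at [V y]; by naturality for [val] the right side becomes [idD Y (idD C g)]
    times the leg. These agree by [id_tens_coassoc]. *)
Lemma dilation_coassoc g a y : memb y = dG g ** leg T GT a ->
  @tens_id R T A _ _ dG y = idD GT (dG g) ** leg T (GT ⊗ A) a.
Proof.
have hdG := dilation_star_hom; have bV2 := blin_star_hom T hV2.
have nC := id_tens_nondegenerate hD nD C; have hC := id_tens_memb_star_hom hD nD C.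
pose Omega := mext (@tens_id R T A _ _ (idD C \o @memb R Y)).
have hO : is_star_hom Omega.
  by case: (mextP T (nondegenerate_strict T (tens_id_star_hom T A hC)
    (tens_id_nondegenerate T A hC nC))).
have [_ OM _] := hO.
move=> hy; have [y0 hy0 Vy] := dilation_restricts g a.
have {hy0} yy0 : y0 = y by apply: memb_inj; rewrite hy hy0.
rewrite {}yy0 in Vy.
have lhs y' z : V2 (lmul (@tens_id R T A _ _ dG y') z) = Omega (V y') ** V2 z.
  move: y'; apply: tens_ext.
  - exact: (blin_comp bV2 (blin_comp (blin_lmul_at z) (blin_tens_id T A hdG))).
  - exact: (blin_comp (blin_mulr (V2 z)) (blin_comp (blin_star_hom T hO) bV)).
  move=> h b; move: z; apply: tens_ext.
  - exact: (blin_comp bV2 (blin_lmul _)).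
  - exact: (blin_comp (blin_mull _) bV2).
  move=> u b'; rewrite !tens_idE // mtensl /V2 !tens_idE // dGl /Omega.
  by rewrite mext_tens_id_mtens // mext_memb // mtensM mul_memb.
apply: multiplier_lext => z.
apply: (tens_id_inj hV iV); rewrite -/V2 lhs Vy OM.
rewrite -[lmul (_ ** _) z]/(lmul (idD GT (dG g)) (lmul (leg T (GT ⊗ A) a) z)).
rewrite /V2 (id_tens_natural hD nD hval (dGl g)) tens_id_leg // amulA.
rewrite /Omega -id_tens_coassoc //; congr (_ ** _ ** _).
by rewrite mext_tens_id_mtens // mext1.
Qed.

Lemma dilation_coaction : is_coaction D dG.
Proof.
split; [exact: dilation_star_hom|exact: dilation_inj| |exact: dilation_coassoc].
by move=> g a; have [y hy _] := dilation_restricts g a; exists y.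
Qed.

Variable i : C -> GT.
Hypothesis iE : forall c, val (i c) = delta c.

Lemma dilation_is_dilation : is_dilation D delta dG i.
Proof.
have [dl dM ds] := hdelta; have [_ VM _] := hV.
have hi : is_star_hom i.
  split=> [k c c'|c c'|c]; apply: csub_val_inj; rewrite iE.
  - by rewrite dl -!iE.
  - by rewrite dM -!iE.
  - by rewrite ds -!iE.
have hmi : is_star_hom (@memb R GT \o i) by apply: star_hom_comp => //; exact: memb_star_hom.
split=> //; first exact: dilation_coaction.
  by move=> c c' cc'; apply: delta_inj; rewrite -!iE cc'.
move=> c c' a.
(* Composing [i ⊗ id] with the inclusion [V] gives [tau], because [val \o i] is [delta]. The
   dilation identity thus becomes [tau_lmul] for [delta c]. *)
have VE v u : V (lmul (@tens_id R T A _ _ (@memb R GT \o i) v) u) = tau v ** V u.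
  move: v; apply: tens_ext.
  - exact: (blin_comp bV (blin_comp (blin_lmul_at u) (blin_tens_id T A hmi))).
  - exact: (blin_comp (blin_mulr (V u)) (blin_star_hom T htau)).
  move=> x b; move: u; apply: tens_ext.
  - exact: (blin_comp bV (blin_lmul _)).
  - exact: (blin_comp (blin_mull _) bV).
  move=> g b'; rewrite !tens_idE // mtensl !tens_idE // mtensM mul_memb.
  by rewrite -iE.
apply: multiplier_lext => u; apply: iV; rewrite VE /= VM dGl.
rewrite tens_idE // iE (tau_lmul _ (dilation_alg_delta c)) tens_idE //.
by rewrite -[csub_val (i c')]/(val (i c')) iE.
Qed.

Lemma dilation_slice w c (g : GT) : val g = @slice R T Y A w (idD C (delta c)) ->
  @slice R T GT A w (dG (i c)) = memb g.
Proof.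
move=> gE; have FA := aunit_proper T A.
have bval := blin_star_hom T hval.
apply: multiplier_lext => h; apply: csub_val_inj.
rewrite -[val (lmul (memb g) h)]/(val g ** val h) gE.
apply: multiplier_lext => x.
have h1 := @blin_cvg _ _ _ _ _ _ _ _ FA (blin_comp (blin_lmul_at x) bval)
  (@slice_cvg R T GT A w (dG (i c)) h).
have h2 := @slice_cvg R T Y A w (idD C (delta c)) (lmul (val h) x).
apply: (@cvg_unique _ (@norm_hausdorff _ _) _ _ _ _ h1).
move: h2; rewrite (_ : (fun _ => _) = ((fun m => lmul m x) \o val) \o
    (fun e => @slice0 R T GT A w (lmul (dG (i c)) (h ⊠ e)))) //.
apply/funext => e /=.
by rewrite (slice0_hom w _ hval) dGl iE tens_idE // slice_mul_mtens.
Qed.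

Lemma dilation_minimal : is_minimal_dilation D delta dG i.
Proof.
split; first exact: dilation_is_dilation.
have hm := memb_star_hom GT; have im := @memb_inj R GT.
set X := (X in cgen X).
have sliceX w c : csub_set (cgen X) (@slice R T GT A w (dG (i c))).
  by apply: sub_cgen; right; exists w, c.
have iX c : csub_set (cgen X) (memb (i c)) by apply: sub_cgen; left; exists c.
apply/seteqP; split.
  apply: cgen_sub; first exact: (range_star_hom_cstar_sub T hm im (setT_cstar_sub _)).
  move=> _ [[c _ <-]|[w [c ->]]]; first by exists (i c).
  exists (CStarSubElt (dilation_alg_slice w c)) => //.
  by rewrite (@dilation_slice w c (CStarSubElt (dilation_alg_slice w c))).
move=> _ [g _ <-].
(* The elements of [GT] lying in the generated algebra form a subalgebra whose image under [val]
   contains the generators of [G], hence all of [G]. *)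
have Xm : is_cstar_sub [set h : GT | csub_set (cgen X) (memb h)].
  have [Xc [X0 Xl] XM Xs] := csubP (cgen X); have [ml mM ms] := hm; split.
  - apply: preimage_closed => //; have [l b] := @blin_memb R GT.
    by move=> h _; exact: (blin_continuous l b).
  - split; first by rewrite /= (lin0 ml).
    by move=> k a b /= ha hb; rewrite ml; exact: Xl.
  - by move=> a b /= ha hb; rewrite mM; exact: XM.
  - by move=> a /= ha; rewrite ms; exact: Xs.
have : (val @` [set h : GT | csub_set (cgen X) (memb h)]) (val g).
  apply: (cgen_sub (range_star_hom_cstar_sub T hval (@csub_val_inj R _ G) Xm) _ (csub_valP g)).
  move=> _ [[w [c ->]]|[c _ <-]].
    exists (CStarSubElt (dilation_alg_slice w c)) => //=.
    rewrite -(@dilation_slice w c (CStarSubElt (dilation_alg_slice w c))) //.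
    exact: sliceX.
  by exists (i c) => //=; exact: iX.
by move=> [h /= hX /csub_val_inj <-].
Qed.

End Coaction.

Lemma dilation_exists :
  exists (dG : GT -> 'M(GT ⊗ A)) (i : C -> GT),
    [/\ restricts_to D dG, is_coaction D dG, forall c, val (i c) = delta c
      & is_minimal_dilation D delta dG i].
Proof.
have /choice[dG dGP] : forall g : GT, exists n : 'M(GT ⊗ A),
    forall u, V (lmul n u) = idD C (val g) ** V u /\ V (rmul n u) = V u ** idD C (val g).
  move=> g; exact: (multiplier_of_range T hV iV (rV_mull g) (rV_mulr g)).
exists dG, (fun c => CStarSubElt (dilation_alg_delta c)); split=> //.
- exact: dilation_restricts.
- exact: dilation_coaction.
- exact: dilation_minimal.
Qed.

End Dilation.

Theorem theorem9p6 (R : realType) (T : tensor_products R)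
    (A : cstarType R) (Delta : A -> 'M(ctens T A A))
    (bialgA : is_bialgebra Delta)
    (sliceA : slice_map_property T A)
    (C : cstarType R) (delta : C -> 'M(ctens T C A))
    (delta_pc : is_partial_coaction Delta delta)
    (delta_inj : injective delta)
    (delta_reg : is_regular Delta delta) :
  exists (dG : cstar_sub_type (dilation_alg Delta delta) ->
               'M(ctens T (cstar_sub_type (dilation_alg Delta delta)) A))
         (i : C -> cstar_sub_type (dilation_alg Delta delta)),
    [/\ restricts_to Delta dG,
        is_coaction Delta dG,
        forall c, csub_val (i c) = delta c
      & is_minimal_dilation Delta delta dG i].
Proof. exact: (dilation_exists bialgA sliceA delta_pc delta_inj delta_reg). Qed.
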